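(* Let $2\le e\le n$ be integers and let $C\subset\mathbb{P}^n$ be the rational normal curve of degree $e$. (a) Let $a_1,\dots,a_{e-2}\ge0$ and $b_{e+1},\dots,b_n\ge0$ be integers with $\sum_{i=1}^{e-2}a_i+\sum_{j=e+1}^{n}b_j=e-2$, and let $$E=\left(\bigoplus_{i=1}^{e-2}\mathcal{O}(e+2-a_i)\right)\oplus\left(\bigoplus_{j=e+1}^{n}\mathcal{O}(e-b_j)\right).$$ Then there is a quadric hypersurface $X=V(F)\subset\mathbb{P}^n$ containing $C$, smooth along $C$, with $N_{C/X}\cong E$. Explicitly, arrange the $a_i$ in non-decreasing order, let $y$ be the number of indices with $a_i=0$ (so $0=a_y<a_{y+1}\le\cdots\le a_{e-2}$), and put $\beta_0=0$ and $\beta_i=a_{y+1}+\cdots+a_{y+i}$ for $i=1,\dots,e-2-y$. If $e=n$, one may take $$F=\sum_{i=0}^{n-2-y}Q_{\beta_i+1,\beta_i+2}.$$ If $e<n$, put also $\gamma_n=e$ and $\gamma_j=e-b_n-b_{n-1}-\cdots-b_{j+1}$ for $e+1\le j\le n-1$; then one may take $$F=\sum_{i=0}^{e-2-y}Q_{\beta_i+1,\beta_i+2}+\sum_{j=e+1}^{n}x_{\gamma_j}x_j .$$ (b) Let $X\subset\mathbb{P}^n$ be a quadric hypersurface containing $C$ and smooth along $C$ such that the splitting type of $N_{C/X}$ contains $e-1$ summands of degree greater than $e$. Then $e<n-1$, the normal bundle $N_{C/X}$ is isomorphic to a bundle of the form $$E'=\mathcal{O}(e+2)^{e-1}\oplus\left(\bigoplus_{j=e+2}^{n}\mathcal{O}(e-b_j)\right)$$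 with integers $b_j\ge0$ and $\sum_{j=e+2}^{n}b_j=e$, and $X$ contains the $e$-plane spanned by $C$. Conversely, if $e<n-1$, then for every such $E'$ there is a quadric $X$ containing $C$, smooth along $C$, with $N_{C/X}\cong E'$: explicitly, with $\gamma_n=e$ and $\gamma_j=e-b_n-b_{n-1}-\cdots-b_{j+1}$ for $e+1\le j\le n-1$, one may take $X=V(F)$ where $$F=\sum_{j=e+1}^{n}x_{\gamma_j}x_j .$$
   Context: We work over an algebraically closed field $K$ of arbitrary characteristic, with homogeneous coordinates $x_0,\dots,x_n$ on $\mathbb{P}^n$. The rational normal curve of degree $e\le n$ in $\mathbb{P}^n$ is the image $C$ of $\mathbb{P}^1\to\mathbb{P}^n$, $(s:t)\mapsto(s^e:s^{e-1}t:\cdots:st^{e-1}:t^e:0:\cdots:0)$. For $1\le i<j\le e$, $Q_{i,j}=x_ix_{j-1}-x_{i-1}x_j$. A hypersurface $X$ containing $C$ is smooth along $C$ if no point of $C$ is a singular point of $X$. The normal bundle $N_{C/X}$ is regarded as a vector bundle on $\mathbb{P}^1\cong C$, and $\mathcal{O}(k)=\mathcal{O}_{\mathbb{P}^1}(k)$. Empty sums are $0$ and empty direct sums are zero. *)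

(* Defs.v *)
From mathcomp Require Import all_boot all_order all_algebra.
From mathcomp Require Import mpoly.

Set Implicit Arguments.
Unset Strict Implicit.
Unset Printing Implicit Defensive.

Import GRing.Theory.
Local Open Scope ring_scope.

(* Homogeneous coordinate vectors are functions 'I_m -> K.  The homogeneous
   coordinates s, t on P^1 are 'X_ord0 and 'X_ord_max in {mpoly K[2]}. *)

Section ProjectiveLine.
Variable K : fieldType.

Definition bform := {mpoly K[2]}.

(* Every homogeneous rational function in s, t lives in the field K(s,t). *)
Definition ratfun := {fraction bform}.

Definition is_pt (m : nat) (p : 'I_m -> K) : Prop := exists i, p i != 0.

(* Nonempty Zariski-open subsets of P^1 (complements of common zero loci of
   families of forms), as scaling-invariant sets of nonzero vectors.  The empty
   set is left out: there the sections of every sheaf are 0 and carry no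
   information. *)
Definition zopen (U : ('I_2 -> K) -> Prop) : Prop :=
  (exists S : bform -> Prop,
     (forall g, S g -> exists d, g \is d.-homog) /\
     (forall p, U p <-> is_pt p /\ exists g, S g /\ g.@[p] != 0)) /\
  (exists p, U p).

(* z is a section of O(k) over U: near every point of U it is a quotient of
   forms with degree difference k whose denominator does not vanish there. *)
Definition Osec (k : int) (U : ('I_2 -> K) -> Prop) (z : ratfun) : Prop :=
  forall p, U p ->
    exists (a b : bform) (da db : nat),
      [/\ a \is da.-homog, b \is db.-homog, da%:Z = db%:Z + k,
          b.@[p] != 0 & z = tofrac a / tofrac b].

(* A sheaf of O_{P^1}-modules given as a subsheaf of the constant sheaf of
   functions idx -> K(s,t), with pointwise operations; restriction maps are
   inclusions.  The closure and gluing conditions are not part of the record;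
   they hold for both sheaves considered below. *)
Record omodule := OModule {
  idx : Type;
  sec : (('I_2 -> K) -> Prop) -> (idx -> ratfun) -> Prop
}.
Arguments sec : clear implicits.

(* Isomorphism of sheaves of O_{P^1}-modules: O(U)-linear bijections
   M(U) -> N(U), compatible with restrictions. *)
Definition omod_iso (M N : omodule) : Prop :=
  exists psi : (('I_2 -> K) -> Prop) -> (idx M -> ratfun) -> (idx N -> ratfun),
    (forall U, zopen U ->
      [/\ forall v, sec M U v -> sec N U (psi U v),
          forall g v w, Osec 0 U g -> sec M U v -> sec M U w ->
            psi U (fun i => g * v i + w i)
              = (fun j => g * psi U v j + psi U w j),
          forall v w, sec M U v -> sec M U w -> psi U v = psi U w -> v = w
        & forall u, sec N U u -> exists2 v, sec M U v & psi U v = u]) /\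
    (forall U V, zopen U -> zopen V -> (forall p, U p -> V p) ->
       forall v, sec M V v -> psi U v = psi V v).

(* O(d_1) (+) ... (+) O(d_r); the zero bundle when d is empty *)
Definition split_bundle (d : seq int) : omodule :=
  OModule (fun U (v : 'I_(size d) -> ratfun) =>
             forall i : 'I_(size d), Osec d`_i U (v i)).

End ProjectiveLine.

Section RationalNormalCurve.
Variables (K : fieldType) (e n : nat).

Definition rnc_coord (R : pzRingType) (s t : R) (i : 'I_n.+1) : R :=
  if (i <= e)%N then s ^+ (e - i) * t ^+ i else 0.

Definition on_curve (p : 'I_n.+1 -> K) : Prop :=
  exists (st : 'I_2 -> K) (c : K),
    [/\ is_pt st, c != 0 &
        forall i, p i = c * rnc_coord (st ord0) (st ord_max) i].

Definition in_curve_ideal (G : {mpoly K[n.+1]}) : Prop :=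
  forall p, on_curve p -> G.@[p] = 0.

Definition curve_ideal := {G : {mpoly K[n.+1]} | in_curve_ideal G}.

(* Linear span of C, as the affine cone over it. *)
Definition in_curve_span (p : 'I_n.+1 -> K) : Prop :=
  exists (m : nat) (c : 'I_m -> K) (q : 'I_m -> 'I_n.+1 -> K),
    (forall k, on_curve (q k)) /\
    (forall i, p i = \sum_(k < m) c k * q k i).

Definition is_quadric (F : {mpoly K[n.+1]}) : Prop :=
  F != 0 /\ F \is 2.-homog.

Definition contains_curve (F : {mpoly K[n.+1]}) : Prop :=
  forall p, on_curve p -> F.@[p] = 0.

Definition contains_curve_span (F : {mpoly K[n.+1]}) : Prop :=
  forall p, in_curve_span p -> F.@[p] = 0.

Definition singular_pt (F : {mpoly K[n.+1]}) (p : 'I_n.+1 -> K) : Prop :=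
  F.@[p] = 0 /\ forall i, (F^`M(i)).@[p] = 0.

Definition smooth_along_curve (F : {mpoly K[n.+1]}) : Prop :=
  forall p, on_curve p -> ~ singular_pt F p.

(* Pullback of polynomials along P^1 -> C. *)
Definition rnc_pullback (A : {mpoly K[n.+1]}) : bform K :=
  A \mPo [tuple rnc_coord ('X_ord0 : bform K) 'X_ord_max i | i < n.+1].

(* N_{C/X} = Hom(I/I^2, O_C), with I the ideal sheaf of C in X = V(F).  Write R
   for the coordinate ring of P^n and I_C for the homogeneous ideal of C, so
   that I is the sheaf of I_C / (F).  Sheaf homomorphisms I/I^2 -> O_C over an
   open U of C are homomorphisms from the sheaf of I_C to O_U killing F (those
   to an O_C-module kill I_C^2), hence, since the sheaf associated with a graded
   module is left adjoint to twisted sections, they are the degree-preserving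
   R-linear maps from I_C to the direct sum of the
     H^0(U, O_{P^n}(m)|_C) = H^0(U, O_{P^1}(e m))
   that kill F.  R-linearity is expressed without naming the module operations
   of I_C: phi L = A phi G + phi H whenever L = A G + H. *)
Definition normal_bundle (F : {mpoly K[n.+1]}) : omodule K :=
  OModule (fun U (phi : curve_ideal -> ratfun K) =>
    [/\ forall (A : {mpoly K[n.+1]}) (G H L : curve_ideal),
          sval L = A * sval G + sval H ->
          phi L = tofrac (rnc_pullback A) * phi G + phi H,
        forall (m : nat) (G : curve_ideal),
          sval G \is m.-homog -> Osec (e * m)%N%:Z U (phi G)
      & forall G : curve_ideal, sval G = F -> phi G = 0]).

(* V(F) is a quadric containing C, smooth along C, whose normal bundle has
   splitting type d. *)
Definition realizes (F : {mpoly K[n.+1]}) (d : seq int) : Prop :=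
  [/\ is_quadric F, contains_curve F, smooth_along_curve F
    & omod_iso (normal_bundle F) (split_bundle K d)].

(* inord is only applied to indices at most n in the formulas below. *)
Definition xvar (i : nat) : {mpoly K[n.+1]} := 'X_(inord i).

Definition Qform (i j : nat) : {mpoly K[n.+1]} :=
  xvar i * xvar j.-1 - xvar i.-1 * xvar j.

End RationalNormalCurve.

Section Indices.
Variables (e n : nat).

(* a_1, ..., a_{e-2} in non-decreasing order *)
Definition sorted_a (a : nat -> nat) : seq nat :=
  sort leq [seq a i | i <- index_iota 1 e.-1].

Definition num_zero (a : nat -> nat) : nat := count_mem 0%N (sorted_a a).

(* beta_i = a_{y+1} + ... + a_{y+i}; the k-th sorted term is nth 0 _ k.-1 *)
Definition beta (a : nat -> nat) (i : nat) : nat :=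
  \sum_(1 <= k < i.+1) nth 0%N (sorted_a a) (num_zero a + k).-1.

(* gamma_n = e is the case of an empty sum.  The subtraction never truncates
   under the constraints imposed on b. *)
Definition gamma (b : nat -> nat) (j : nat) : nat :=
  e - \sum_(j.+1 <= k < n.+1) b k.

Definition E_degrees (a b : nat -> nat) : seq int :=
  [seq (e.+2)%:Z - (a i)%:Z | i <- index_iota 1 e.-1] ++
  [seq e%:Z - (b j)%:Z | j <- index_iota e.+1 n.+1].

Definition E'_degrees (b : nat -> nat) : seq int :=
  nseq e.-1 (e.+2)%:Z ++
  [seq e%:Z - (b j)%:Z | j <- index_iota e.+2 n.+1].

End Indices.

(* Main.v *)
Require Import Defs.
From mathcomp Require Import all_boot all_order all_algebra.
From mathcomp Require Import perm mpoly.
From mathcomp Require Import ring zify.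
From Stdlib Require Import FunctionalExtensionality ProofIrrelevance ClassicalEpsilon.

Set Implicit Arguments.
Unset Strict Implicit.
Unset Printing Implicit Defensive.

Import Order.TTheory GRing.Theory Num.Theory.
Local Open Scope ring_scope.

(** The normal bundle of C in P^n is O(e+2)^(e-1) + O(e)^(n-e). Indeed a vector
    field v along C acts on Q_{i,i+1} as a monomial times a second difference

      w_i = 2 s t v_i - s^2 v_{i+1} - t^2 v_{i-1},

    which vanishes for all i exactly when the part of v in the span of C is tangent to
    the cone over C, and it acts on x_j, j > e, as v_j. A homomorphism on the ideal of C is
    determined by its values on the Q_{i,i+1} and the x_j (ideal_hom_ext), and every
    (w, v) comes from a vector field without poles on either chart, because the
    second difference can be inverted by summation from both ends of the index
    range. A quadric F through C turns a normal vector field into a section of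
    O(2e), and the normal bundle of C in V(F) is the kernel of this map
    (normal_sheaf_ker).

    For the explicit quadrics the map is given on each summand by 0 or by a monomial
    in s and t, and the summands with a monomial can be ordered so that the
    exponents of t increase while those of s decrease. The syzygies between consecutive monomials are a
    basis of the kernel (chain_kernel_split), and their degrees are read off from
    the differences of the exponents (betas_degrees, gamma_degrees). The chain
    starts with a power of s and ends with a power of t, whence smoothness along C
    (chain_form_smooth).

    Conversely, let the normal bundle have at least e - 1 summands of degree
    greater than e. They cannot map to the summands O(e), so they embed in
    O(e+2)^(e-1) and span it generically; hence F acts as 0 on these coordinates
    (row_head_eq0). This means that the derivatives of F in the directions of the
    span of C vanish along C, so F vanishes on the span (contains_span). Then
    O(e+2)^(e-1) is contained in the normal bundle, which forces the large degrees
    to equal e + 2 (split_top_degrees); as the other summands have degree at most e,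
    the rank and the degree of the kernel (split_degree) give the rest. The degree
    is computed by a determinant, using that a nonzero global section of O(k) exists
    only for k >= 0 (global_Oreg_neg). *)

(** * Sections of O(k) near a point *)

Section LocalSections.
Variables (K T : fieldType) (fr : {rmorphism bform K -> T}).
Hypothesis fr_inj : injective fr.
Implicit Types (p : 'I_2 -> K) (z : T) (a b : bform K).

Definition sv : T := fr 'X_ord0.
Definition tv : T := fr 'X_ord_max.

(** Regularity at p of a rational section of O(k). All that matters about the
    field of rational functions is that it contains the binary forms; it is an
    abstract T here, and K(s,t) in the theorem. *)
Definition Oreg (k : int) p z : Prop :=
  exists (a b : bform K) (da db : nat),
    [/\ a \is da.-homog, b \is db.-homog, da%:Z = db%:Z + k,
        b.@[p] != 0 & z = fr a / fr b].

Lemma fr_neq0 a : a != 0 -> fr a != 0.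
Proof. by rewrite -(rmorph0 fr) (inj_eq fr_inj). Qed.

Lemma meval_neq0 p a : a.@[p] != 0 -> a != 0.
Proof. by apply: contraNneq => ->; rewrite meval0. Qed.

Lemma mpolyX1_neq0 n (i : 'I_n) : 'X_i != 0 :> {mpoly K[n]}.
Proof.
by apply/eqP => /(congr1 (mcoeff U_(i))); rewrite mcoeffX eqxx mcoeff0 => /eqP; rewrite oner_eq0.
Qed.

Lemma sv_neq0 : sv != 0.
Proof. exact/fr_neq0/mpolyX1_neq0. Qed.

Lemma tv_neq0 : tv != 0.
Proof. exact/fr_neq0/mpolyX1_neq0. Qed.

Lemma dhomog_var n (i : 'I_n) : ('X_i : {mpoly K[n]}) \is 1.-homog.
Proof. by rewrite dhomogX /= mdeg1. Qed.

Lemma is_ptP p : is_pt p -> p ord0 != 0 \/ p ord_max != 0.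
Proof.
case=> i hi; case: (eqVneq i ord0) hi => [->|ne] hi; first by left.
right; suff -> : ord_max = i by [].
by apply: val_inj => /=; move: ne; case: i hi => [[|[|]]].
Qed.

Lemma Oreg_form d p a : a \is d.-homog -> Oreg d%:Z p (fr a).
Proof.
move=> ha; exists a, 1, d, 0%N.
by rewrite dhomog1 meval1 oner_neq0 rmorph1 divr1 add0r.
Qed.

Lemma OregM k l p z w : Oreg k p z -> Oreg l p w -> Oreg (k + l) p (z * w).
Proof.
move=> [a [b [da [db [ha hb e hp ->]]]]] [a' [b' [da' [db' [ha' hb' e' hp' ->]]]]].
exists (a * a'), (b * b'), (da + da')%N, (db + db')%N; split.
- exact: dhomogM.
- exact: dhomogM.
- by rewrite !PoszD e e' addrACA.
- by rewrite mevalM mulf_neq0.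
- by rewrite !rmorphM invfM mulrACA.
Qed.

Lemma OregD k p z w : Oreg k p z -> Oreg k p w -> Oreg k p (z + w).
Proof.
move=> [a [b [da [db [ha hb e hp ->]]]]] [a' [b' [da' [db' [ha' hb' e' hp' ->]]]]].
exists (a * b' + a' * b), (b * b'), (da + db')%N, (db + db')%N; split.
- apply: dhomogD; first exact: dhomogM.
  by have -> : (da + db')%N = (da' + db)%N; [lia | exact: dhomogM].
- exact: dhomogM.
- by rewrite !PoszD e addrAC.
- by rewrite mevalM mulf_neq0.
- rewrite rmorphD !rmorphM addf_div //; apply: fr_neq0.
  exact: meval_neq0 hp.
  exact: meval_neq0 hp'.
Qed.

Lemma Oreg1 p : Oreg 0 p 1.
Proof. by rewrite -(rmorph1 fr); apply: (Oreg_form _ (dhomog1 _ _)). Qed.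

Lemma OregN k p z : Oreg k p z -> Oreg k p (- z).
Proof.
move=> hz; rewrite -mulN1r -[k]add0r; apply: OregM => //.
by rewrite -(rmorph1 fr) -rmorphN; apply: Oreg_form; rewrite dhomogN dhomog1.
Qed.

Lemma OregB k p z w : Oreg k p z -> Oreg k p w -> Oreg k p (z - w).
Proof. by move=> hz hw; apply/OregD/OregN. Qed.

Lemma Oreg_formV d p a : a \is d.-homog -> a.@[p] != 0 -> Oreg (- d%:Z) p (fr a)^-1.
Proof.
move=> ha hp; exists 1, a, 0%N, d.
by rewrite dhomog1 rmorph1 mul1r subrr.
Qed.

Lemma OregX k p z j : Oreg k p z -> Oreg (k * j%:Z) p (z ^+ j).
Proof.
move=> hz; elim: j => [|j IHj]; first by rewrite expr0 mulr0; apply: Oreg1.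
by rewrite exprS; have -> : k * j.+1%:Z = k + k * j%:Z; [lia | apply: OregM].
Qed.

Lemma Oreg_exprz d p a (k : int) : a \is d.-homog -> a.@[p] != 0 ->
  Oreg (d%:Z * k) p (fr a ^ k).
Proof.
move=> ha hp; case: k => k; first exact/OregX/Oreg_form.
by rewrite NegzE mulrN -mulNr -exprz_inv; apply/OregX/Oreg_formV.
Qed.

Lemma Oreg_svz p k : p ord0 != 0 -> Oreg k p (sv ^ k).
Proof.
move=> hp; rewrite -[k in Oreg k]mul1r; apply: Oreg_exprz; first exact: dhomog_var.
by rewrite mevalXU.
Qed.

Lemma Oreg_tvz p k : p ord_max != 0 -> Oreg k p (tv ^ k).
Proof.
move=> hp; rewrite -[k in Oreg k]mul1r; apply: Oreg_exprz; first exact: dhomog_var.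
by rewrite mevalXU.
Qed.

Lemma Oreg_svX p j : Oreg j%:Z p (sv ^+ j).
Proof. by rewrite -[j%:Z]mul1r; apply/OregX/Oreg_form/dhomog_var. Qed.

Lemma Oreg_tvX p j : Oreg j%:Z p (tv ^+ j).
Proof. by rewrite -[j%:Z]mul1r; apply/OregX/Oreg_form/dhomog_var. Qed.

(** For negative k the fraction 0 needs a denominator of positive degree: a power
    of a coordinate that is nonzero at the point. *)
Lemma Oreg0 k p : is_pt p -> Oreg k p 0.
Proof.
move=> /is_ptP[] hp.
- rewrite -(subrr (sv ^ k)); apply: OregB; exact: Oreg_svz.
- rewrite -(subrr (tv ^ k)); apply: OregB; exact: Oreg_tvz.
Qed.

Lemma Oreg_int p (m : int) : is_pt p -> Oreg 0 p m%:~R.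
Proof.
move=> hp; have h0 j : Oreg 0 p (j%:R : T).
  by elim: j => [|j IHj]; [apply: Oreg0 | rewrite mulrS; apply: OregD => //; apply: Oreg1].
by case: m => m; [exact: h0 | rewrite NegzE mulrNz; apply: OregN (h0 _)].
Qed.

Lemma Oreg_sum (J : Type) (r : seq J) (P : pred J) (f : J -> T) k p :
  is_pt p -> (forall j, P j -> Oreg k p (f j)) -> Oreg k p (\sum_(j <- r | P j) f j).
Proof.
move=> hp hf; elim/big_ind: _ => //; first exact: Oreg0.
by move=> z w; apply: OregD.
Qed.

Lemma Oreg_prod (J : Type) (r : seq J) (f : J -> T) (k : J -> int) p :
  (forall j, Oreg (k j) p (f j)) -> Oreg (\sum_(j <- r) k j) p (\prod_(j <- r) f j).
Proof.
move=> hf; elim: r => [|j r IHr]; first by rewrite !big_nil; apply: Oreg1.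
by rewrite !big_cons; apply: OregM.
Qed.

(** A matrix of sections of O(r i - c j) is a map between sums of line
    bundles; its determinant is a section of the determinant line bundle. *)
Lemma Oreg_det m (M : 'M[T]_m) (r c : 'I_m -> int) p : is_pt p ->
  (forall i j, Oreg (r i - c j) p (M i j)) ->
  Oreg (\sum_i r i - \sum_j c j) p (\det M).
Proof.
move=> hp hM; apply: Oreg_sum => // s _; rewrite -[k in Oreg k]add0r; apply: OregM.
  rewrite -[0](mul0r (Posz (odd_perm s))); apply/OregX/OregN/Oreg1.
have -> : \sum_i r i - \sum_j c j = \sum_i (r i - c (s i)).
  by rewrite sumrB; congr (_ - _); rewrite (reindex_inj (@perm_inj _ s)).
exact: Oreg_prod.
Qed.

Lemma zopen_pt (U : ('I_2 -> K) -> Prop) : zopen U -> forall p, U p -> is_pt p.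
Proof. by move=> [[S [_ hU]] _] p /hU[]. Qed.

Definition nonvanishing a : ('I_2 -> K) -> Prop := fun p => is_pt p /\ a.@[p] != 0.

Lemma zopen_nonvanishing a d p : a \is d.-homog -> is_pt p -> a.@[p] != 0 ->
  zopen (nonvanishing a).
Proof.
move=> ha hp hap; split; last by exists p.
exists (fun g => g = a); split=> [g ->|q]; first by exists d.
split=> [[hq hq']|[hq [g [-> hg]]]]; last by split.
by split=> //; exists a.
Qed.

End LocalSections.

(** * Global sections of O(k) *)

Lemma mulf_divK (F : fieldType) (k d a b : F) : d != 0 -> b != 0 ->
  k * d * a / (d * b) * b = k * a.
Proof. by move=> hd hb; field; rewrite hb hd. Qed.

Section GlobalSections.
Variables (K : closedFieldType) (T : fieldType) (fr : {rmorphism bform K -> T}).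
Hypothesis fr_inj : injective fr.
Implicit Types (p : 'I_2 -> K) (z : T) (a b : bform K) (P Q : {poly K}).

Lemma closed_poly_eq0 P : (forall x, P.[x] = 0) -> P = 0.
Proof.
by move=> hP; apply/eqP/negPn/negP => /closed_nonrootP[x]; rewrite rootE hP eqxx.
Qed.

Definition affine_pt (x : K) : 'I_2 -> K := fun i => if i == ord0 then 1 else x.
Definition infty_pt : 'I_2 -> K := fun i => if i == ord0 then 0 else 1.

Lemma is_pt_affine x : is_pt (affine_pt x).
Proof. by exists ord0; rewrite /affine_pt eqxx oner_neq0. Qed.

Lemma is_pt_infty : is_pt infty_pt.
Proof. by exists ord_max; rewrite /infty_pt /= oner_neq0. Qed.

Definition dehom a : {poly K} := \sum_(m <- msupp a) a@_m *: 'X^(m ord_max).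

Definition ratconst : {rmorphism K -> T} := fr \o @mpolyC 2 K.

(** The embedding of K(x) in T that sends x to the slope t/s. *)
Definition slope_eval P : T := (map_poly ratconst P).[(tv fr) / (sv fr)].

Lemma slope_evalM P Q : slope_eval (P * Q) = slope_eval P * slope_eval Q.
Proof. by rewrite /slope_eval rmorphM hornerM. Qed.

Lemma slope_evalB P Q : slope_eval (P - Q) = slope_eval P - slope_eval Q.
Proof. by rewrite /slope_eval rmorphB hornerD hornerN. Qed.

Lemma big_ord2 (R : Type) (idx : R) (op : Monoid.law idx) (F : 'I_2 -> R) :
  \big[op/idx]_(i < 2) F i = op (F ord0) (F ord_max).
Proof.
rewrite big_ord_recl big_ord1; congr (op _ (F _)); exact: val_inj.
Qed.

Lemma fr_dehom a d : a \is d.-homog -> fr a = (sv fr) ^+ d * slope_eval (dehom a).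
Proof.
move=> /dhomogP ha; rewrite {1}(mpolyE a) /slope_eval /dehom !rmorph_sum horner_sum mulr_sumr.
apply: eq_big_seq => m hm /=.
rewrite map_polyZ map_polyXn hornerZ hornerXn -mul_mpolyC rmorphM /= mulrCA; congr (_ * _).
have := ha m hm; rewrite /= mdegE big_ord2 => <-.
rewrite mpolyXE_id big_ord2 rmorphM !rmorphXn expr_div_n exprD /=.
by rewrite -/((sv fr)) -/((tv fr)) -mulrA [_ * (_ / _)]mulrC divfK // expf_neq0 // (sv_neq0 fr_inj).
Qed.

Lemma size_dehom a d : a \is d.-homog -> (size (dehom a) <= d.+1)%N.
Proof.
move=> /dhomogP ha; apply: leq_trans (size_sum _ _ _) _.
apply/bigmax_leqP_seq => m hm _; apply: leq_trans (size_scale_leq _ _) _.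
by have := ha m hm; rewrite size_polyXn ltnS /= mdegE big_ord2 => <-; rewrite leq_addl.
Qed.

Lemma horner_dehom a x : (dehom a).[x] = a.@[affine_pt x].
Proof.
rewrite mevalE /dehom horner_sum; apply: eq_bigr => m _.
by rewrite hornerZ hornerXn big_ord2 /affine_pt /= expr1n mul1r.
Qed.

Lemma coef_dehom a d : a \is d.-homog -> (dehom a)`_d = a.@[infty_pt].
Proof.
move=> /dhomogP ha; rewrite mevalE /dehom coef_sum; apply: eq_big_seq => m hm.
rewrite coefZ coefXn big_ord2 /infty_pt /= expr1n mulr1; congr (_ * _).
have := ha m hm; rewrite /= mdegE big_ord2 => <-; rewrite -{2}[m ord_max]add0n eqn_add2r.
by case: (m ord0) => [|j]; rewrite ?expr0 // exprS mul0r.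
Qed.

(** The slope t/s is transcendental over the constants: clearing denominators
    in P(t/s) gives a form whose value at (1:x) is P(x). *)
Lemma slope_eval_eq0 P : slope_eval P = 0 -> P = 0.
Proof.
move=> h0; apply: closed_poly_eq0 => x.
pose N := size P.
pose a : bform K := \sum_(i < N) P`_i *: ('X_ord0 ^+ (N - i) * 'X_ord_max ^+ i).
have ha : fr a = (sv fr) ^+ N * slope_eval P.
  rewrite /a /slope_eval rmorph_sum /= horner_coef size_map_poly mulr_sumr.
  apply: eq_bigr => i _; rewrite -mul_mpolyC rmorphM /= coef_map /= mulrCA; congr (_ * _).
  rewrite rmorphM !rmorphXn /= -/((sv fr)) -/((tv fr)) expr_div_n.
  have -> : (sv fr) ^+ N = (sv fr) ^+ (N - i) * (sv fr) ^+ i.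
    by rewrite -exprD subnK // ltnW // ltn_ord.
  by rewrite -mulrA [_ * (_ / _)]mulrC divfK // expf_neq0 // (sv_neq0 fr_inj).
have {ha} : a = 0 by apply: fr_inj; rewrite ha h0 mulr0 rmorph0.
move/(congr1 (meval (affine_pt x))); rewrite meval0 /a rmorph_sum /= => <-.
rewrite horner_coef; apply: eq_bigr => i _.
by rewrite mevalZ mevalM !rmorphXn /= !mevalXU /affine_pt /= expr1n mul1r.
Qed.

Lemma slope_eval_inj P Q : slope_eval P = slope_eval Q -> P = Q.
Proof. by move=> h; apply/subr0_eq/slope_eval_eq0; rewrite slope_evalB h subrr. Qed.

Lemma Oreg_slope k p z : Oreg fr k p z -> exists a b (da db : nat),
  [/\ a \is da.-homog, b \is db.-homog, da%:Z = db%:Z + k, b.@[p] != 0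
    & z * slope_eval (dehom b) = (sv fr) ^ k * slope_eval (dehom a)].
Proof.
move=> [a [b [da [db [ha hb e hp ->]]]]]; exists a, b, da, db; split=> //.
have hs := sv_neq0 fr_inj.
have hd : (sv fr) ^+ da = (sv fr) ^ k * (sv fr) ^+ db by rewrite !exprnP e addrC expfzDr.
rewrite (fr_dehom ha) hd (fr_dehom hb).
have hne : slope_eval (dehom b) != 0.
  apply: contraNneq hp => hb0.
  have /eqP : fr b = 0 by rewrite (fr_dehom hb) hb0 mulr0.
  by rewrite -(rmorph0 fr) (inj_eq fr_inj) => /eqP ->; rewrite meval0.
by rewrite mulf_divK // expf_neq0 // (sv_neq0 fr_inj).
Qed.

(** In lowest terms the denominator of the dehomogenised function divides the
    denominator of each local expression, so it has no root and is constant;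
    at the point s = 0 the regularity bounds the degree of the numerator. *)
Lemma global_Oreg_neg k z : (forall p, is_pt p -> Oreg fr k p z) -> k < 0 -> z = 0.
Proof.
move=> hz hk.
have [a [b [da [db [ha hb e hp hab]]]]] := Oreg_slope (hz _ (is_pt_affine 0)).
have hk0 : (sv fr) ^ k != 0 by rewrite expfz_neq0 // (sv_neq0 fr_inj).
have hb0 : dehom b != 0.
  by apply: contraNneq hp => h; rewrite -horner_dehom h horner0.
set A := dehom a in hab; set B := dehom b in hab hb0.
have hloc p a' b' : z * slope_eval (dehom b') = (sv fr) ^ k * slope_eval (dehom a') ->
    A * dehom b' = dehom a' * B.
  move=> h'; apply: slope_eval_inj; apply: (mulfI hk0); rewrite !slope_evalM.
  by rewrite mulrA -hab mulrA -h'; ring.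
have [G hG] : exists G, G = gcdp A B by exists (gcdp A B).
have hG0 : G != 0 by rewrite hG gcdp_eq0 negb_and hb0 orbT.
have hA : A = A %/ G * G by rewrite divpK // hG dvdp_gcdl.
have hB : B = B %/ G * G by rewrite divpK // hG dvdp_gcdr.
set A0 := A %/ G in hA; set B0 := B %/ G in hB.
have cop : coprimep B0 A0.
  by rewrite coprimep_sym /A0 /B0 hG coprimep_div_gcd // hb0 orbT.
have hB0 x : B0.[x] != 0.
  have [a' [b' [da' [db' [ha' hb' e' hp' /(hloc (affine_pt x)) h]]]]] :=
    Oreg_slope (hz _ (is_pt_affine x)).
  apply: contraNneq hp' => h0.
  have : B0 %| A0 * dehom b'.
    apply/dvdpP; exists (dehom a'); apply: (mulIf hG0); apply: etrans (etrans h _).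
      by rewrite [in RHS]hA; ring.
    by rewrite {1}hB; ring.
  rewrite Gauss_dvdpr // => /dvdpP[q hq].
  by rewrite -horner_dehom hq hornerM h0 mulr0.
have [c hc] : exists c, B0 = c%:P.
  exists B0`_0; apply: size1_polyC; rewrite leqNgt; apply/negP => hs.
  have /closed_rootP[x] : size B0 != 1 by rewrite gtn_eqF.
  by rewrite rootE (negPf (hB0 x)).
have hc0 : c != 0 by have := hB0 0; rewrite hc hornerC.
have [a' [b' [da' [db' [ha' hb' e' hp' h]]]]] := Oreg_slope (hz _ is_pt_infty).
have hsz : (db' < size (dehom b'))%N.
  by rewrite ltnNge; apply: contraNN hp' => hs; rewrite -(coef_dehom hb') nth_default.
have /(hloc infty_pt) {}h := h.
have h2 : A0 * dehom b' = c *: dehom a'.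
  apply: (mulIf hG0); rewrite mulrAC -hA h [in LHS]hB hc -mul_polyC; ring.
have hA0 : A0 = 0.
  apply/eqP/negPn/negP => hA0.
  have := size_dehom ha'; rewrite -(size_scale _ hc0) -h2 size_mul //; last first.
    by rewrite -size_poly_gt0 (leq_ltn_trans _ hsz).
  move: hA0; rewrite -size_poly_gt0 => hA0 hs;
  by move: hA0 hs hsz e' hk; clear; move: (size _) (size _) => u v; lia.
have := hab; rewrite hA hA0 mul0r /slope_eval rmorph0 horner0 mulr0 -/(slope_eval _) => /eqP.
rewrite mulf_eq0 => /orP[/eqP //|/eqP /slope_eval_eq0 /eqP].
by rewrite (negPf hb0).
Qed.

(** Kronecker substitution s = x^N, t = x separates all monomials of a given
    binary polynomial. *)
Lemma mpoly2_eq0 (G : bform K) : (forall p, is_pt p -> G.@[p] = 0) -> G = 0.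
Proof.
move=> hG; pose N := msize G.
pose P : {poly K} := \sum_(m <- msupp G) G@_m *: 'X^(N * m ord0 + m ord_max).
have hP x : x != 0 -> P.[x] = 0.
  move=> hx; pose p : 'I_2 -> K := fun i => if i == ord0 then x ^+ N else x.
  rewrite -(hG p); last by exists ord_max.
  rewrite mevalE /P horner_sum; apply: eq_bigr => m _.
  by rewrite hornerZ hornerXn big_ord2 /p /= exprD exprM.
have {}hP : P = 0.
  have /eqP : P * 'X = 0.
    apply: closed_poly_eq0 => x; rewrite hornerM hornerX.
    by have [->|/hP ->] := eqVneq x 0; rewrite ?mulr0 ?mul0r.
  by rewrite mulf_eq0 polyX_eq0 orbF => /eqP.
have key m m' : m \in msupp G -> m' \in msupp G ->
    (N * m ord0 + m ord_max == N * m' ord0 + m' ord_max)%N = (m' == m).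
  move=> hm hm'; apply/eqP/eqP => [h|-> //].
  have bd (m0 : 'X_{1..2}) : m0 \in msupp G -> (m0 ord_max < N)%N.
    by move/msize_mdeg_lt; apply: leq_ltn_trans; rewrite mdegE big_ord2 leq_addl.
  have hN : (0 < N)%N by apply: leq_ltn_trans (bd m hm).
  have e0 : m' ord0 = m ord0.
    move/(congr1 (divn^~ N)): h.
    by rewrite ![(N * _)%N]mulnC !divnMDl // !divn_small ?addn0 ?bd.
  apply/mnmP => i; have [->//|->] : i = ord0 \/ i = ord_max.
    by case: i => [[|[|//]] ?]; [left|right]; apply: val_inj.
  by move: h; rewrite e0 => /addnI ->.
apply/mpolyP => m; rewrite mcoeff0; apply/eqP/negPn/negP => hm.
have hm' : m \in msupp G by rewrite mcoeff_msupp.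
have := congr1 (fun Q : {poly K} => Q`_(N * m ord0 + m ord_max)) hP.
rewrite coef0 /P coef_sum (bigD1_seq m) //= big_seq_cond big1 ?addr0.
  by rewrite coefZ coefXn eqxx mulr1 => /eqP; rewrite (negPf hm).
move=> m1 /andP[h1 ne]; rewrite coefZ coefXn key //.
by rewrite (negPf ne) mulr0.
Qed.

End GlobalSections.

(** * Directional derivatives *)

Section DirectionalDerivative.
Variables (K : fieldType) (n : nat) (R : comNzRingType).
Variable th : {rmorphism {mpoly K[n.+1]} -> R}.
Implicit Types (v w : nat -> R) (G H : {mpoly K[n.+1]}).

(** With th the restriction to the curve, or the evaluation at one of its points,
    this is the derivative along C of G in the direction of a vector field v. *)
Definition dird v G : R := \sum_(i < n.+1) th G^`M(i) * v i.

Lemma dirdD v G H : dird v (G + H) = dird v G + dird v H.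
Proof.
by rewrite /dird -big_split; apply: eq_bigr => i _; rewrite mderivD rmorphD mulrDl.
Qed.

Lemma dirdN v G : dird v (- G) = - dird v G.
Proof.
by rewrite /dird -sumrN; apply: eq_bigr => i _; rewrite mderivN rmorphN mulNr.
Qed.

Lemma dird0 v : dird v 0 = 0.
Proof. by apply: (addrI (dird v 0)); rewrite -dirdD !addr0. Qed.

Lemma dirdM v G H : dird v (G * H) = th G * dird v H + th H * dird v G.
Proof.
rewrite /dird !mulr_sumr -big_split; apply: eq_bigr => i _.
by rewrite mderivM rmorphD !rmorphM /=; ring.
Qed.

Lemma dird_sum v (J : Type) (r : seq J) (P : pred J) (F : J -> {mpoly K[n.+1]}) :
  dird v (\sum_(j <- r | P j) F j) = \sum_(j <- r | P j) dird v (F j).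
Proof.
elim/big_rec2: _ => [|j x G _ <-]; first exact: dird0.
exact: dirdD.
Qed.

Lemma dird_xvar v i : (i <= n)%N -> dird v (xvar K n i) = v i.
Proof.
move=> hi; rewrite /dird (bigD1 (inord i)) //= big1 ?addr0 => [|j ne].
  by rewrite /xvar mderivX mnm1E eqxx -[X in (X - _)%MM]add0m addmK mpolyX0 scale1r rmorph1 mul1r inordK.
by rewrite /xvar mderivX mnm1E eq_sym (negPf ne) scale0r rmorph0 mul0r.
Qed.

Lemma dird_lin z v w G :
  dird (fun i => z * v i + w i) G = z * dird v G + dird w G.
Proof.
rewrite /dird mulr_sumr -big_split; apply: eq_bigr => i _ /=; ring.
Qed.

Lemma dird_Qform v i j : (0 < i <= n)%N -> (0 < j <= n)%N ->
  dird v (Qform K n i j) =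
    th (xvar K n i) * v j.-1 + th (xvar K n j.-1) * v i
    - (th (xvar K n i.-1) * v j + th (xvar K n j) * v i.-1).
Proof. by move=> hi hj; rewrite /Qform dirdD dirdN !dirdM !dird_xvar //; lia. Qed.

End DirectionalDerivative.

(** * The homogeneous ideal of the rational normal curve *)

Section CurveIdeal.
Variables (K : closedFieldType) (T : fieldType) (fr : {rmorphism bform K -> T}).
Hypothesis fr_inj : injective fr.
Variables (e n : nat).
Hypotheses (he : (2 <= e)%N) (hen : (e <= n)%N).
Local Notation S := {mpoly K[n.+1]}.
Local Notation x := (xvar K n).
Local Notation Q := (Qform K n).
Local Notation c01 P := (comp_mpoly [tuple x 0; x 1] P).
Local Notation ideal := (curve_ideal K e n).
Implicit Types (G H : S).

Definition pullT : {rmorphism S -> T} :=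
  fr \o comp_mpoly [tuple rnc_coord e ('X_ord0 : bform K) 'X_ord_max i | i < n.+1].

Lemma pullTE G : pullT G = fr (rnc_pullback e G).
Proof. by []. Qed.

Definition xc (i : nat) : T := sv fr ^+ (e - i) * tv fr ^+ i.

Lemma pullT_xvar i : (i <= n)%N -> pullT (x i) = if (i <= e)%N then xc i else 0.
Proof.
move=> hi; rewrite pullTE /rnc_pullback /xvar comp_mpolyXU -tnth_nth tnth_mktuple.
rewrite /rnc_coord inordK //; case: ifP => _; last exact: rmorph0.
by rewrite rmorphM !rmorphXn.
Qed.

Lemma pullT_xvar_le i : (i <= e)%N -> pullT (x i) = xc i.
Proof. by move=> hi; rewrite pullT_xvar ?hi // (leq_trans hi). Qed.

Lemma xc_neq0 i : xc i != 0.
Proof. by rewrite mulf_neq0 // expf_neq0 ?sv_neq0 ?tv_neq0. Qed.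

Lemma on_curve_rnc (st : 'I_2 -> K) : is_pt st ->
  on_curve e (fun i : 'I_n.+1 => rnc_coord e (st ord0) (st ord_max) i).
Proof. by move=> hst; exists st, 1; split=> // [|i]; rewrite ?oner_neq0 ?mul1r. Qed.

Lemma meval_pullback G st :
  (rnc_pullback e G).@[st] = G.@[fun i => rnc_coord e (st ord0) (st ord_max) i].
Proof.
rewrite comp_mpoly_meval; apply: meval_eq => i; rewrite tnth_mktuple /rnc_coord.
by case: ifP => _; rewrite ?meval0 // mevalM !rmorphXn /= !mevalXU.
Qed.

Lemma pullT_ideal G : in_curve_ideal e G -> pullT G = 0.
Proof.
move=> hG; rewrite pullTE (@mpoly2_eq0 _ (rnc_pullback e G)) ?rmorph0 // => st hst.
by rewrite meval_pullback; apply/hG/on_curve_rnc.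
Qed.

Lemma in_ideal_lin A G H :
  in_curve_ideal e G -> in_curve_ideal e H -> in_curve_ideal e (A * G + H).
Proof. by move=> hG hH p hp; rewrite mevalD mevalM hG // hH // mulr0 addr0. Qed.

Lemma in_ideal0 : in_curve_ideal e (0 : S).
Proof. by move=> p _; rewrite meval0. Qed.

Lemma in_idealM A G : in_curve_ideal e G -> in_curve_ideal e (A * G).
Proof. by move=> hG p hp; rewrite mevalM hG // mulr0. Qed.

Lemma in_idealD G H : in_curve_ideal e G -> in_curve_ideal e H -> in_curve_ideal e (G + H).
Proof. by move=> hG hH p hp; rewrite mevalD hG // hH // addr0. Qed.

Lemma in_ideal_Q i j : (0 < i <= e)%N -> (0 < j <= e)%N -> in_curve_ideal e (Q i j).
Proof.
move=> hi hj p [st [c [_ _ hp]]].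
rewrite /Qform mevalB !mevalM /xvar !mevalXU !hp /rnc_coord !inordK; try lia.
rewrite !ifT; try lia.
set s := st ord0; set t := st ord_max.
have -> : (e - i.-1 = (e - i).+1)%N by lia.
have -> : (e - j.-1 = (e - j).+1)%N by lia.
have -> : t ^+ i = t * t ^+ i.-1 by rewrite -exprS; congr (_ ^+ _); lia.
have -> : t ^+ j = t * t ^+ j.-1 by rewrite -exprS; congr (_ ^+ _); lia.
by rewrite !exprS; ring.
Qed.

Lemma in_ideal_x j : (e < j <= n)%N -> in_curve_ideal e (x j).
Proof.
move=> hj p [st [c [_ _ hp]]]; rewrite /xvar mevalXU hp /rnc_coord inordK; last by lia.
by rewrite ifF ?mulr0 //; lia.
Qed.

(** Homomorphisms of modules over the coordinate ring from the ideal of the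
    curve to T. *)
Definition ideal_hom (phi : ideal -> T) : Prop :=
  forall A (G H L : ideal), sval L = A * sval G + sval H ->
    phi L = pullT A * phi G + phi H.

(** The value of phi on a polynomial, 0 off the ideal, so that generators can
    be plugged in without carrying membership proofs. *)
Definition ev (phi : ideal -> T) G : T :=
  if excluded_middle_informative (in_curve_ideal e G) is left h
  then phi (exist _ G h) else 0.

Lemma ev_sval phi (G : ideal) : ev phi (sval G) = phi G.
Proof.
rewrite /ev; case: excluded_middle_informative => [h|]; last by case; apply: proj2_sig.
by case: G h => G h h' /=; congr (phi (exist _ _ _)); apply: proof_irrelevance.
Qed.

Section IdealHom.
Variable phi : ideal -> T.
Hypothesis phi_hom : ideal_hom phi.

Lemma ev_lin A G H : in_curve_ideal e G -> in_curve_ideal e H ->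
  ev phi (A * G + H) = pullT A * ev phi G + ev phi H.
Proof.
move=> hG hH; have hL := in_ideal_lin A hG hH.
have /phi_hom : sval (exist _ _ hL : ideal)
  = A * sval (exist _ _ hG : ideal) + sval (exist _ _ hH : ideal) by [].
by rewrite -!ev_sval.
Qed.

Lemma ev0 : ev phi 0 = 0.
Proof.
have := ev_lin 1 in_ideal0 in_ideal0; rewrite mulr0 addr0 rmorph1 mul1r => /eqP.
by rewrite -subr_eq0 opprD addNKr oppr_eq0 => /eqP.
Qed.

Lemma evM A G : in_curve_ideal e G -> ev phi (A * G) = pullT A * ev phi G.
Proof. by move=> hG; rewrite -[A * G]addr0 (ev_lin _ hG in_ideal0) ev0 addr0. Qed.

Lemma evD G H : in_curve_ideal e G -> in_curve_ideal e H ->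
  ev phi (G + H) = ev phi G + ev phi H.
Proof. by move=> hG hH; rewrite -[G]mul1r ev_lin // rmorph1 mul1r mul1r. Qed.

(** This comes from x_0 Q_{i,i+1} = x_{i-1} Q_{1,i+1} - x_i Q_{1,i}: where x_0 is
    invertible, the ideal of the curve is generated by the Q_{1,k} and the x_j. The
    mirror image below uses the Q_{k,e} at the other end of the curve. *)
Lemma ev_Q_head i : (0 < i < e)%N ->
  xc 0 * ev phi (Q i i.+1) = xc i.-1 * ev phi (Q 1 i.+1) - xc i * ev phi (Q 1 i).
Proof.
move=> hi; apply/eqP; rewrite -subr_eq0 opprB addrA; apply/eqP.
have h1 : in_curve_ideal e (Q i i.+1) by apply: in_ideal_Q; lia.
have h2 : in_curve_ideal e (Q 1 i.+1) by apply: in_ideal_Q; lia.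
have h3 : in_curve_ideal e (Q 1 i) by apply: in_ideal_Q; lia.
have -> : xc 0 * ev phi (Q i i.+1) + xc i * ev phi (Q 1 i) - xc i.-1 * ev phi (Q 1 i.+1)
   = ev phi (x 0 * Q i i.+1 + (x i * Q 1 i + (- x i.-1) * Q 1 i.+1)).
  have [[a1 a2] a3] := (in_idealM (x 0) h1, in_idealM (x i) h3, in_idealM (- x i.-1) h2).
  have a4 := in_idealD a2 a3; rewrite (evD a1 a4) (evD a2 a3) (evM _ h1) (evM _ h2) (evM _ h3) rmorphN.
  by rewrite !pullT_xvar_le ?mulNr ?addrA //; lia.
rewrite /Qform /= (_ : _ + _ = 0) ?ev0 //; ring.
Qed.

Lemma ev_Q_last i : (0 < i < e)%N ->
  xc e.-1 * ev phi (Q i i.+1) = xc i * ev phi (Q i e) - xc i.-1 * ev phi (Q i.+1 e).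
Proof.
move=> hi; apply/eqP; rewrite -subr_eq0 opprB addrA; apply/eqP.
have h1 : in_curve_ideal e (Q i i.+1) by apply: in_ideal_Q; lia.
have h2 : in_curve_ideal e (Q i.+1 e) by apply: in_ideal_Q; lia.
have h3 : in_curve_ideal e (Q i e) by apply: in_ideal_Q; lia.
have -> : xc e.-1 * ev phi (Q i i.+1) + xc i.-1 * ev phi (Q i.+1 e) - xc i * ev phi (Q i e)
   = ev phi (x e.-1 * Q i i.+1 + (x i.-1 * Q i.+1 e + (- x i) * Q i e)).
  have [[a1 a2] a3] := (in_idealM (x e.-1) h1, in_idealM (x i.-1) h2, in_idealM (- x i) h3).
  have a4 := in_idealD a2 a3; rewrite (evD a1 a4) (evD a2 a3) (evM _ h1) (evM _ h2) (evM _ h3) rmorphN.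
  by rewrite !pullT_xvar_le ?mulNr ?addrA //; lia.
rewrite /Qform /= (_ : _ + _ = 0) ?ev0 //; ring.
Qed.

Hypothesis phi_Q : forall i, (0 < i < e)%N -> ev phi (Q i i.+1) = 0.
Hypothesis phi_x : forall j, (e < j <= n)%N -> ev phi (x j) = 0.

Let ker G := in_curve_ideal e G /\ ev phi G = 0.

Let ker_lin A G H : ker G -> ker H -> ker (A * G + H).
Proof.
move=> [iG hG] [iH hH]; split; first exact: in_ideal_lin.
by rewrite ev_lin // hG hH mulr0 addr0.
Qed.

Let ker0 : ker 0.
Proof. by split; [apply: in_ideal0 | apply: ev0]. Qed.

Let ker_mul A G : ker G -> ker (A * G).
Proof. by move=> hG; rewrite -[A * G]addr0; apply: ker_lin. Qed.

(** The quadrics Q_{1,i} follow from the Q_{i,i+1}, since T has no torsion. *)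
Let ker_Q1 i : (0 < i <= e)%N -> ker (Q 1 i).
Proof.
elim: i => [//|[|i] IHi] hi; first by rewrite /Qform /= mulrC subrr; apply: ker0.
split; first by apply: in_ideal_Q; lia.
have [|_ h1] := IHi; first by lia.
have := @ev_Q_head i.+1; rewrite h1 phi_Q; try lia.
move=> /(_ ltac:(lia)) /eqP; rewrite !mulr0 subr0 eq_sym mulf_eq0 (negPf (xc_neq0 _)).
by move/eqP.
Qed.

(** A subalgebra containing all coordinates: the locus x_0 != 0 of the curve is
    cut out by x_0 x_i = x_1 x_{i-1} and x_j = 0, so after multiplying by a power
    of x_0 everything reduces to a polynomial in x_0 and x_1. *)
Let reducible G :=
  exists (N : nat) (P : bform K), ker (x 0 ^+ N * G - c01 P).

Let red_const c : reducible c%:MP.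
Proof. by exists 0%N, c%:MP; rewrite comp_mpolyC expr0 mul1r subrr; apply: ker0. Qed.

Let red_add G H : reducible G -> reducible H -> reducible (G + H).
Proof.
move=> [N [P hP]] [M [R hR]].
exists (N + M)%N, ('X_ord0 ^+ M * P + 'X_ord0 ^+ N * R).
rewrite rmorphD !rmorphM !rmorphXn /= !comp_mpolyXU /=.
have -> : x 0 ^+ (N + M) * (G + H) - (x 0 ^+ M * c01 P
      + x 0 ^+ N * c01 R)
  = x 0 ^+ M * (x 0 ^+ N * G - c01 P)
    + x 0 ^+ N * (x 0 ^+ M * H - c01 R) by rewrite exprD; ring.
by apply: ker_lin => //; apply: ker_mul.
Qed.

Let red_mul G H : reducible G -> reducible H -> reducible (G * H).
Proof.
move=> [N [P hP]] [M [R hR]]; exists (N + M)%N, (P * R); rewrite rmorphM /=.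
have -> : x 0 ^+ (N + M) * (G * H) - c01 P * c01 R
  = (x 0 ^+ M * H) * (x 0 ^+ N * G - c01 P)
    + c01 P * (x 0 ^+ M * H - c01 R).
  by rewrite exprD; ring.
by apply: ker_lin => //; apply: ker_mul.
Qed.

Let red_xvar i : (i <= n)%N -> reducible (x i).
Proof.
elim: i => [|[|i] IHi] hi.
- exists 0%N, 'X_ord0; rewrite comp_mpolyXU /= expr0 mul1r subrr; exact: ker0.
- exists 0%N, 'X_ord_max; rewrite comp_mpolyXU /= expr0 mul1r subrr; exact: ker0.
have [lei|gti] := leqP i.+2 e; last first.
  exists 0%N, 0; rewrite comp_mpoly0 expr0 mul1r subr0; split.
    by apply: in_ideal_x; lia.
  by apply: phi_x; lia.
have [N [P hP]] := IHi (ltnW hi); exists N.+1, ('X_ord_max * P).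
rewrite rmorphM /= comp_mpolyXU /=.
have -> : x 0 ^+ N.+1 * x i.+2 - x 1 * c01 P
  = x 1 * (x 0 ^+ N * x i.+1 - c01 P) + (- x 0 ^+ N) * Q 1 i.+2.
  by rewrite /Qform /= exprS; ring.
by apply: ker_lin => //; apply: ker_mul; apply: ker_Q1; lia.
Qed.

Let red_all G : reducible G.
Proof.
elim/mpolyind: G => [|c m G _ _ hG]; first by rewrite -mpolyC0; apply: red_const.
apply: red_add => //; rewrite -mul_mpolyC; apply: red_mul; first exact: red_const.
rewrite mpolyXE_id; elim/big_ind: _ => [||i _].
- by rewrite -mpolyC1; apply: red_const.
- exact: red_mul.
elim: (m i) => [|k IHk]; first by rewrite expr0 -mpolyC1; apply: red_const.
rewrite exprS; apply: red_mul => //.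
by have := @red_xvar i (ltn_ord i); rewrite /xvar inord_val.
Qed.

(** The two coordinates s^e and s^(e-1) t take every value (a, b) with a != 0,
    because e-th roots exist. *)
Let ideal_x01 (P : bform K) : in_curve_ideal e (c01 P) -> P = 0.
Proof.
move=> hP; suff /eqP : 'X_ord0 * P = 0.
  by rewrite mulf_eq0 (negPf (mpolyX1_neq0 _ _)) => /eqP.
apply: mpoly2_eq0 => p _; rewrite mevalM mevalXU; have [->|hp0] := eqVneq (p ord0) 0.
  by rewrite mul0r.
have /closed_rootP[s] : size ('X^e - (p ord0)%:P) != 1.
  by rewrite size_XnsubC; lia.
rewrite rootE !hornerE subr_eq0 => /eqP hs.
have hs0 : s != 0.
  by apply: contraNneq hp0 => hs0; rewrite -hs hs0 expr0n; case: (e) he.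
pose st : 'I_2 -> K := fun i => if i == ord0 then s else p ord_max / s ^+ e.-1.
have /hP : on_curve e (fun i : 'I_n.+1 => rnc_coord e (st ord0) (st ord_max) i).
  by apply: on_curve_rnc; exists ord0; rewrite /st eqxx.
rewrite comp_mpoly_meval => h; suff -> : P.@[p] = 0 by rewrite mulr0.
rewrite -[RHS]h; apply: meval_eq => i.
have [->|->] : i = ord0 \/ i = ord_max.
- by case: i => [[|[|//]] ?]; [left|right]; apply: val_inj.
- by rewrite (tnth_nth 0) /= /xvar mevalXU /rnc_coord inordK //= /st /= subn0 hs mulr1.
rewrite (tnth_nth 0) /= /xvar mevalXU /rnc_coord inordK; last by lia.
rewrite ifT; last by lia.
by rewrite /st /= expr1 mulrC subn1 divfK // expf_neq0.
Qed.

Lemma ideal_hom_eq0 (G : ideal) : phi G = 0.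
Proof.
have [N [P [hI hk]]] := red_all (sval G).
have hG : in_curve_ideal e (sval G) := proj2_sig G.
have hP : P = 0.
  apply: ideal_x01; have := in_ideal_lin (- 1) hI (in_idealM (x 0 ^+ N) hG).
  by rewrite mulN1r opprB subrK.
move: hk; rewrite hP comp_mpoly0 subr0 evM // rmorphXn pullT_xvar_le // => /eqP.
by rewrite mulf_eq0 expf_eq0 (negPf (xc_neq0 _)) andbF /= ev_sval => /eqP.
Qed.

End IdealHom.

(** The Q_{i,i+1} and the x_j do not generate the ideal, but up to multiplication by
    monomials they do, and T has no torsion. *)
Lemma ideal_hom_ext (phi psi : ideal -> T) : ideal_hom phi -> ideal_hom psi ->
  (forall i, (0 < i < e)%N -> ev phi (Q i i.+1) = ev psi (Q i i.+1)) ->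
  (forall j, (e < j <= n)%N -> ev phi (x j) = ev psi (x j)) ->
  forall G : ideal, phi G = psi G.
Proof.
move=> hphi hpsi hQ hx G.
pose d (G : ideal) := phi G - psi G.
have hd : ideal_hom d.
  by move=> A G1 H1 L1 hL; rewrite /d (hphi _ _ _ _ hL) (hpsi _ _ _ _ hL); ring.
have evd G1 : in_curve_ideal e G1 -> ev d G1 = ev phi G1 - ev psi G1.
  by move=> h; rewrite -[G1]/(sval (exist _ G1 h : ideal)) !ev_sval.
apply/subr0_eq/(ideal_hom_eq0 hd) => [i hi|j hj].
  by rewrite evd ?hQ ?subrr //; apply: in_ideal_Q; lia.
by rewrite evd ?hx ?subrr //; apply: in_ideal_x.
Qed.

End CurveIdeal.

(** * Isomorphisms of sheaves of rational functions *)

Section SheafIso.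
Variables (K T : fieldType) (fr : {rmorphism bform K -> T}).
Local Notation opn := (('I_2 -> K) -> Prop).

Definition sheaf (I : Type) := opn -> (I -> T) -> Prop.

(** Isomorphism of O-modules inside constant sheaves of T-valued functions; for
    T = K(s,t) this unfolds to the isomorphism of O_{P^1}-modules of the theorem. *)
Definition sheaf_iso (I J : Type) (M : sheaf I) (N : sheaf J) : Prop :=
  exists psi : opn -> (I -> T) -> (J -> T),
    (forall U, zopen U ->
      [/\ forall v, M U v -> N U (psi U v),
          forall g v w, (forall p, U p -> Oreg fr 0 p g) -> M U v -> M U w ->
            psi U (fun i => g * v i + w i)
              = (fun j => g * psi U v j + psi U w j),
          forall v w, M U v -> M U w -> psi U v = psi U w -> v = w
        & forall u, N U u -> exists2 v, M U v & psi U v = u]) /\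
    (forall U V, zopen U -> zopen V -> (forall p, U p -> V p) ->
       forall v, M V v -> psi U v = psi V v).

Definition linear_fun (I J : Type) (f : (I -> T) -> (J -> T)) : Prop :=
  forall z v w, f (fun i => z * v i + w i) = (fun j => z * f v j + f w j).

(** Isomorphisms given on all open sets by one T-linear map with T-linear
    inverse; every isomorphism constructed below is of this kind. *)
Definition gen_iso (I J : Type) (M : sheaf I) (N : sheaf J) : Prop :=
  exists (f : (I -> T) -> (J -> T)) (g : (J -> T) -> (I -> T)),
    [/\ linear_fun f, linear_fun g,
        forall U v, zopen U -> M U v -> N U (f v) /\ g (f v) = v
      & forall U u, zopen U -> N U u -> M U (g u) /\ f (g u) = u].

Lemma gen_iso_sym I J (M : sheaf I) (N : sheaf J) : gen_iso M N -> gen_iso N M.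
Proof. by move=> [f [g [hf hg hM hN]]]; exists g, f. Qed.

Lemma gen_iso_trans I J L (M : sheaf I) (N : sheaf J) (P : sheaf L) :
  gen_iso M N -> gen_iso N P -> gen_iso M P.
Proof.
move=> [f [g [hf hg hM hN]]] [f' [g' [hf' hg' hM' hN']]].
exists (f' \o f), (g \o g'); split=> [z v w|z v w|U v hU hv|U v hU hv] /=.
- by rewrite hf hf'.
- by rewrite hg' hg.
- have [h1 e1] := hM U v hU hv; have [h2 e2] := hM' U _ hU h1.
  by split=> //; rewrite e2.
- have [h1 e1] := hN' U v hU hv; have [h2 e2] := hN U _ hU h1.
  by split=> //; rewrite e2.
Qed.

Lemma gen_iso_iso I J (M : sheaf I) (N : sheaf J) : gen_iso M N -> sheaf_iso M N.
Proof.
move=> [f [g [hf hg hM hN]]]; exists (fun _ => f); split=> [U hU|//].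
split=> [v|z v w _ _ _|v w hv hw e|u hu].
- by case/(hM U v hU).
- exact: hf.
- by have [_ <-] := hM U v hU hv; have [_ <-] := hM U w hU hw; rewrite e.
- by have [h1 e1] := hN U u hU hu; exists (g u).
Qed.

Lemma sheaf_iso_trans I J L (M : sheaf I) (N : sheaf J) (P : sheaf L) :
  sheaf_iso M N -> sheaf_iso N P -> sheaf_iso M P.
Proof.
move=> [f [hf rf]] [g [hg rg]]; exists (fun U v => g U (f U v)); split=> [U hU|U V hU hV hUV v hv].
  have [f1 f2 f3 f4] := hf U hU; have [g1 g2 g3 g4] := hg U hU.
  split=> [v hv|z v w hz hv hw|v w hv hw e|u hu].
  - exact/g1/f1.
  - by rewrite f2 // g2 //; apply: f1.
  - by apply: f3 => //; apply: g3 => //; apply: f1.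
  - have [v hv <-] := g4 u hu; have [w hw <-] := f4 v hv; by exists w.
have [f1 _ _ _] := hf V hV.
by rewrite (rf U V hU hV hUV v hv) (rg U V hU hV hUV) //; apply: f1.
Qed.

Definition split_sheaf (d : seq int) : sheaf 'I_(size d) :=
  fun U v => forall (i : 'I_(size d)) p, U p -> Oreg fr d`_i p (v i).

(** The kernel of the map from the sum of the O(c l), l < N, given by the row h;
    the sections are extended by zero so that indices can be plain numbers. *)
Definition ker_sheaf (N : nat) (c : nat -> int) (h : nat -> T) : sheaf nat :=
  fun U u => [/\ forall l, (l < N)%N -> forall p, U p -> Oreg fr (c l) p (u l),
                 forall l, (N <= l)%N -> u l = 0
               & \sum_(l < N) h l * u l = 0].

End SheafIso.

Arguments split_sheaf {K T} fr d _ _.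

(** * The normal bundle as the kernel of a map of split bundles *)

Lemma dhomog_mderiv (R : nzRingType) n (G : {mpoly R[n]}) m (i : 'I_n) :
  G \is m.+1.-homog -> G^`M(i) \is m.-homog.
Proof.
move=> /dhomogP hG; apply/dhomogP => j; rewrite mcoeff_msupp mcoeff_mderiv => hj.
have /hG /= : (j + U_(i))%MM \in msupp G.
  by rewrite mcoeff_msupp; apply: contraNneq hj => ->; rewrite mul0rn.
by rewrite mdegD mdeg1 addn1 => -[].
Qed.

Lemma mderiv_dhomog0 (R : nzRingType) n (G : {mpoly R[n]}) (i : 'I_n) :
  G \is 0.-homog -> G^`M(i) = 0.
Proof.
move=> /dhomogP hG; apply/mpolyP => j; rewrite mcoeff0 mcoeff_mderiv.
apply/eqP/negPn/negP => hj.
have /hG /= : (j + U_(i))%MM \in msupp G.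
  by rewrite mcoeff_msupp; apply: contraNneq hj => ->; rewrite mul0rn.
by rewrite mdegD mdeg1 addn1.
Qed.

Section AlongCurve.
Variables (K : fieldType) (n e : nat) (R : comNzRingType).
Variables (th : {rmorphism {mpoly K[n.+1]} -> R}) (c s t : R).
Hypothesis hen : (e <= n)%N.
Hypothesis th_curve : forall i, (i <= n)%N ->
  th (xvar K n i) = if (i <= e)%N then c * (s ^+ (e - i) * t ^+ i) else 0.
Implicit Types v : nat -> R.

Definition second_diff v (l : nat) : R :=
  s * t * v l.+1 *+ 2 - s ^+ 2 * v l.+2 - t ^+ 2 * v l.

(** Since Q_{l+1,l+2} vanishes on C, its derivative along v does not change if v is
    modified by the tangent directions (t/s)^i and i (t/s)^i; these are the
    sequences killed by the second difference. *)
Lemma dird_Q v l : (l < e.-1)%N ->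
  dird th v (Qform K n l.+1 l.+2) = c * (s ^+ (e - 2 - l) * t ^+ l) * second_diff v l.
Proof.
move=> hl; rewrite dird_Qform; try lia.
rewrite !th_curve /=; try lia.
rewrite !ifT; try lia.
rewrite /second_diff.
have -> : (e - l.+1 = (e - 2 - l).+1)%N by lia.
have -> : (e - l.+2 = e - 2 - l)%N by lia.
have -> : (e - l = (e - 2 - l).+2)%N by lia.
by rewrite !exprS; ring.
Qed.

Lemma dird_xx v i j : (i <= e)%N -> (e < j <= n)%N ->
  dird th v (xvar K n i * xvar K n j) = c * (s ^+ (e - i) * t ^+ i) * v j.
Proof.
move=> hi hj; rewrite dirdM !dird_xvar; try lia.
by rewrite !th_curve ?hi ?ifF ?mul0r ?addr0 //; lia.
Qed.

End AlongCurve.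

Section NormalBundle.
Variables (K : closedFieldType) (T : fieldType) (fr : {rmorphism bform K -> T}).
Hypothesis fr_inj : injective fr.
Variables (e n : nat).
Hypotheses (he : (2 <= e)%N) (hen : (e <= n)%N).
Local Notation S := {mpoly K[n.+1]}.
Local Notation x := (xvar K n).
Local Notation Q := (Qform K n).
Local Notation ideal := (curve_ideal K e n).
Local Notation D := (dird (pullT fr e n)).
Local Notation s := (sv fr).
Local Notation t := (tv fr).
Implicit Types (G H F : S) (u v : nat -> T).

Definition normal_sheaf F : sheaf K T ideal :=
  fun U (phi : ideal -> T) =>
    [/\ ideal_hom fr phi,
        forall (m : nat) (G : ideal), sval G \is m.-homog ->
          forall p, U p -> Oreg fr (e * m)%N%:Z p (phi G)
      & forall G : ideal, sval G = F -> phi G = 0].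

Lemma dhomog_rnc_coord (i : 'I_n.+1) :
  rnc_coord e ('X_ord0 : bform K) 'X_ord_max i \is e.-homog.
Proof.
rewrite /rnc_coord; case: ifP => hi; last exact: dhomog0.
have := dhomogM (dhomogMn (e - i) (dhomog_var K (ord0 : 'I_2)))
                (dhomogMn i (dhomog_var K (ord_max : 'I_2))).
by rewrite !mul1n subnK.
Qed.

Lemma dhomog_pullback m G : G \is m.-homog -> rnc_pullback e G \is (e * m)%N.-homog.
Proof.
move=> /dhomogP hG; rewrite /rnc_pullback comp_mpolyEX.
rewrite big_seq; apply: rpred_sum => j hj; apply: rpredZ; rewrite comp_mpolyX.
have <- : (\sum_(i < n.+1) e * j i)%N = (e * m)%N.
  by rewrite -big_distrr /= -mdegE; have /= -> := hG j hj.
apply: (big_ind2 (fun (A : bform K) k => A \is k.-homog)) => [|A k B l hA hB|i _].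
- exact: dhomog1.
- exact: dhomogM.
rewrite tnth_mktuple; exact: dhomogMn (dhomog_rnc_coord i).
Qed.

Lemma Oreg_pullT m G p : G \is m.-homog -> Oreg fr (e * m)%N%:Z p (pullT fr e n G).
Proof. by move=> hG; rewrite pullTE; apply/Oreg_form/dhomog_pullback. Qed.

Lemma dird_ideal_hom v : ideal_hom fr (fun G : ideal => D v (sval G)).
Proof.
move=> A G H L ->; rewrite dirdD dirdM; congr (_ + _).
by rewrite (pullT_ideal fr (proj2_sig G)) mul0r addr0.
Qed.

Lemma ev_dird v G : in_curve_ideal e G -> ev (fun G : ideal => D v (sval G)) G = D v G.
Proof. by move=> h; rewrite -[G]/(sval (exist _ G h : ideal)) ev_sval. Qed.

Local Notation recur := (second_diff s t).

Definition qmon (l : nat) : T := s ^+ (e - 2 - l) * t ^+ l.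

Lemma qmon_neq0 l : qmon l != 0.
Proof. by rewrite mulf_neq0 // expf_neq0 ?sv_neq0 ?tv_neq0. Qed.

Lemma pullT_curve i : (i <= n)%N ->
  pullT fr e n (x i) = if (i <= e)%N then 1 * (s ^+ (e - i) * t ^+ i) else 0.
Proof. by move=> hi; rewrite pullT_xvar // mul1r. Qed.

Lemma dird_pullT_Q v l : (l < e.-1)%N -> D v (Q l.+1 l.+2) = qmon l * recur v l.
Proof. by move=> hl; rewrite (dird_Q hen pullT_curve) // mul1r. Qed.

(** The degrees of the summands of the normal bundle of C in P^n, which is
    O(e+2)^(e-1) + O(e)^(n-e). *)
Definition kdeg (l : nat) : int := if (l < e.-1)%N then e.+2%:Z else e%:Z.

(** A solution of the homogeneous recurrence in i which vanishes at i = k + 1.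
    Cut off there, it becomes, up to sign, the fundamental solution of the second
    difference with source at k. *)
Definition greens (i k : nat) : T :=
  (i%:Z - k%:Z - 1)%:~R * (t / s) ^+ i * (s ^+ k / t ^+ k.+2).

(** Vector fields along C with given coordinates u in the normal bundle of C: the
    second difference is inverted by summing the fundamental solution, cut off on
    either side. The field lift has no poles where s != 0, lift_rev has none where
    t != 0, and they differ by a solution of the homogeneous recurrence. *)
Definition lift u (i : nat) : T :=
  if (i <= e)%N then - \sum_(k < e.-1 | (k.+1 < i)%N) greens i k * u k else u (i - 2)%N.

Definition lift_rev u (i : nat) : T :=
  if (i <= e)%N then \sum_(k < e.-1 | (i <= k.+1)%N) greens i k * u k else u (i - 2)%N.

Lemma greens_step (a r F x0 y0 : T) : x0 != 0 ->
  x0 * y0 * ((a + 1) * (y0 / x0 * r) * F) *+ 2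
    - x0 ^+ 2 * ((a + 2) * (y0 / x0 * (y0 / x0 * r)) * F) - y0 ^+ 2 * (a * r * F) = 0.
Proof. by move=> h; field. Qed.

Lemma greens_second_diff l k :
  s * t * greens l.+1 k *+ 2 - s ^+ 2 * greens l.+2 k - t ^+ 2 * greens l k = 0.
Proof.
rewrite -(greens_step (l%:Z - k%:Z - 1)%:~R ((t / s) ^+ l) (s ^+ k / t ^+ k.+2) t (sv_neq0 fr_inj)).
rewrite /greens !exprS; set w := (l%:Z - k%:Z - 1)%:~R.
have -> : (l.+1%:Z - k%:Z - 1)%:~R = w + 1 :> T.
  by rewrite -[X in w + X]/(1%:~R) -intrD; congr _%:~R; lia.
have -> : (l.+2%:Z - k%:Z - 1)%:~R = w + 2 :> T.
  by rewrite -[X in w + X]/(2%:~R) -intrD; congr _%:~R; lia.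
by [].
Qed.

Lemma greens_diag k : greens k.+1 k = 0.
Proof. by rewrite /greens (_ : k.+1%:Z - k%:Z - 1 = 0) ?mul0r //; lia. Qed.

Lemma greens_unit l : s ^+ 2 * greens l.+2 l = 1.
Proof.
rewrite /greens (_ : l.+2%:Z - l%:Z - 1 = 1) ?mul1r; last by lia.
have [hs ht] := (sv_neq0 fr_inj, tv_neq0 fr_inj).
rewrite expr_div_n -!(addn2 l) !exprD.
by move: s t hs ht => a b ha hb; field; rewrite ?ha ?hb ?expf_neq0.
Qed.

Lemma second_diff_lift u l : (l < e.-1)%N -> recur (lift u) l = u l.
Proof.
move=> hl; pose g i k := if (k.+1 < i)%N then greens i k else 0.
have liftE i : (i <= e)%N -> lift u i = - \sum_(k < e.-1) g i k * u k.
  move=> hi; rewrite /lift hi big_mkcond; congr (- _); apply: eq_bigr => k _.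
  by rewrite /g; case: ifP => _; rewrite ?mul0r.
rewrite /second_diff !liftE; try lia.
have -> : u l = \sum_(k < e.-1) ((k : nat) == l)%:R * u k.
  rewrite (bigD1 (Ordinal hl)) //= eqxx mul1r big1 ?addr0 // => k.
  by rewrite -val_eqE /= => /negPf ->; rewrite mul0r.
set A := \sum_(k < _) g l.+1 k * _; set B := \sum_(k < _) g l.+2 k * _.
set C := \sum_(k < _) g l k * _.
transitivity (- (s * t * A *+ 2 - s ^+ 2 * B - t ^+ 2 * C)); first by ring.
rewrite /A /B /C !mulr_sumr -sumrMnl -!sumrB -sumrN; apply: eq_bigr => k _ /=.
have -> : ((k : nat) == l)%:R = - (s * t * g l.+1 k *+ 2 - s ^+ 2 * g l.+2 k - t ^+ 2 * g l k).
  have [hk|hk|hk] := ltngtP (k : nat) l.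
  - have -> : g l k = greens l k.
      rewrite /g; case: ltnP => // h; have -> : l = k.+1 by lia.
      by rewrite greens_diag.
    by rewrite /g !ifT ?greens_second_diff ?oppr0 //; lia.
  - by rewrite /g !ifF ?mulr0 ?mul0rn ?subrr ?oppr0 //; lia.
  - rewrite /g hk ltnn ltnS leqnn ifF; last by lia.
    by rewrite greens_unit !mulr0 mul0rn sub0r subr0 opprK.
ring.
Qed.

Lemma second_diff_lift_rev u l : (l < e.-1)%N -> recur (lift_rev u) l = u l.
Proof.
move=> hl; rewrite -[RHS]second_diff_lift //.
pose d i := \sum_(k < e.-1) greens i k * u k.
have dE i : (i <= e)%N -> lift_rev u i = lift u i + d i.
  move=> hi; have -> : d i = \sum_(k < e.-1 | (k.+1 < i)%N) greens i k * u k
      + \sum_(k < e.-1 | ~~ (k.+1 < i)%N) greens i k * u k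
    by rewrite /d (bigID (fun k : 'I_e.-1 => (k.+1 < i)%N)).
  rewrite /lift /lift_rev hi addKr; apply: eq_bigl => k.
  by rewrite -leqNgt.
have hd : recur d l = 0.
  rewrite /second_diff /d !mulr_sumr -sumrMnl -!sumrB; apply: big1 => k _ /=.
  transitivity ((s * t * greens l.+1 k *+ 2 - s ^+ 2 * greens l.+2 k - t ^+ 2 * greens l k) * u k).
    by ring.
  by rewrite greens_second_diff mul0r.
rewrite -[RHS]addr0 -hd /second_diff !dE; try lia; ring.
Qed.

(** The two lifts differ by a tangent field, so they have the same effect on the
    ideal of the curve. *)
Lemma dird_lift_rev u (G : ideal) : D (lift_rev u) (sval G) = D (lift u) (sval G).
Proof.
apply: (@ideal_hom_ext _ _ fr fr_inj e n he hen _ _ (dird_ideal_hom _) (dird_ideal_hom _)).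
- move=> [|i] // hi; rewrite !ev_dird; try (apply: in_ideal_Q; lia).
  by rewrite !dird_pullT_Q ?second_diff_lift ?second_diff_lift_rev //; lia.
- move=> j hj; rewrite !ev_dird; try exact: in_ideal_x.
  by rewrite !dird_xvar ?/lift ?/lift_rev ?ifF //; lia.
Qed.

Lemma Oreg_greens p i k : is_pt p -> p ord0 != 0 -> (k.+1 < i)%N -> Oreg fr (- 2) p (greens i k).
Proof.
move=> hp hp0 hk; have -> : greens i k
    = (i%:Z - k%:Z - 1)%:~R * (t ^+ (i - k.+2) * s ^ (- (i - k)%N%:Z)).
  rewrite /greens -!mulrA; congr (_ * _).
  have [hs ht] := (sv_neq0 fr_inj, tv_neq0 fr_inj).
  have [j ->] : exists j, i = (j + k.+2)%N by exists (i - k.+2)%N; lia.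
  rewrite addnK -exprnN (_ : j + k.+2 - k = j + 2)%N; last by lia.
  rewrite expr_div_n -(addn2 k) addnA !exprD.
  by move: s t hs ht => a b ha hb; field; rewrite ?ha ?hb ?expf_neq0.
rewrite (_ : - 2 = 0 + ((i - k.+2)%N%:Z + (- (i - k)%N%:Z))); last by lia.
by apply: OregM; [apply: Oreg_int | apply: OregM; [apply: Oreg_tvX | apply: Oreg_svz]].
Qed.

Lemma Oreg_greens_rev p i k : is_pt p -> p ord_max != 0 -> (i <= k.+1)%N ->
  Oreg fr (- 2) p (greens i k).
Proof.
move=> hp hp0; rewrite leq_eqVlt => /orP[/eqP ->|].
  by rewrite greens_diag; apply: Oreg0.
move=> hk; have -> : greens i k
    = (i%:Z - k%:Z - 1)%:~R * (s ^+ (k - i) * t ^ (- (k.+2 - i)%N%:Z)).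
  rewrite /greens -!mulrA; congr (_ * _).
  have [hs ht] := (sv_neq0 fr_inj, tv_neq0 fr_inj).
  have [j ->] : exists j, k = (j + i)%N by exists (k - i)%N; lia.
  rewrite addnK -exprnN (_ : (j + i).+2 - i = j + 2)%N; last by lia.
  rewrite expr_div_n -(addn2 (j + i)) !exprD.
  by move: s t hs ht => a b ha hb; field; rewrite ?ha ?hb ?expf_neq0.
rewrite (_ : - 2 = 0 + ((k - i)%N%:Z + (- (k.+2 - i)%N%:Z))); last by lia.
by apply: OregM; [apply: Oreg_int | apply: OregM; [apply: Oreg_svX | apply: Oreg_tvz]].
Qed.

Lemma Oreg_dird p v G m : is_pt p -> (forall i, (i <= n)%N -> Oreg fr e p (v i)) ->
  G \is m.-homog -> Oreg fr (e * m)%N%:Z p (D v G).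
Proof.
move=> hp hv hG; apply: Oreg_sum => // i _; case: m hG => [|m] hG.
  by rewrite mderiv_dhomog0 // rmorph0 mul0r; apply: Oreg0.
rewrite mulnS addnC PoszD; apply: OregM; last by apply: hv; rewrite -ltnS.
exact/Oreg_pullT/dhomog_mderiv.
Qed.

(** Each of the two lifts gives regularity on one of the two charts. *)
Lemma Oreg_lift p u (G : ideal) m : is_pt p ->
  (forall l, (l < n.-1)%N -> Oreg fr (kdeg l) p (u l)) ->
  sval G \is m.-homog -> Oreg fr (e * m)%N%:Z p (D (lift u) (sval G)).
Proof.
move=> hp hu hG; have [hp0|hp0] := is_ptP hp; last rewrite -dird_lift_rev.
- apply: Oreg_dird => // i hi; rewrite /lift; case: leqP => hie; last first.
    by have := hu (i - 2)%N; rewrite /kdeg ifF; [apply; lia | lia].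
  apply: OregN; apply: Oreg_sum => // k hk.
  rewrite (_ : e%:Z = - 2 + e.+2%:Z); last by lia.
  apply: OregM; first exact: Oreg_greens.
  by have := hu k; rewrite /kdeg ltn_ord; apply; have := ltn_ord k; lia.
- apply: Oreg_dird => // i hi; rewrite /lift_rev; case: leqP => hie; last first.
    by have := hu (i - 2)%N; rewrite /kdeg ifF; [apply; lia | lia].
  apply: Oreg_sum => // k hk.
  rewrite (_ : e%:Z = - 2 + e.+2%:Z); last by lia.
  apply: OregM; first exact: Oreg_greens_rev.
  by have := hu k; rewrite /kdeg ltn_ord; apply; have := ltn_ord k; lia.
Qed.

(** Coordinates of a normal vector field in O(e+2)^(e-1) + O(e)^(n-e): by Leibniz
    its value on Q_{l+1,l+2} is divisible by the monomial qmon l. *)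
Definition coords (phi : ideal -> T) (l : nat) : T :=
  if (l < e.-1)%N then ev phi (Q l.+1 l.+2) / qmon l
  else if (l < n.-1)%N then ev phi (x l.+2) else 0.

Lemma coords_Q phi l : (l < e.-1)%N -> coords phi l = ev phi (Q l.+1 l.+2) / qmon l.
Proof. by rewrite /coords => ->. Qed.

Lemma coords_x phi j : (e < j <= n)%N -> coords phi (j - 2) = ev phi (x j).
Proof.
move=> hj; rewrite /coords ifF; last by lia.
by rewrite ifT; [congr (ev _ (x _)); lia | lia].
Qed.

(** Both sides take the same values on the Q_{i,i+1} and the x_j. *)
Lemma lift_coords phi : ideal_hom fr phi ->
  forall G : ideal, D (lift (coords phi)) (sval G) = phi G.
Proof.
move=> hphi; apply: (@ideal_hom_ext _ _ fr fr_inj e n he hen _ _ (dird_ideal_hom _) hphi).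
- move=> [|i] // hi; rewrite ev_dird; last by apply: in_ideal_Q; lia.
  rewrite dird_pullT_Q ?second_diff_lift ?coords_Q; try lia.
  by rewrite mulrC divfK // qmon_neq0.
- move=> j hj; rewrite ev_dird; last exact: in_ideal_x.
  by rewrite dird_xvar ?/lift ?ifF ?coords_x //; lia.
Qed.

Lemma coords_lift u l : (l < n.-1)%N ->
  coords (fun G : ideal => D (lift u) (sval G)) l = u l.
Proof.
move=> hl; have [hle|hle] := ltnP l e.-1.
  rewrite coords_Q // ev_dird; last by apply: in_ideal_Q; lia.
  by rewrite dird_pullT_Q // second_diff_lift // mulrC mulKf // qmon_neq0.
have -> : l = (l.+2 - 2)%N by lia.
rewrite coords_x; last by lia.
rewrite ev_dird; last by apply: in_ideal_x; lia.
by rewrite dird_xvar /lift ?ifF //; lia.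
Qed.

Lemma coords_lin : linear_fun coords.
Proof.
move=> z v w; apply: functional_extensionality => l; rewrite /coords.
have evl G : ev (fun G0 : ideal => z * v G0 + w G0) G = z * ev v G + ev w G.
  by rewrite /ev; case: excluded_middle_informative => // _; rewrite mulr0 addr0.
case: ifP => _; first by rewrite evl mulrDl mulrA.
by case: ifP => _; rewrite ?evl ?mulr0 ?addr0.
Qed.

Lemma lift_lin : linear_fun lift.
Proof.
move=> z v w; apply: functional_extensionality => i; rewrite /lift; case: ifP => // _.
rewrite mulrN -opprD mulr_sumr -big_split; congr (- _); apply: eq_bigr => k _ /=; ring.
Qed.

Lemma dhomog_Q i j : (Q i j) \is 2.-homog.
Proof.
rewrite /Qform; apply: rpredB; rewrite -[2%N]/(1 + 1)%N; apply: dhomogM; exact: dhomog_var.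
Qed.

Lemma Oreg_ev_Q U phi F i j p : normal_sheaf F U phi -> (0 < i <= e)%N -> (0 < j <= e)%N ->
  U p -> Oreg fr (e * 2)%N%:Z p (ev phi (Q i j)).
Proof.
move=> [_ h _] hi hj hU; have hQ : in_curve_ideal e (Q i j) by apply: in_ideal_Q.
rewrite -[Q i j]/(sval (exist _ _ hQ : ideal)) ev_sval; apply: h => //; exact: dhomog_Q.
Qed.

(** The value on Q_{l+1,l+2} is divided by a monomial; where s != 0 the quadrics
    Q_{1,i}, and where t != 0 the quadrics Q_{i,e}, express the quotient with a
    power of s, resp. of t, as the only denominator. *)
Lemma Oreg_coords U phi F l p : zopen U -> normal_sheaf F U phi -> U p -> (l < n.-1)%N ->
  Oreg fr (kdeg l) p (coords phi l).
Proof.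
move=> hU hphi hp hl; have [hom hreg _] := hphi; rewrite /kdeg; case: ltnP => hle; last first.
  rewrite /coords ifF; last by lia.
  rewrite hl; have hx : in_curve_ideal e (x l.+2) by apply: in_ideal_x; lia.
  rewrite -[x _]/(sval (exist _ _ hx : ideal)) ev_sval -[X in Posz X](muln1 e).
  by apply: hreg => //; apply: dhomog_var.
have [hs ht] := (sv_neq0 fr_inj, tv_neq0 fr_inj).
rewrite coords_Q //; have [hp0|hp0] := is_ptP (zopen_pt hU hp).
- have := @ev_Q_head _ _ fr e n he hen phi hom l.+1; rewrite ltnS /= => hd.
  have -> : ev phi (Q l.+1 l.+2) / qmon l
      = (s * ev phi (Q 1 l.+2) - t * ev phi (Q 1 l.+1)) * s ^ (- e.-1%:Z).
    have /hd : (l.+1 < e)%N by lia.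
    rewrite /xc /qmon subn0 expr0 mulr1 -exprnN.
    have -> : (e - l = (e - 2 - l).+2)%N by lia.
    have -> : (e - l.+1 = (e - 2 - l).+1)%N by lia.
    have -> : s ^+ e = s * s ^+ e.-1 by rewrite -exprS prednK //; lia.
    rewrite !exprS; move: (ev phi (Q l.+1 l.+2)) (ev phi (Q 1 l.+2)) (ev phi (Q 1 l.+1)) => A B C.
    have hA : s ^+ e.-1 != 0 by rewrite expf_neq0.
    have hB : s ^+ (e - 2 - l) != 0 by rewrite expf_neq0.
    have hC : t ^+ l != 0 by rewrite expf_neq0.
    move: (s ^+ e.-1) (s ^+ (e - 2 - l)) (t ^+ l) hA hB hC => a b c ha hb hc h.
    have -> : A = (s * (s * b) * c * B - s * b * (t * c) * C) / (s * a).
      by rewrite -h mulrAC mulfV ?mul1r // mulf_neq0.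
    by field; rewrite ha hb hc.
  rewrite (_ : e.+2%:Z = 1 + (e * 2)%N%:Z + (- e.-1%:Z)); last by lia.
  apply: OregM; last exact: Oreg_svz.
  apply: (OregB fr_inj); apply: OregM; try (apply: (Oreg_ev_Q hphi) => //; lia).
    exact: (Oreg_svX fr p 1).
  exact: (Oreg_tvX fr p 1).
- have := @ev_Q_last _ _ fr e n he hen phi hom l.+1; rewrite ltnS /= => hd.
  have -> : ev phi (Q l.+1 l.+2) / qmon l
      = (t * ev phi (Q l.+1 e) - s * ev phi (Q l.+2 e)) * t ^ (- e.-1%:Z).
    have /hd : (l.+1 < e)%N by lia.
    rewrite /xc /qmon (_ : e - e.-1 = 1)%N ?expr1 -?exprnN; last by lia.
    have -> : (e - l = (e - 2 - l).+2)%N by lia.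
    have -> : (e - l.+1 = (e - 2 - l).+1)%N by lia.
    rewrite !exprS; move: (ev phi (Q l.+1 l.+2)) (ev phi (Q l.+1 e)) (ev phi (Q l.+2 e)) => A B C.
    have hA : t ^+ e.-1 != 0 by rewrite expf_neq0.
    have hB : s ^+ (e - 2 - l) != 0 by rewrite expf_neq0.
    have hC : t ^+ l != 0 by rewrite expf_neq0.
    move: (t ^+ e.-1) (s ^+ (e - 2 - l)) (t ^+ l) hA hB hC => a b c ha hb hc h.
    have -> : A = (s * b * (t * c) * B - s * (s * b) * c * C) / (s * a).
      by rewrite -h mulrAC mulfV ?mul1r // mulf_neq0.
    by field; rewrite ha hb hc.
  rewrite (_ : e.+2%:Z = 1 + (e * 2)%N%:Z + (- e.-1%:Z)); last by lia.
  apply: OregM; last exact: Oreg_tvz.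
  apply: (OregB fr_inj); apply: OregM; try (apply: (Oreg_ev_Q hphi) => //; lia).
    exact: (Oreg_tvX fr p 1).
  exact: (Oreg_svX fr p 1).
Qed.

(** The normal bundle of C in V(F) is the kernel of the map that evaluates a
    normal vector field of C in P^n on F. *)
Theorem normal_sheaf_ker F (h : nat -> T) : in_curve_ideal e F ->
  (forall u, D (lift u) F = \sum_(l < n.-1) h l * u l) ->
  gen_iso (normal_sheaf F) (ker_sheaf fr n.-1 kdeg h).
Proof.
move=> hF hh; exists coords, (fun u (G : ideal) => D (lift u) (sval G)).
split=> [||U phi hU hphi|U u hU [hu1 hu2 hu3]].
- exact: coords_lin.
- move=> z v w; apply: functional_extensionality => G.
  by rewrite lift_lin dird_lin.
- have [hom hreg hkill] := hphi; split; last first.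
    by apply: functional_extensionality => G; apply: lift_coords.
  split=> [l hl p hp|l hl|].
  + exact: Oreg_coords hU hphi hp hl.
  + by rewrite /coords !ifF //; lia.
  + by rewrite -hh -[F]/(sval (exist _ F hF : ideal)) lift_coords // hkill.
- split; last first.
    apply: functional_extensionality => l; have [hl|hl] := ltnP l n.-1.
      exact: coords_lift.
    by rewrite hu2 // /coords !ifF //; lia.
  split=> [|m G hG p hp|G hG].
  + exact: dird_ideal_hom.
  + by apply: Oreg_lift => // [|l hl]; [exact: zopen_pt hp | apply: hu1].
  + by rewrite hG hh hu3.
Qed.

End NormalBundle.

Arguments normal_sheaf {K T} fr e {n} F _ _.

(** * Kernels of chains of monomials *)

Section Split.
Variables (K : fieldType) (T : fieldType) (fr : {rmorphism bform K -> T}).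

Definition ext0 (N : nat) (z : 'I_N -> T) (j : nat) : T :=
  if insub j is Some i then z i else 0.

Lemma ext0_ord N (z : 'I_N -> T) (i : 'I_N) : ext0 z i = z i.
Proof. by rewrite /ext0 valK. Qed.

Lemma ext0_lt N (z : 'I_N -> T) j (hj : (j < N)%N) : ext0 z j = z (Ordinal hj).
Proof. by rewrite -(ext0_ord z (Ordinal hj)). Qed.

Lemma ext0_lin N a (v w : 'I_N -> T) j :
  ext0 (fun i => a * v i + w i) j = a * ext0 v j + ext0 w j.
Proof. by rewrite /ext0; case: insub => [//|]; rewrite mulr0 addr0. Qed.

Lemma split_sheaf_perm (d d' : seq int) : perm_eq d d' ->
  gen_iso (split_sheaf fr d) (split_sheaf fr d').
Proof.
rewrite perm_sym => /(perm_iotaP 0)[js hjs hd'].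
have sz : size js = size d by rewrite (perm_size hjs) size_iota.
have sz' : size d' = size js by rewrite hd' size_map.
have mem j : (j \in js) = (j < size d)%N by rewrite (perm_mem hjs) mem_iota.
have un : uniq js by rewrite (perm_uniq hjs) iota_uniq.
have lt_nth (i : 'I_(size d')) : (nth 0%N js i < size d)%N.
  by rewrite -mem mem_nth // -sz'.
have lt_index (j : 'I_(size d)) : (index (j : nat) js < size d')%N.
  by rewrite sz' index_mem mem.
have dE j : (j < size js)%N -> d'`_j = d`_(nth 0%N js j).
  by move=> hj; rewrite hd' (nth_map 0%N).
exists (fun (z : 'I_(size d) -> T) (i : 'I_(size d')) => z (Ordinal (lt_nth i))).
exists (fun (w : 'I_(size d') -> T) (j : 'I_(size d)) => w (Ordinal (lt_index j))).
split=> // U v hU hv; split.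
- move=> i p hp; have := hv (Ordinal (lt_nth i)) p hp.
  by rewrite dE // -sz'.
- apply: functional_extensionality => j; congr (v _); apply: val_inj => /=.
  by rewrite nth_index ?mem.
- move=> j p hp; have := hv (Ordinal (lt_index j)) p hp.
  by rewrite dE ?nth_index ?index_mem ?mem.
- apply: functional_extensionality => i; congr (v _); apply: val_inj => /=.
  by rewrite index_uniq // -sz'.
Qed.

End Split.

Section Chain.
Variables (K T : fieldType) (fr : {rmorphism bform K -> T}).
Hypothesis fr_inj : injective fr.
Variables (N : nat) (c : nat -> int) (h : nat -> T) (p q : nat -> nat) (deg : int).
Variables (k0 : nat) (ch' free : seq nat).
Local Notation ch := (k0 :: ch').
Local Notation s := (sv fr).
Local Notation t := (tv fr).

Hypothesis ch_perm : perm_eq (ch ++ free) (iota 0 N).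
Hypothesis ch_mono : path (fun k l => (q k <= q l)%N && (p l <= p k)%N) k0 ch'.
Hypothesis ch_deg : forall k, k \in ch -> c k = deg - (p k)%:Z - (q k)%:Z.
Hypothesis ch_row : forall k, (k < N)%N -> h k = if k \in ch then s ^+ p k * t ^+ q k else 0.

Definition chain_degrees : seq int :=
  pairmap (fun k l => c k - (q l)%:Z + (q k)%:Z) k0 ch' ++ [seq c k | k <- free].

Let M := size ch'.
Let kk j := nth 0%N ch j.
Let P j := p (kk j).
Let R j := q (kk j).
Let mon j : T := s ^+ P j * t ^+ R j.
Let W j : T := s ^+ P j * t ^+ R j.+1.

Let kk_ch j : (j <= M)%N -> kk j \in ch.
Proof. by move=> hj; rewrite /kk mem_nth. Qed.

Let mono i j : (i <= j <= M)%N -> (R i <= R j)%N && (P j <= P i)%N.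
Proof.
move=> /andP[hij hj].
pose r k l := (q k <= q l)%N && (p l <= p k)%N.
have r_tr : transitive r.
  move=> y x z /andP[h1 h2] /andP[h3 h4].
  by rewrite /r (leq_trans h1 h3) (leq_trans h4 h2).
have r_refl : reflexive r by move=> x; rewrite /r !leqnn.
have := @sorted_leq_nth _ r r_tr r_refl 0%N ch ch_mono i j.
by rewrite !inE; apply => //; rewrite ltnS // (leq_trans hij).
Qed.

Let mem_ch_lt k : k \in ch -> (k < N)%N.
Proof.
by move=> hk; have := perm_mem ch_perm k; rewrite mem_cat hk mem_iota add0n.
Qed.

Let mem_free k : (k \in free) = (k < N)%N && (k \notin ch).
Proof.
have := perm_mem ch_perm k; rewrite mem_cat mem_iota add0n leq0n /= => <-.
have := perm_uniq ch_perm; rewrite iota_uniq cat_uniq => /and3P[_ /hasPn hd _].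
by case hk : (k \in free); rewrite ?orbF ?andbN ?orbT //; have := hd k hk.
Qed.

Let ch_uniq : uniq ch.
Proof. by have := perm_uniq ch_perm; rewrite iota_uniq cat_uniq => /and3P[]. Qed.

Let free_uniq : uniq free.
Proof. by have := perm_uniq ch_perm; rewrite iota_uniq cat_uniq => /and3P[]. Qed.

Let size_deg : size chain_degrees = (M + size free)%N.
Proof. by rewrite size_cat size_pairmap size_map. Qed.

Let ltn_deg (i : 'I_(size chain_degrees)) : (i < M + size free)%N.
Proof. by rewrite -size_deg. Qed.

Let deg_chain i : (i < M)%N -> chain_degrees`_i = deg - (P i)%:Z - (R i.+1)%:Z.
Proof.
move=> hi; rewrite nth_cat size_pairmap hi (nth_pairmap 0%N) // -/(kk i).
rewrite ch_deg; last exact: kk_ch (ltnW hi).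
by rewrite -/(P i) -/(R i) -/(R i.+1); lia.
Qed.

Let deg_free i : (i < size free)%N -> chain_degrees`_(M + i) = c (nth 0%N free i).
Proof.
move=> hi; rewrite nth_cat size_pairmap ltnNge leq_addr addKn /=.
by rewrite (nth_map 0%N).
Qed.

Let c_chain j : (j <= M)%N -> c (kk j) = deg - (P j)%:Z - (R j)%:Z.
Proof. by move=> hj; rewrite ch_deg // kk_ch. Qed.

Let mon_neq0 j : mon j != 0.
Proof. by rewrite mulf_neq0 // expf_neq0 ?sv_neq0 ?tv_neq0. Qed.

Let W_neq0 j : W j != 0.
Proof. by rewrite mulf_neq0 // expf_neq0 ?sv_neq0 ?tv_neq0. Qed.

Let sum_chain (u : nat -> T) : \sum_(l < N) h l * u l = \sum_(0 <= j < M.+1) mon j * u (kk j).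
Proof.
rewrite -(big_mkord xpredT (fun l => h l * u l)) /index_iota subn0.
rewrite -(perm_big _ ch_perm) big_cat /=.
rewrite [X in _ + X](_ : _ = 0) ?addr0; last first.
  rewrite big_seq; apply: big1 => k; rewrite mem_free => /andP[hk /negPf hk'].
  by rewrite ch_row // hk' mul0r.
rewrite (big_nth 0%N) big_seq [RHS]big_seq; apply: eq_bigr => j.
rewrite mem_index_iota => hj; rewrite -/(kk j).
by rewrite ch_row ?kk_ch // mem_ch_lt // kk_ch.
Qed.

(** In a chain the syzygies between neighbours generate all syzygies. In terms of
    Z_j = W_{j-1} z_{j-1}, where z_{j-1} is the coefficient of the syzygy between
    the monomials j-1 and j, the kernel element is u_j = (Z_{j+1} - Z_j) / mon_j, so
    Z is recovered from u by partial sums. *)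
Let Z (z : nat -> T) j : T := if (0 < j <= M)%N then W j.-1 * z j.-1 else 0.

Let to_split (u : nat -> T) (i : 'I_(size chain_degrees)) : T :=
  if (i < M)%N then (\sum_(0 <= j < i.+1) mon j * u (kk j)) / W i
  else u (nth 0%N free (i - M)).

Let of_split (z : 'I_(size chain_degrees) -> T) (k : nat) : T :=
  if k \in ch then (Z (ext0 z) (index k ch).+1 - Z (ext0 z) (index k ch)) / mon (index k ch)
  else if (k < N)%N then ext0 z (M + index k free) else 0.

Let of_split_kk z j : (j <= M)%N ->
  of_split z (kk j) = (Z (ext0 z) j.+1 - Z (ext0 z) j) / mon j.
Proof. by move=> hj; rewrite /of_split kk_ch // index_uniq. Qed.

Let to_split_lin : linear_fun to_split.
Proof.
move=> a v w; apply: functional_extensionality => i; rewrite /to_split; case: ifP => // _.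
rewrite mulrA -mulrDl mulr_sumr -big_split; congr (_ / _); apply: eq_bigr => j _ /=; ring.
Qed.

Let of_split_lin : linear_fun of_split.
Proof.
move=> a v w; apply: functional_extensionality => k; rewrite /of_split /Z !ext0_lin.
case: ifP => _; last by case: ifP => _; rewrite ?mulr0 ?addr0.
by case: ifP => _; case: ifP => _; ring.
Qed.

Let mon_div_W i j : mon j / W i = s ^ ((P j)%:Z - (P i)%:Z) * t ^ ((R j)%:Z - (R i.+1)%:Z).
Proof. by rewrite /mon /W !expfzDr ?sv_neq0 ?tv_neq0 // -!exprnN !exprnP invfM; ring. Qed.

Let Oreg_part U (u : nat -> T) i x (J : seq nat) : zopen U -> U x -> (i < M)%N ->
  (forall j, j \in J -> (j <= M)%N) ->
  (forall l, (l < N)%N -> Oreg fr (c l) x (u l)) ->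
  (forall j, j \in J -> x ord0 != 0 \/ (P i <= P j)%N) ->
  (forall j, j \in J -> x ord_max != 0 \/ (R i.+1 <= R j)%N) ->
  Oreg fr (deg - (P i)%:Z - (R i.+1)%:Z) x ((\sum_(j <- J) mon j * u (kk j)) / W i).
Proof.
move=> hU hx hi hJ hu hs ht; rewrite mulr_suml big_seq; apply: Oreg_sum => //.
  exact: zopen_pt hx.
move=> j hj; rewrite mulrAC mon_div_W.
have -> : deg - (P i)%:Z - (R i.+1)%:Z
    = ((P j)%:Z - (P i)%:Z) + ((R j)%:Z - (R i.+1)%:Z) + c (kk j).
  by rewrite c_chain ?hJ //; lia.
apply: OregM; last by apply: hu; rewrite mem_ch_lt // kk_ch // hJ.
apply: OregM.
- by case: (hs j hj) => hP; [apply: Oreg_svz | rewrite subzn // -exprnP; apply: Oreg_svX].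
- by case: (ht j hj) => hP; [apply: Oreg_tvz | rewrite subzn // -exprnP; apply: Oreg_tvX].
Qed.

(** Where t != 0 a partial sum of the kernel relation is divisible by the
    monomial W_i, and where s != 0 the complementary partial sum is. *)
Theorem chain_kernel_split :
  gen_iso (ker_sheaf fr N c h) (split_sheaf fr chain_degrees).
Proof.
exists to_split, of_split; split=> // U.
- move=> u hU [hu1 hu2 hu3]; rewrite sum_chain in hu3; split.
    move=> i x hx; rewrite /to_split; case: ltnP => hi; last first.
      have hi2 : (i - M < size free)%N by have := ltn_deg i; lia.
      rewrite -{1}(subnKC hi) deg_free //; apply: hu1 => //.
      by have := mem_nth 0%N hi2; rewrite mem_free => /andP[].
    rewrite deg_chain //.
    have hu l : (l < N)%N -> Oreg fr (c l) x (u l) by move=> hl; apply: hu1.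
    have [hx0|hx0] := is_ptP (zopen_pt hU hx).
    + have -> : \sum_(0 <= j < i.+1) mon j * u (kk j)
          = - \sum_(i.+1 <= j < M.+1) mon j * u (kk j).
        apply/eqP; rewrite -addr_eq0; apply/eqP; rewrite -[RHS]hu3.
        by rewrite [RHS](big_cat_nat (n := i.+1)) // ltnW.
      rewrite mulNr; apply: OregN.
      apply: (Oreg_part hU hx) => // j; rewrite mem_index_iota => hj; try lia.
      by right; have /andP[] := @mono i.+1 j ltac:(lia).
    + apply: (Oreg_part hU hx) => // j; rewrite mem_index_iota => hj; try lia.
      by right; have /andP[] := @mono j i ltac:(lia).
  apply: functional_extensionality => k; rewrite /of_split.
  case: ifP => hk; last first.
    case: ifP => hkN; last by rewrite hu2 // leqNgt hkN.
    have hf : k \in free by rewrite mem_free hkN hk.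
    have hlt : (M + index k free < size chain_degrees)%N by rewrite size_deg ltn_add2l index_mem.
    rewrite (ext0_lt _ hlt) /to_split /= ltnNge leq_addr /= addKn nth_index //.
  have hj : (index k ch <= M)%N by rewrite -ltnS -[M.+1]/(size ch) index_mem.
  have ZE j : (j <= M.+1)%N -> Z (ext0 (to_split u)) j = \sum_(0 <= i < j) mon i * u (kk i).
    case: j => [|j] hjM; first by rewrite big_geq.
    rewrite /Z /=; case: ltnP => hjM'; last by rewrite (_ : j.+1 = M.+1) ?hu3 //; lia.
    have hlt : (j < size chain_degrees)%N by rewrite size_deg; lia.
    by rewrite (ext0_lt _ hlt) /to_split /= hjM' mulrC divfK.
  rewrite !ZE; try lia.
  rewrite big_nat_recr //= [X in X - _]addrC addrK /kk nth_index //.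
  by rewrite mulrC mulKf.
- move=> z hU hz.
  have ZS j : (j < M)%N -> exists2 i : 'I_(size chain_degrees), i = j :> nat &
      Z (ext0 z) j.+1 = W j * z i.
    move=> hj; have hlt : (j < size chain_degrees)%N by rewrite size_deg; lia.
    by exists (Ordinal hlt) => //; rewrite /Z /= hj (ext0_lt _ hlt).
  have tel j : (j <= M.+1)%N ->
      \sum_(0 <= i < j) mon i * of_split z (kk i) = Z (ext0 z) j.
    move=> hj; transitivity (\sum_(0 <= i < j) (Z (ext0 z) i.+1 - Z (ext0 z) i)).
      rewrite big_seq [RHS]big_seq; apply: eq_bigr => i; rewrite mem_index_iota => hi.
      by rewrite of_split_kk; [rewrite mulrC divfK | lia].
    by rewrite telescope_sumr // [Z _ 0]/Z /= subr0.
  split; last first.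
    apply: functional_extensionality => i; rewrite /to_split; case: ltnP => hi; last first.
      have hi2 : (i - M < size free)%N by have := ltn_deg i; lia.
      have := mem_nth 0%N hi2; rewrite mem_free => /andP[h1 /negPf h2].
      by rewrite /of_split h2 h1 index_uniq // subnKC // ext0_ord.
    rewrite tel; last by lia.
    have [i' e ->] := ZS _ hi; have -> : i' = i by apply: val_inj.
    by rewrite mulrC mulKf.
  split=> [l hl x hx|l hl|].
  + rewrite /of_split hl; case: ifP => hk; last first.
      have hf : l \in free by rewrite mem_free hl hk.
      have hlt : (M + index l free < size chain_degrees)%N by rewrite size_deg ltn_add2l index_mem.
      rewrite (ext0_lt _ hlt); have := hz (Ordinal hlt) x hx.
      by rewrite deg_free ?index_mem // nth_index.
    set j := index l ch; have hj : (j <= M)%N by rewrite -ltnS -[M.+1]/(size ch) index_mem.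
    have -> : l = kk j by rewrite /kk nth_index.
    rewrite c_chain // mulrBl; apply: (OregB fr_inj).
      have [hjM|hjM] := ltnP j M; last first.
        rewrite /Z ifF ?mul0r; last by lia.
        by apply: Oreg0 => //; apply: zopen_pt hx.
      have [i e ->] := ZS _ hjM; have := hz i x hx; rewrite e deg_chain // => hr.
      have /andP[hR _] := @mono j j.+1 ltac:(lia).
      have -> : W j * z i / mon j = t ^+ (R j.+1 - R j) * z i.
        rewrite /W /mon -{1}(subnK hR) exprD.
        have := mon_neq0 j; rewrite /mon mulf_eq0 negb_or => /andP[h1 h2].
        by move: (s ^+ _) (t ^+ R j) (t ^+ _) h1 h2 => a b b' ha hb; field; rewrite hb ha.
      have -> : deg - (P j)%:Z - (R j)%:Z = (R j.+1 - R j)%N%:Z + (deg - (P j)%:Z - (R j.+1)%:Z).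
        by lia.
      by apply: OregM => //; apply: Oreg_tvX.
    case: j hj => [|j] hj.
      by rewrite /Z /= mul0r; apply: Oreg0 => //; apply: zopen_pt hx.
    have [i e ->] := ZS _ hj; have := hz i x hx; rewrite e deg_chain // => hr.
    have /andP[_ hP] := @mono j j.+1 ltac:(lia).
    have -> : W j * z i / mon j.+1 = s ^+ (P j - P j.+1) * z i.
      rewrite /W /mon -{1}(subnK hP) exprD.
      have := mon_neq0 j.+1; rewrite /mon mulf_eq0 negb_or => /andP[h1 h2].
      move: (s ^+ P j.+1) (s ^+ _) (t ^+ _) h1 h2 => a a' b ha hb; field.
      by rewrite hb ha.
    have -> : deg - (P j.+1)%:Z - (R j.+1)%:Z
      = (P j - P j.+1)%N%:Z + (deg - (P j)%:Z - (R j.+1)%:Z) by lia.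
    by apply: OregM => //; apply: Oreg_svX.
  + rewrite /of_split (negPf (contra (@mem_ch_lt l) _)) ?ifF // -?leqNgt //; lia.
  + by rewrite sum_chain tel // /Z ltnn andbF.
Qed.

End Chain.

(** * Quadrics whose conormal map is a chain of monomials *)

Section ChainForm.
Variables (K : closedFieldType) (e n : nat).
Hypotheses (he : (2 <= e)%N) (hen : (e <= n)%N).
Variables (B : seq nat) (ga : nat -> nat).
Hypothesis B_sorted : sorted ltn B.
Hypothesis B_lt : forall b, b \in B -> (b < e.-1)%N.
Hypothesis ga_mono : {homo ga : i j / (i <= j)%N}.
Hypothesis ga_le : forall j, (ga j <= e)%N.
Hypothesis B_ga : forall b j, b \in B -> (e < j <= n)%N -> (b.+2 <= ga j)%N.
Local Notation x := (xvar K n).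
Local Notation Q := (Qform K n).

(** The quadrics of the theorem: B lists the exponents beta_i, and ga is the
    function gamma. *)
Definition chain_form : {mpoly K[n.+1]} :=
  \sum_(b <- B) Q b.+1 b.+2 + \sum_(e.+1 <= j < n.+1) x (ga j) * x j.

Lemma chain_form_dhomog : chain_form \is 2.-homog.
Proof.
apply: rpredD; apply: rpred_sum => j _; first exact: dhomog_Q.
by rewrite -[2%N]/(1 + 1)%N; apply: dhomogM; apply: dhomog_var.
Qed.

Lemma chain_form_ideal : in_curve_ideal e chain_form.
Proof.
apply: in_idealD => p hp; rewrite raddf_sum big_seq big1 // => j.
  move=> hj; have hQ : in_curve_ideal e (Q j.+1 j.+2).
    by apply: in_ideal_Q => //; have := B_lt hj; lia.
  exact: hQ.
rewrite mem_index_iota => hj; have hx : in_curve_ideal e (x j) by apply: in_ideal_x.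
by rewrite /= mevalM hx // mulr0.
Qed.

Section Derivative.
Variables (R : comNzRingType) (th : {rmorphism {mpoly K[n.+1]} -> R}) (c s t : R).
Hypothesis th_curve : forall i, (i <= n)%N ->
  th (x i) = if (i <= e)%N then c * (s ^+ (e - i) * t ^+ i) else 0.

Lemma dird_chain_form v : dird th v chain_form =
  \sum_(b <- B) c * (s ^+ (e - 2 - b) * t ^+ b) * second_diff s t v b
  + \sum_(e.+1 <= j < n.+1) c * (s ^+ (e - ga j) * t ^+ ga j) * v j.
Proof.
rewrite dirdD !dird_sum; congr (_ + _).
- rewrite big_seq [RHS]big_seq; apply: eq_bigr => b hb.
  by rewrite (dird_Q hen th_curve) // B_lt.
- rewrite big_seq [RHS]big_seq; apply: eq_bigr => j; rewrite mem_index_iota => hj.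
  by rewrite (dird_xx hen th_curve) ?ga_le.
Qed.

End Derivative.

(** Exponents of s and t in the monomial by which F acts on the l-th coordinate of
    the normal bundle of C in P^n, if l belongs to the chain; the other coordinates
    are killed. *)
Definition chain_p l : nat := if (l < e.-1)%N then (e - 2 - l)%N else (e - ga l.+2)%N.
Definition chain_q l : nat := if (l < e.-1)%N then l else ga l.+2.
Definition chain := B ++ iota e.-1 (n - e).
Definition chain_free := [seq l <- iota 0 e.-1 | l \notin B].

Lemma B_uniq : uniq B.
Proof. exact: (sorted_uniq ltn_trans ltnn). Qed.

Lemma chain_perm : perm_eq (chain ++ chain_free) (iota 0 n.-1).
Proof.
have -> : n.-1 = (e.-1 + (n - e))%N by lia.
rewrite iotaD add0n /chain -catA perm_catC -catA perm_catC -/(iota 0 _) perm_cat2r.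
rewrite perm_sym -(perm_filterC (mem B)) perm_catC perm_cat2l.
apply: uniq_perm; [exact: filter_uniq (iota_uniq _ _)|exact: B_uniq|].
move=> b; rewrite mem_filter mem_iota add0n leq0n /=.
by case hb : (b \in B) => //; rewrite B_lt.
Qed.

Lemma chain_sorted : sorted (fun k l => (chain_q k <= chain_q l)%N && (chain_p l <= chain_p k)%N) chain.
Proof.
set r := (fun k l => _).
have r_tr : transitive r.
  move=> y z w /andP[h1 h2] /andP[h3 h4].
  by rewrite /r (leq_trans h1 h3) (leq_trans h4 h2).
rewrite sorted_pairwise // pairwise_cat; apply/and3P; split.
- apply/allrelP => b l hb; rewrite mem_iota => hl; have hj : (e < l.+2 <= n)%N by lia.
  have hl' : (l < e.-1)%N = false by lia.
  by rewrite /r /chain_p /chain_q B_lt // hl'; have := B_ga hb hj; lia.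
- have := B_sorted; rewrite (sorted_pairwise ltn_trans).
  apply: (@sub_in_pairwise _ (mem B)); last exact/allP.
  move=> b b' hb hb' /= hbb; rewrite /r /chain_p /chain_q !B_lt //; lia.
- have := iota_ltn_sorted e.-1 (n - e); rewrite (sorted_pairwise ltn_trans).
  apply: (@sub_in_pairwise _ (fun l => e.-1 <= l)%N); last first.
    by apply/allP => l; rewrite mem_iota => /andP[].
  move=> l l' hl hl' /= hll; rewrite -!topredE /= in hl hl'; rewrite /r /chain_p /chain_q.
  rewrite !(leq_gtF hl) !(leq_gtF hl'); have := @ga_mono l.+2 l'.+2; lia.
Qed.

Lemma on_curve_nonzero (p : 'I_n.+1 -> K) : on_curve e p ->
  exists (c s t : K), [/\ c != 0, (s != 0) \/ (t != 0)
    & forall i, (i <= n)%N ->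
      (x i).@[p] = if (i <= e)%N then c * (s ^+ (e - i) * t ^+ i) else 0].
Proof.
move=> [st [c [hst hc hp]]]; exists c, (st ord0), (st ord_max); split=> //.
  exact: is_ptP.
move=> i hi; rewrite /xvar mevalXU hp /rnc_coord inordK //.
by case: ifP => _ //; rewrite mulr0.
Qed.

Section Smooth.
Hypothesis chain_head : 0%N \in B \/ exists2 j, (e < j <= n)%N & ga j = 0%N.
Hypothesis chain_last : (e - 2)%N \in B \/ exists2 j, (e < j <= n)%N & ga j = e.

(** The vector fields below have a single nonzero second difference, at the
    first or at the last quadric; so the derivative of the form along them is the
    first or last monomial of the chain, up to sign and a power of s or t. *)
Lemma second_diff_head (s t : K) b : (b < e.-1)%N ->
  second_diff s t (fun i => if (i <= e)%N then i.-1%:R * (s ^+ (e - i) * t ^+ (i - 2)) else 0) b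
    = if b == 0%N then - s ^+ e else 0.
Proof.
move=> hb; rewrite /second_diff; lazy beta.
have [-> -> ->] : [/\ (b <= e)%N = true, (b.+1 <= e)%N = true & (b.+2 <= e)%N = true].
  by split; lia.
have -> : (e - b.+2 = e - 2 - b)%N by lia.
have -> : (e - b.+1 = (e - 2 - b).+1)%N by lia.
have -> : (e - b = (e - 2 - b).+2)%N by lia.
case: b hb => [|[|b]] hb /=.
- have -> : s ^+ e = s * (s * s ^+ (e - 2 - 0)).
    by rewrite -!exprS; congr (_ ^+ _); lia.
  by rewrite !exprS; ring.
- by rewrite !exprS; ring.
have -> : (b.+4 - 2 = b.+2)%N by lia.
have -> : (b.+3 - 2 = b.+1)%N by lia.
have -> : (b.+2 - 2 = b)%N by lia.
by rewrite !exprS; ring.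
Qed.

Lemma second_diff_last (s t : K) b : (b < e.-1)%N ->
  second_diff s t (fun i => if (i <= e)%N then (e.-1 - i)%:R * (s ^+ (e - 2 - i) * t ^+ i) else 0) b
    = if b == (e - 2)%N then - t ^+ e else 0.
Proof.
move=> hb; rewrite /second_diff; lazy beta.
have [-> -> ->] : [/\ (b <= e)%N = true, (b.+1 <= e)%N = true & (b.+2 <= e)%N = true].
  by split; lia.
have [k hk] : exists k, e = (b + k).+2 by exists (e - 2 - b)%N; lia.
have -> : (e - 2 - b = k)%N by lia.
have -> : (b == e - 2)%N = (k == 0)%N by apply/eqP/eqP; lia.
have -> : (e.-1 - b = k.+1)%N by lia.
have -> : (e.-1 - b.+1 = k)%N by lia.
have -> : (e.-1 - b.+2 = k.-1)%N by lia.
have -> : (e - 2 - b.+1 = k.-1)%N by lia.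
have -> : (e - 2 - b.+2 = k.-2)%N by lia.
case: k hk => [|[|k]] hk /=.
- have -> : e = b.+2 by lia.
  by rewrite !exprS; ring.
- by rewrite !exprS; ring.
by rewrite !exprS; ring.
Qed.

(** The chain starts with a power of s and ends with a power of t, so its monomials
    have no common zero. *)
Lemma chain_form_smooth : smooth_along_curve e chain_form.
Proof.
move=> p /on_curve_nonzero[c [s [t [hc hst hp]]]] [_ hsing].
have sing v : dird (meval p) v chain_form = 0.
  by apply: big1 => i _; rewrite /= hsing mul0r.
have killB v : (forall b, (b < e.-1)%N -> second_diff s t v b = 0) ->
    \sum_(b <- B) c * (s ^+ (e - 2 - b) * t ^+ b) * second_diff s t v b = 0.
  by move=> hv; rewrite big_seq big1 // => b hb; rewrite hv ?mulr0 // B_lt.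
have var j (v : nat -> K) : (e < j <= n)%N -> (forall i, v i = (i == j)%:R) ->
    c * (s ^+ (e - ga j) * t ^+ ga j) = 0.
  move=> hj hv; rewrite -[RHS](sing v) (dird_chain_form hp) killB ?add0r; last first.
    move=> b hb; have z i : (i <= e)%N -> v i = 0.
      by move=> hi; rewrite hv ltn_eqF //; lia.
    by rewrite /second_diff !z ?mulr0 ?mul0rn ?subrr //; lia.
  rewrite (bigD1_seq j) ?iota_uniq ?mem_index_iota //= hv eqxx mulr1 big1 ?addr0 //.
  by move=> i /negPf hi; rewrite hv hi mulr0.
have quad b0 (v : nat -> K) y : b0 \in B -> (forall i, (e < i)%N -> v i = 0) ->
    (forall b, (b < e.-1)%N -> second_diff s t v b = if b == b0 then y else 0) ->
    c * (s ^+ (e - 2 - b0) * t ^+ b0) * y = 0.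
  move=> hb0 hv hy; rewrite -[RHS](sing v) (dird_chain_form hp).
  rewrite [X in _ + X]big_seq [X in _ + X]big1 ?addr0; last first.
    by move=> j; rewrite mem_index_iota => /andP[hj _]; rewrite hv ?mulr0.
  rewrite (bigD1_seq b0) ?B_uniq //= hy ?B_lt // eqxx big_seq_cond big1 ?addr0 //.
  by move=> b /andP[hb /negPf hne]; rewrite hy ?B_lt // hne mulr0.
have out (F : nat -> K) i : (e < i)%N -> (if (i <= e)%N then F i else 0) = 0.
  by move=> hi; rewrite leqNgt hi.
have hs : s = 0.
  apply/eqP; case: chain_head => [h0|[j hj hga]].
    have /eqP := quad _ _ _ h0 (out _) (second_diff_head s t).
    rewrite expr0 mulr1 !mulf_eq0 (negPf hc) oppr_eq0 !expf_eq0 /=.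
    by case/orP => /andP[].
  have /eqP := var j (fun i => (i == j)%:R) hj (fun=> erefl).
  by rewrite hga expr0 mulr1 subn0 mulf_eq0 (negPf hc) expf_eq0 => /andP[].
have ht : t = 0.
  apply/eqP; case: chain_last => [h0|[j hj hga]].
    have /eqP := quad _ _ _ h0 (out _) (second_diff_last s t).
    rewrite subnn expr0 mul1r !mulf_eq0 (negPf hc) oppr_eq0 !expf_eq0 /=.
    by case/orP => /andP[].
  have /eqP := var j (fun i => (i == j)%:R) hj (fun=> erefl).
  by rewrite hga subnn expr0 mul1r mulf_eq0 (negPf hc) expf_eq0 => /andP[].
by case: hst; rewrite ?hs ?ht eqxx.
Qed.

End Smooth.

Section NormalSplit.
Variables (T : fieldType) (fr : {rmorphism bform K -> T}).
Hypothesis fr_inj : injective fr.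
Local Notation s := (sv fr).
Local Notation t := (tv fr).

Let row (l : nat) : T := if l \in chain then s ^+ chain_p l * t ^+ chain_q l else 0.

Let row_dird (u : nat -> T) :
  dird (pullT fr e n) (lift fr e u) chain_form = \sum_(l < n.-1) row l * u l.
Proof.
rewrite (dird_chain_form (@pullT_curve K T fr e n)).
rewrite -(big_mkord xpredT (fun l => row l * u l)) /index_iota subn0 -(perm_big _ chain_perm).
rewrite /chain -catA !big_cat /= [X in _ = _ + (_ + X)]big_seq.
rewrite [X in _ = _ + (_ + X)]big1 => [|l]; last first.
  rewrite mem_filter mem_iota => /andP[hl hl']; rewrite /row mem_cat (negPf hl) mem_iota.
  by rewrite ifF ?mul0r //; lia.
rewrite addr0; congr (_ + _).
  rewrite big_seq [RHS]big_seq; apply: eq_bigr => b hb; have hb' := B_lt hb.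
  by rewrite (second_diff_lift fr_inj he hen) // /row mem_cat hb /chain_p /chain_q hb' mul1r.
have -> : (n.+1 - e.+1 = n - e)%N by lia.
have -> : e.+1 = (2 + e.-1)%N by lia.
rewrite iotaDl big_map big_seq [RHS]big_seq; apply: eq_bigr => l hl.
rewrite /row mem_cat hl orbT mul1r; move: hl; rewrite mem_iota => hl.
rewrite /lift /chain_p /chain_q !ifF; try lia.
by rewrite addKn.
Qed.

Theorem chain_form_normal (d : seq int) : (0 < size chain)%N ->
  perm_eq (chain_degrees (kdeg e) chain_q (head 0%N chain) (behead chain) chain_free) d ->
  gen_iso (normal_sheaf fr e chain_form) (split_sheaf fr d).
Proof.
move=> hsz hd.
have := normal_sheaf_ker fr_inj he hen chain_form_ideal row_dird.
move/gen_iso_trans; apply; apply: gen_iso_trans (split_sheaf_perm fr hd).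
have hch : chain = head 0%N chain :: behead chain by case: (chain) hsz.
apply: (@chain_kernel_split _ _ fr fr_inj n.-1 (kdeg e) row chain_p chain_q (e * 2)%N%:Z).
- by rewrite -hch; apply: chain_perm.
- by have := chain_sorted; rewrite {1}hch.
- rewrite -hch => k; rewrite mem_cat mem_iota => hk; rewrite /kdeg /chain_p /chain_q.
  by have := ga_le k.+2; case: ltnP => hk'; lia.
- by rewrite -hch => k _.
Qed.

End NormalSplit.
End ChainForm.

(** * Splittings of a kernel bundle *)

Section SplitData.
Variables (K : closedFieldType) (T : fieldType) (fr : {rmorphism bform K -> T}).
Hypothesis fr_inj : injective fr.

(** Nonvanishing regular sections of O(k) at p. *)
Definition Ounit (k : int) (p : 'I_2 -> K) (z : T) : Prop :=
  exists (a b : bform K) (da db : nat),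
    [/\ a \is da.-homog, b \is db.-homog, da%:Z = db%:Z + k,
        a.@[p] != 0 /\ b.@[p] != 0 & z = fr a / fr b].

Lemma Ounit_neq0 k p z : Ounit k p z -> z != 0.
Proof.
move=> [a [b [da [db [_ _ _ [ha hb] ->]]]]].
by rewrite mulf_neq0 ?invr_eq0 ?fr_neq0 //; [exact: meval_neq0 ha | exact: meval_neq0 hb].
Qed.

Lemma Ounit_inv k p z : Ounit k p z -> Oreg fr (- k) p z^-1.
Proof.
move=> [a [b [da [db [ha hb e [hp _] ->]]]]]; exists b, a, db, da.
by split=> //; [lia | rewrite invfM invrK mulrC].
Qed.

Lemma Ounit_generic k p z : Oreg fr k p z -> z != 0 -> exists2 p', is_pt p' & Ounit k p' z.
Proof.
move=> [a [b [da [db [ha hb e hp ez]]]]] hz.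
have ha0 : a != 0 by apply: contraNneq hz => a0; rewrite ez a0 rmorph0 mul0r.
have hab : a * b != 0 by rewrite mulf_neq0 // (meval_neq0 hp).
have [[p' hp' hne]|nex] := classic (exists2 p', is_pt p' & (a * b).@[p'] != 0); last first.
  move/eqP: hab; case; apply: mpoly2_eq0 => p' hp'; apply/eqP/negPn/negP => hne.
  by apply: nex; exists p'.
exists p' => //; exists a, b, da, db; split=> //.
by move: hne; rewrite mevalM mulf_eq0 negb_or => /andP.
Qed.

Section Data.
Variables (N r : nat) (c : nat -> int) (h : nat -> T) (deg : int).
Variables (d : 'I_r -> int) (A : 'I_r -> nat -> T).

(** B is inverse to A on the kernel of h; on all of T^N the product of the two is
    the projection to the kernel along the basis vector e_{l0}. *)
Definition local_inverse (p : 'I_2 -> K) (l0 : nat) (B : 'I_r -> nat -> T) : Prop :=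
  [/\ forall i k, (k < N)%N -> Oreg fr (d i - c k) p (B i k),
      forall k l, (k < N)%N -> (l < N)%N ->
        \sum_(i < r) B i k * A i l = (l == k)%:R - h k / h l0 * (l == l0)%:R
    & forall i j, \sum_(k < N) A i k * B j k = (j == i)%:R].

(** The columns A i of forms describe an isomorphism from the sum of the
    O(d i) onto the kernel of the row h; locally, where h_{l0} is invertible,
    the coordinates with respect to the A i are given by a matrix B. *)
Record split_data : Prop := SplitData {
  sd_reg : forall i l p, (l < N)%N -> is_pt p -> Oreg fr (c l - d i) p (A i l);
  sd_ker : forall i, \sum_(l < N) h l * A i l = 0;
  sd_row : forall l p, (l < N)%N -> is_pt p -> Oreg fr (deg - c l) p (h l);
  sd_inv : forall p l0, is_pt p -> (l0 < N)%N -> Ounit (deg - c l0) p (h l0) ->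
    exists B, local_inverse p l0 B
}.
End Data.

(** No common zeros: the row is a surjective map of bundles onto O(deg). *)
Definition row_surjective N c h deg : Prop :=
  forall p, is_pt p -> exists2 l0, (l0 < N)%N & Ounit (deg - c l0) p (h l0).

Lemma local_inverse_l0 N r c h (d : 'I_r -> int) A p l0 B :
  local_inverse N c h d A p l0 B -> (l0 < N)%N -> h l0 != 0 -> forall j, B j l0 = 0.
Proof.
move=> [_ hBA hAB] hl0 hne j.
transitivity (\sum_(k < N) (\sum_(i < r) B i l0 * A i k) * B j k).
  under eq_bigr do rewrite mulr_suml; rewrite exchange_big /=.
  rewrite (bigD1 j) //= [X in _ + X]big1 ?addr0 => [|i hi].
    by under eq_bigr do rewrite -mulrA; rewrite -mulr_sumr hAB eqxx mulr1.
  by under eq_bigr do rewrite -mulrA; rewrite -mulr_sumr hAB eq_sym (negPf hi) mulr0.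
rewrite big1 // => k _; rewrite hBA //.
by rewrite divff // mul1r subrr mul0r.
Qed.

(** Adding to the columns A the column e_{l0} / h_{l0}, a local preimage of 1,
    gives an invertible matrix; its determinant does not depend on l0, because
    two such columns differ by a combination of the A i. So the determinant is
    a global section without zeros of the line bundle of degree
    sum c - sum d - deg. *)
Lemma split_degree N r c h deg (d : 'I_r -> int) A :
  split_data N c h deg d A -> row_surjective N c h deg ->
  N = (r + 1)%N /\ \sum_(l < N) c l = deg + \sum_i d i.
Proof.
move=> [hreg hker hrow hinv] hsurj.
pose MA : 'M[T]_(N, r) := \matrix_(l, i) A i l.
pose X l0 : 'M[T]_(N, r + 1) := row_mx MA (\col_l (((l : nat) == l0)%:R / h l0)).
pose Y (B : 'I_r -> nat -> T) : 'M[T]_(r + 1, N) := col_mx (\matrix_(i, k) B i k) (\row_k h k).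
have XY p l0 B : local_inverse N c h d A p l0 B -> X l0 *m Y B = 1%:M.
  move=> [_ hBA _]; apply/matrixP => l k; rewrite mul_row_col !mxE big_ord1 !mxE.
  under eq_bigr do rewrite !mxE mulrC; rewrite hBA //.
  by rewrite -val_eqE /=; ring.
have YX p l0 B : local_inverse N c h d A p l0 B -> (l0 < N)%N -> h l0 != 0 ->
    Y B *m X l0 = 1%:M.
  move=> hB hl0 hne; have [_ hBA hAB] := hB.
  rewrite mul_col_row scalar_mx_block; congr block_mx.
  - apply/matrixP => i j; rewrite !mxE; under eq_bigr do rewrite !mxE mulrC.
    by rewrite hAB.
  - apply/matrixP => i j; rewrite !mxE (bigD1 (Ordinal hl0)) //= !mxE.
    rewrite (local_inverse_l0 hB) // mul0r add0r big1 // => k hk.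
    by rewrite !mxE; move: hk; rewrite -val_eqE /= => /negPf ->; rewrite mul0r mulr0.
  - apply/matrixP => i j; rewrite !mxE; under eq_bigr do rewrite !mxE.
    by rewrite hker.
  - apply/matrixP => i j; rewrite !mxE (bigD1 (Ordinal hl0)) //= !mxE eqxx mul1r divff //.
    rewrite !ord1 eqxx big1 ?addr0 // => k hk.
    by rewrite !mxE; move: hk; rewrite -val_eqE /= => /negPf ->; rewrite mul0r mulr0.
have [l1 hl1 hu1] := hsurj _ (is_pt_infty K).
have hn1 := Ounit_neq0 hu1.
have [B1 hB1] := hinv _ _ (is_pt_infty K) hl1 hu1.
have eN : N = (r + 1)%N.
  apply/eqP; rewrite eqn_leq; apply/andP; split.
  - have := mxrankM_maxl (X l1) (Y B1); rewrite (XY _ _ _ hB1) mxrank1 => h1.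
    exact: leq_trans h1 (rank_leq_col _).
  - have := mxrankM_maxl (Y B1) (X l1); rewrite (YX _ _ _ hB1) // mxrank1 => h1.
    exact: leq_trans h1 (rank_leq_col _).
split=> //.
pose r1 (l : 'I_(r + 1)) := c l.
pose c1 (j : 'I_(r + 1)) : int := if split j is inl i then d i else deg.
have sc1 : \sum_j c1 j = \sum_i d i + deg.
  rewrite big_split_ord /= big_ord1; congr (_ + _); last first.
    by rewrite /c1 -[rshift _ _]/(unsplit (inr _)) unsplitK.
  by apply: eq_bigr => i _; rewrite /c1 -[lshift _ _]/(unsplit (inl _)) unsplitK.
have sr1 : \sum_(l < N) c l = \sum_l r1 l by rewrite eN.
pose S l0 : 'M[T]_(r + 1) := castmx (eN, erefl _) (X l0).
pose S' B : 'M[T]_(r + 1) := castmx (erefl _, eN) (Y B).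
have SE l0 l j : S l0 l j = X l0 (cast_ord (esym eN) l) j by rewrite castmxE cast_ord_id.
have S'E B i k : S' B i k = Y B i (cast_ord (esym eN) k) by rewrite castmxE cast_ord_id.
have SS p l0 B : local_inverse N c h d A p l0 B -> S l0 *m S' B = 1%:M.
  move=> hB; apply/matrixP => l k; rewrite mxE.
  transitivity ((X l0 *m Y B) (cast_ord (esym eN) l) (cast_ord (esym eN) k)).
    by rewrite mxE; apply: eq_bigr => j _; rewrite SE S'E.
  by rewrite (XY _ _ _ hB) !mxE -!val_eqE.
have detS l0 : (l0 < N)%N -> h l0 != 0 -> \det (S l0) = \det (S l1).
  move=> hl0 hne.
  pose M : 'M[T]_(r + 1) := block_mx 1%:M (\col_i (B1 i l0 / h l0)) 0 1%:M.
  have XM : X l0 = X l1 *m M.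
    rewrite mul_row_block mulmx1 mulmx0 addr0 mulmx1.
    congr row_mx; apply/matrixP => l' j'; rewrite !mxE.
    have [_ hBA _] := hB1; have := hBA l0 l' hl0 (ltn_ord l') => e1.
    under eq_bigr do rewrite !mxE mulrCA mulrA; rewrite -mulr_suml e1.
    by field; rewrite hne hn1.
  have -> : S l0 = S l1 *m M.
    apply/matrixP => l j; rewrite SE XM !mxE.
    by apply: eq_bigr => j' _; rewrite SE.
  by rewrite det_mulmx det_ublock !det1 !mulr1.
have unitS : \det (S l1) != 0.
  apply/eqP => e0; have := congr1 (fun Z => \det Z) (SS _ _ _ hB1).
  by rewrite det_mulmx det1 e0 mul0r => /eqP; rewrite eq_sym oner_eq0.
pose k := \sum_l r1 l - \sum_j c1 j.
have colE (j : 'I_(r + 1)) : (exists2 i, j = lshift 1 i & c1 j = d i) \/ (j = rshift r ord0 /\ c1 j = deg).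
  rewrite /c1; case: splitP => i e; [left; exists i => // | right; split=> //]; apply: val_inj => //=.
  by rewrite e ord1.
have regS p : is_pt p -> Oreg fr k p (\det (S l1)).
  move=> hp; have [l0 hl0 hu0] := hsurj p hp; rewrite -(detS l0 hl0 (Ounit_neq0 hu0)).
  apply: Oreg_det => // l j; rewrite SE.
  have [[i -> ->]|[-> ->]] := colE j.
  - by rewrite row_mxEl mxE; apply: hreg => //; rewrite eN.
  - rewrite row_mxEr mxE /r1 /=; case: eqP => [->|_]; last by rewrite mul0r; apply: Oreg0.
    by rewrite mul1r -opprB; apply: Ounit_inv.
have regS' p : is_pt p -> Oreg fr (- k) p (\det (S l1))^-1.
  move=> hp; have [l0 hl0 hu0] := hsurj p hp; rewrite -(detS l0 hl0 (Ounit_neq0 hu0)).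
  have [B hB] := hinv p l0 hp hl0 hu0.
  have -> : (\det (S l0))^-1 = \det (S' B).
    have := congr1 (fun Z => \det Z) (SS _ _ _ hB); rewrite det_mulmx det1 => e1.
    by apply: (mulfI (_ : \det (S l0) != 0)); rewrite ?e1 ?divff // detS // (Ounit_neq0 hu0).
  rewrite opprB; apply: Oreg_det => // j l; rewrite S'E.
  have [hBreg _ _] := hB.
  have [[i -> ->]|[-> ->]] := colE j.
  - by rewrite col_mxEu mxE; apply: hBreg; rewrite eN.
  - by rewrite col_mxEd mxE; apply: hrow => //; rewrite eN.
have k0 : k = 0.
  have [hk|hk|//] := ltgtP k 0.
    by have := global_Oreg_neg fr_inj regS hk => e0; rewrite e0 eqxx in unitS.
  have hk' : - k < 0 by rewrite oppr_lt0.
  have /eqP := global_Oreg_neg fr_inj regS' hk'; rewrite invr_eq0 => e0.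
  by rewrite e0 in unitS.
by move: k0; rewrite /k sc1 sr1 => /subr0_eq ->; rewrite addrC.
Qed.


Section TwoDegrees.
Variables (N r m : nat) (al be : int) (h : nat -> T) (deg : int).
Variables (d : 'I_r -> int) (A : 'I_r -> nat -> T).
Hypotheses (hmN : (m <= N)%N) (hba : be < al).
Let c (l : nat) : int := if (l < m)%N then al else be.
Hypothesis sd : split_data N c h deg d A.

Let big : {set 'I_r} := [set i | be < d i].
Hypothesis many : (m <= #|big|)%N.

Let c_lt l : (l < m)%N -> c l = al. Proof. by rewrite /c => ->. Qed.
Let c_ge l : (m <= l)%N -> c l = be. Proof. by rewrite /c ltnNge => ->. Qed.
Let ltmN (l : 'I_m) : (l < N)%N. Proof. exact: leq_trans (ltn_ord l) hmN. Qed.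

(** The entry is a map from O(d i) to the summand O(c l) of smaller degree. *)
Let A_zero i l : c l < d i -> (l < N)%N -> A i l = 0.
Proof.
move=> hlt hl; apply: (@global_Oreg_neg _ _ fr fr_inj (c l - d i)); last by rewrite subr_lt0.
by move=> p hp; apply: (sd_reg sd).
Qed.

Let A_tail i l : i \in big -> (m <= l < N)%N -> A i l = 0.
Proof. by rewrite inE => hi /andP[hml hlN]; apply: A_zero => //; rewrite c_ge. Qed.

Let sum_head (F : nat -> T) : (forall l, (m <= l < N)%N -> F l = 0) ->
  \sum_(l < N) F l = \sum_(l < m) F l.
Proof.
move=> hF; rewrite -(big_mkord xpredT F) (big_cat_nat (n := m)) //= big_mkord.
rewrite [X in _ + X]big_nat [X in _ + X]big1 ?addr0 // => l hl; exact: hF.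
Qed.

Let W : 'M[T]_(#|big|, m) := \matrix_(i, l) A (enum_val i) l.

Let W_inv p l0 B : local_inverse N c h d A p l0 B ->
  W *m (\matrix_(l < m, j < #|big|) B (enum_val j) l) = 1%:M.
Proof.
move=> [_ _ hAB]; apply/matrixP => i j; rewrite !mxE.
rewrite eq_sym -(inj_eq enum_val_inj) -hAB.
rewrite (@sum_head (fun l => A (enum_val i) l * B (enum_val j) l)) => [|l hl]; last first.
  by rewrite A_tail ?mul0r // enum_valP.
by apply: eq_bigr => l _; rewrite !mxE.
Qed.

(** The summands of degree greater than be map to the first m coordinates only;
    being independent and at least m in number, they span these coordinates over
    T, so the row, which kills them, vanishes there. *)
Lemma row_head_eq0 l : (l < m)%N -> h l = 0.
Proof.
move=> hl; apply/eqP/negPn/negP => hne.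
have hlN := leq_trans hl hmN.
have [p hp hu] := Ounit_generic (sd_row sd hlN (is_pt_infty K)) hne.
have [B hB] := sd_inv sd hp hlN hu.
have hW := W_inv hB.
have full : row_full W.
  rewrite /row_full eqn_leq rank_leq_col /=; apply: leq_trans many _.
  by have := mxrankM_maxl W (\matrix_(l < m, j < #|big|) B (enum_val j) l); rewrite hW mxrank1.
have /row_fullP[W' hW'] := full.
have h0 : W *m (\col_(l < m) h l) = 0.
  apply/matrixP => i j; rewrite !mxE -[RHS](sd_ker sd (enum_val i)).
    rewrite (@sum_head (fun l => h l * A (enum_val i) l)) => [|l' hl']; last first.
      by rewrite A_tail ?mulr0 // enum_valP.
    by apply: eq_bigr => l' _; rewrite !mxE mulrC.
have := congr1 (mulmx W') h0; rewrite mulmxA hW' mul1mx mulmx0.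
by move/matrixP/(_ (Ordinal hl) ord0); rewrite !mxE /= => e; rewrite e eqxx in hne.
Qed.

Hypothesis surj : row_surjective N c h deg.

(** As the row vanishes on the first m coordinates, the kernel contains
    O(al)^m, which maps to the summands of degree at least al only. *)
Lemma split_top_degrees : #|big| = m /\ forall i, i \in big -> d i = al.
Proof.
have pt0 := is_pt_infty K.
have [l0 hl0 hu0] := surj pt0; have [B hB] := sd_inv sd pt0 hl0 hu0.
have le_big : (#|big| <= m)%N.
  have := mxrankM_maxr W (\matrix_(l < m, j < #|big|) B (enum_val j) l).
  rewrite (W_inv hB) mxrank1 => h1; exact: leq_trans h1 (rank_leq_row _).
have card_big : #|big| = m by apply/eqP; rewrite eqn_leq le_big many.
have dualE p l B' : local_inverse N c h d A p l B' ->
    forall k l', (k < m)%N -> (l' < N)%N -> \sum_(i < r) B' i k * A i l' = (l' == k)%:R.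
  move=> [_ hBA _] k l' hk hl'.
  by rewrite hBA ?(leq_trans hk) // (row_head_eq0 hk) mul0r mul0r subr0.
have B_global i k p : (k < m)%N -> is_pt p -> Oreg fr (d i - al) p (B i k).
  move=> hk hp; have [l1 hl1 hu1] := surj hp; have [B' hB'] := sd_inv sd hp hl1 hu1.
  have -> : B i k = B' i k.
    transitivity (\sum_(l < N) (\sum_(j < r) B j k * A j l) * B' i l).
      have [_ _ hAB'] := hB'.
      under eq_bigr do rewrite mulr_suml; rewrite exchange_big /=.
      rewrite (bigD1 i) //= [X in _ + X]big1 ?addr0 => [|j hj].
        by under eq_bigr do rewrite -mulrA; rewrite -mulr_sumr hAB' eqxx mulr1.
      by under eq_bigr do rewrite -mulrA; rewrite -mulr_sumr hAB' eq_sym (negPf hj) mulr0.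
    have hkN := leq_trans hk hmN.
    rewrite (bigD1 (Ordinal hkN)) //= (dualE _ _ _ hB) // eqxx mul1r big1 ?addr0 // => l.
    rewrite -val_eqE /= => /negPf hl.
    by rewrite (dualE _ _ _ hB) // hl mul0r.
  have [hreg _ _] := hB'; have := hreg i k (leq_trans hk hmN).
  by rewrite c_lt.
pose top : {set 'I_r} := [set i | al <= d i].
have B_zero i k : (k < m)%N -> i \notin top -> B i k = 0.
  rewrite inE -ltNge => hk hi; apply: (@global_Oreg_neg _ _ fr fr_inj (d i - al)).
    by move=> p; apply: B_global.
  by rewrite subr_lt0.
have le_top : (m <= #|top|)%N.
  pose V : 'M[T]_(m, #|top|) := \matrix_(k, i) B (enum_val i) k.
  have hV : V *m (\matrix_(i < #|top|, l < m) A (enum_val i) l) = 1%:M.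
    apply/matrixP => k l; rewrite !mxE -val_eqE eq_sym -(dualE _ _ _ hB k l (ltn_ord k) (ltmN l)).
    rewrite [RHS](bigID (mem top)) /= [X in _ = _ + X]big1 ?addr0 => [|i hi]; last first.
      by rewrite B_zero ?mul0r.
    by rewrite [RHS]big_enum_val /=; apply: eq_bigr => i _; rewrite !mxE.
  have := mxrankM_maxl V (\matrix_(i < #|top|, l < m) A (enum_val i) l); rewrite hV mxrank1 => h1.
  exact: leq_trans h1 (rank_leq_col _).
have sub : top \subset big.
  by apply/subsetP => i; rewrite !inE; apply: lt_le_trans.
have eq_top : top = big.
  by apply/eqP; rewrite eqEcard sub card_big le_top.
split=> // i hi; apply/eqP; rewrite eq_le; apply/andP; split; last first.
  by move: hi; rewrite -eq_top inE.
rewrite leNgt; apply/negP => hlt.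
have [_ _ hAB] := hB; have := hAB i i; rewrite eqxx big1 => [/eqP|l _].
  by rewrite eq_sym oner_eq0.
have [hlm|hml] := ltnP l m; first by rewrite A_zero ?mul0r // c_lt.
by rewrite A_tail ?mul0r // hml ltn_ord.
Qed.

End TwoDegrees.
End SplitData.

(** * The matrix of an isomorphism with a split bundle *)

Section Extract.
Variables (K : closedFieldType) (T : fieldType) (fr : {rmorphism bform K -> T}).
Hypothesis fr_inj : injective fr.
Variables (N : nat) (c : nat -> int) (h : nat -> T) (deg : int) (d : seq int).
Local Notation r := (size d).
Local Notation ker := (ker_sheaf fr N c h).
Local Notation spl := (split_sheaf fr d).
Local Notation opn := (('I_2 -> K) -> Prop).
Hypothesis row_reg : forall l p, (l < N)%N -> is_pt p -> Oreg fr (deg - c l) p (h l).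

Variable psi : opn -> (nat -> T) -> ('I_r -> T).
Hypothesis psi_ker : forall U, zopen U -> forall v, ker U v -> spl U (psi U v).
Hypothesis psi_lin : forall U, zopen U -> forall g v w,
  (forall p, U p -> Oreg fr 0 p g) -> ker U v -> ker U w ->
  psi U (fun i => g * v i + w i) = (fun j => g * psi U v j + psi U w j).
Hypothesis psi_inj : forall U, zopen U -> forall v w, ker U v -> ker U w ->
  psi U v = psi U w -> v = w.
Hypothesis psi_surj : forall U, zopen U -> forall u, spl U u -> exists2 v, ker U v & psi U v = u.
Hypothesis psi_res : forall U V, zopen U -> zopen V -> (forall p, U p -> V p) ->
  forall v, ker V v -> psi U v = psi V v.

Lemma ker_sheaf0 U : zopen U -> ker U (fun=> 0).
Proof.
move=> hU; split=> [l hl p hp||] //; first by apply: Oreg0 => //; apply: zopen_pt hp.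
by rewrite big1 // => l _; rewrite mulr0.
Qed.

Lemma ker_sheaf_lin U g v w : (forall p, U p -> Oreg fr 0 p g) -> ker U v -> ker U w ->
  ker U (fun l => g * v l + w l).
Proof.
move=> hg [v1 v2 v3] [w1 w2 w3]; split=> [l hl p hp|l hl|].
- apply: OregD => //; last exact: w1.
  by rewrite -[c l]add0r; apply: OregM; [exact: hg | exact: v1].
- by rewrite v2 // w2 // mulr0 addr0.
- under eq_bigr do rewrite mulrDr mulrCA; rewrite big_split /= -mulr_sumr v3 w3.
  by rewrite mulr0 addr0.
Qed.

Lemma ker_sheaf_res (U V : opn) v : (forall p, U p -> V p) -> ker V v -> ker U v.
Proof. by move=> hUV [v1 v2 v3]; split=> // l hl p /hUV; apply: v1. Qed.

Let psi0 U : zopen U -> psi U (fun=> 0) = fun=> 0.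
Proof.
move=> hU; have h0 := ker_sheaf0 hU.
have := psi_lin hU (g := 1) (fun p _ => Oreg1 fr p) h0 h0.
have -> : (fun _ : nat => 1 * 0 + 0 : T) = fun=> 0.
  by apply: functional_extensionality => l; rewrite mulr0 addr0.
move=> e; apply: functional_extensionality => j.
have /(congr1 (fun f => f j)) /= := e; rewrite mul1r => /eqP.
by rewrite -subr_eq0 opprD addNKr oppr_eq0 => /eqP.
Qed.

Let psi_comb U (J : Type) (s : seq J) (g : J -> T) (v : J -> nat -> T) : zopen U ->
  (forall j p, U p -> Oreg fr 0 p (g j)) -> (forall j, ker U (v j)) ->
  ker U (fun l => \sum_(j <- s) g j * v j l) /\
  psi U (fun l => \sum_(j <- s) g j * v j l) = (fun i => \sum_(j <- s) g j * psi U (v j) i).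
Proof.
move=> hU hg hv; elim: s => [|j s [IH1 IH2]].
  have -> : (fun l : nat => \sum_(j <- [::]) g j * v j l) = fun=> 0.
    by apply: functional_extensionality => l; rewrite big_nil.
  split; first exact: ker_sheaf0.
  by rewrite psi0 //; apply: functional_extensionality => l; rewrite big_nil.
have -> : (fun l : nat => \sum_(i <- j :: s) g i * v i l)
    = (fun l => g j * v j l + \sum_(i <- s) g i * v i l).
  by apply: functional_extensionality => l; rewrite big_cons.
split; first by apply: ker_sheaf_lin => //; apply: hg.
rewrite psi_lin //; last exact: hg.
by rewrite IH2; apply: functional_extensionality => i; rewrite big_cons.
Qed.

Let psi_scale U g v : zopen U -> (forall p, U p -> Oreg fr 0 p g) -> ker U v ->
  ker U (fun l => g * v l) /\ psi U (fun l => g * v l) = (fun i => g * psi U v i).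
Proof.
move=> hU hg hv; have [h1 h2] := @psi_comb U unit [:: tt] (fun=> g) (fun=> v) hU (fun=> hg) (fun=> hv).
have e : (fun l => \sum_(j <- [:: tt]) g * v l) = (fun l => g * v l).
  by apply: functional_extensionality => l; rewrite big_seq1.
rewrite -e; split=> //; rewrite h2.
by apply: functional_extensionality => i; rewrite big_seq1.
Qed.

Let is_var (w : bform K) : Prop := w = 'X_ord0 \/ w = 'X_ord_max.

Let var_homog w : is_var w -> w \is 1.-homog.
Proof. by case=> ->; apply: dhomog_var. Qed.

Let var_neq0 w : is_var w -> fr w != 0.
Proof. by case=> ->; apply: fr_neq0 => //; apply: mpolyX1_neq0. Qed.

Let var_pt p : is_pt p -> exists2 w, is_var w & w.@[p] != 0.
Proof.
by move=> /is_ptP[] hp; [exists 'X_ord0 | exists 'X_ord_max]; rewrite ?mevalXU //; [left|right].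
Qed.

Let Oreg_var w k p : is_var w -> w.@[p] != 0 -> Oreg fr k p (fr w ^ k).
Proof. by move=> hw hp; rewrite -[k in Oreg _ k]mul1r; apply: Oreg_exprz (var_homog hw) hp. Qed.

Let unit_vec (i : 'I_r) : 'I_r -> T := fun j => (j == i)%:R.

Let unit_sec w (i : 'I_r) : is_var w ->
  spl (nonvanishing w) (fun j => fr w ^ d`_i * unit_vec i j).
Proof.
move=> hw j p [hp hwp]; rewrite /unit_vec; case: eqVneq => [->|_].
  by rewrite mulr1; apply: Oreg_var.
by rewrite mulr0; apply: Oreg0.
Qed.

Let one_pt : 'I_2 -> K := fun=> 1.
Let one_is_pt : is_pt one_pt.
Proof. by exists ord0; apply: oner_neq0. Qed.

Let var_one w : is_var w -> w.@[one_pt] != 0.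
Proof. by case=> ->; rewrite mevalXU oner_neq0. Qed.

Let zopen_var w : is_var w -> zopen (nonvanishing w).
Proof. by move=> hw; exact: zopen_nonvanishing (var_homog hw) one_is_pt (var_one hw). Qed.

(** The preimages of s^(d i) e_i over s != 0 and of t^(d i) e_i over t != 0 are
    proportional on the overlap; divided by s^(d i), resp. t^(d i), they are
    therefore one and the same vector, of forms of degree c l - d i. *)
Lemma iso_columns : exists A : 'I_r -> nat -> T,
  forall w (i : 'I_r), is_var w -> ker (nonvanishing w) (fun l => fr w ^ d`_i * A i l) /\
    psi (nonvanishing w) (fun l => fr w ^ d`_i * A i l) = (fun j => fr w ^ d`_i * unit_vec i j).
Proof.
pose s : bform K := 'X_ord0; pose t : bform K := 'X_ord_max.
have vs : is_var s by left.
have vt : is_var t by right.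
have ex w (i : 'I_r) : is_var w -> exists v, ker (nonvanishing w) v /\
    psi (nonvanishing w) v = (fun j => fr w ^ d`_i * unit_vec i j).
  by move=> hw; have [v hv hv'] := psi_surj (zopen_var hw) (unit_sec i hw); exists v.
have [vS hS] := fin_all_exists (fun i => ex s i vs).
have [vT hT] := fin_all_exists (fun i => ex t i vt).
exists (fun (i : 'I_r) l => fr s ^ (- d`_i) * vS i l).
have hs0 := var_neq0 vs; have ht0 := var_neq0 vt.
have eS (i : 'I_r) : (fun l => fr s ^ d`_i * (fr s ^ (- d`_i) * vS i l)) = vS i.
  apply: functional_extensionality => l.
  by rewrite mulrA -expfzDr // subrr expr0z mul1r.
have eT (i : 'I_r) : (fun l => fr t ^ d`_i * (fr s ^ (- d`_i) * vS i l)) = vT i.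
  pose U := nonvanishing (s * t).
  have hst : s * t \is 2.-homog by apply: (@dhomogM _ _ _ 1 _ 1); apply: var_homog.
  have hU : zopen U.
    by apply: (zopen_nonvanishing hst one_is_pt); rewrite mevalM mulf_neq0 // var_one.
  have Us p : U p -> nonvanishing s p.
    by move=> [hp]; rewrite mevalM mulf_eq0 negb_or => /andP[].
  have Ut p : U p -> nonvanishing t p.
    by move=> [hp]; rewrite mevalM mulf_eq0 negb_or => /andP[].
  have [kS pS] := hS i; have [kT pT] := hT i.
  pose g := fr t ^ d`_i * fr s ^ (- d`_i).
  have hg p : U p -> Oreg fr 0 p g.
    move=> hp; rewrite -(subrr d`_i); apply: OregM; apply: Oreg_var => //.
      by case: (Ut _ hp).
    by case: (Us _ hp).
  have [k1 p1] := psi_scale hU hg (ker_sheaf_res Us kS).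
  transitivity (fun l => g * vS i l).
    by apply: functional_extensionality => l; rewrite mulrA.
  apply: (psi_inj hU k1 (ker_sheaf_res Ut kT)).
  rewrite p1 (psi_res hU (zopen_var vs) Us kS) (psi_res hU (zopen_var vt) Ut kT) pS pT.
  apply: functional_extensionality => j; rewrite mulrA; congr (_ * _).
  by rewrite /g -mulrA -expfzDr // addNr expr0z mulr1.
by move=> w i [] ->; rewrite -/s -/t ?eS ?eT.
Qed.

(** A local section is recovered from its image z under the isomorphism as the sum
    of the z_i A_i, by linearity and injectivity on a neighbourhood. The matrix B
    consists of the images of the projections of the basis vectors. *)
Theorem iso_split_data : exists A, split_data fr N c h deg (fun i : 'I_r => d`_i) A.
Proof.
have [A hA] := iso_columns.
have regA (i : 'I_r) l p : (l < N)%N -> is_pt p -> Oreg fr (c l - d`_i) p (A i l).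
  move=> hl hp; have [w hw hwp] := var_pt hp; have [[k1 _ _] _] := hA w i hw.
  have hw0 := var_neq0 hw.
  have -> : A i l = (fr w ^ d`_i * A i l) * fr w ^ (- d`_i).
    by rewrite mulrAC -expfzDr // subrr expr0z mul1r.
  by apply: OregM; [apply: k1 | apply: Oreg_var].
have tailA (i : 'I_r) l : (N <= l)%N -> A i l = 0.
  move=> hl; have hw : is_var 'X_ord0 by left.
  have [[_ /(_ l hl) /eqP + _] _] := hA _ i hw.
  by rewrite mulf_eq0 expfz_eq0 (negPf (var_neq0 hw)) andbF => /eqP.
have kerA (i : 'I_r) : \sum_(l < N) h l * A i l = 0.
  have hw : is_var 'X_ord0 by left.
  have [[_ _ k3] _] := hA _ i hw; apply/eqP; move/eqP: k3.
  rewrite (eq_bigr (fun l : 'I_N => fr 'X_ord0 ^ d`_i * (h l * A i l))) => [|l _]; last first.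
    exact: mulrCA.
  by rewrite -mulr_sumr mulf_eq0 expfz_eq0 (negPf (var_neq0 hw)) andbF.
exists A; split=> // p l0 hp hl0 hu0.
have hne : h l0 != 0 by have := Ounit_neq0 fr_inj hu0.
have [a [b [da [db [ha hb e [hap hbp] eh]]]]] := hu0.
have [w hw hwp] := var_pt hp; have hw0 := var_neq0 hw.
pose U := nonvanishing (w * (a * b)).
have hwab : w * (a * b) \is (1 + (da + db))%N.-homog by apply/dhomogM/dhomogM; rewrite ?var_homog.
have Up : U p by split=> //; rewrite !mevalM !mulf_neq0.
have hU : zopen U := zopen_nonvanishing hwab hp (proj2 Up).
have Uw q : U q -> nonvanishing w q.
  by move=> [hq]; rewrite mevalM mulf_eq0 negb_or => /andP[].
have Uu q : U q -> Ounit fr (deg - c l0) q (h l0).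
  move=> [hq]; rewrite !mevalM !mulf_eq0 !negb_or => /and3P[_ h1 h2].
  by exists a, b, da, db.
have Oz k q : U q -> Oreg fr k q (fr w ^ k) by move=> /Uw[_]; apply: Oreg_var.
(* u k is the projection of e_k to the kernel along e_{l0}. *)
pose u k l := fr w ^ c k * ((l == k)%:R - h k / h l0 * (l == l0)%:R).
have ker_u k : (k < N)%N -> ker U (u k).
  move=> hk; split=> [l hl q hq|l hl|].
  - have hq1 := zopen_pt hU hq; rewrite /u mulrBr; apply: (OregB fr_inj).
      case: eqVneq => [->|_]; first by rewrite mulr1; apply: Oz.
      by rewrite mulr0; apply: Oreg0.
    case: eqVneq => [->|_]; last by rewrite !mulr0; apply: Oreg0.
    rewrite mulr1 (_ : c l0 = c k + ((deg - c k) + - (deg - c l0))); last by lia.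
    by apply: OregM; [exact: Oz | apply: OregM; [exact: row_reg | apply/Ounit_inv/Uu]].
  - by rewrite /u !gtn_eqF ?mulr0 ?subrr ?mulr0 //; apply: leq_trans hl.
  - rewrite /u; under eq_bigr do rewrite mulrCA mulrBr; rewrite -mulr_sumr sumrB.
    rewrite (bigD1 (Ordinal hk)) //= eqxx mulr1 big1 ?addr0 => [|l]; last first.
      by rewrite -val_eqE /= => /negPf ->; rewrite mulr0.
    rewrite (bigD1 (Ordinal hl0)) //= eqxx mulr1 big1 ?addr0 => [|l]; last first.
      by rewrite -val_eqE /= => /negPf ->; rewrite !mulr0.
    by rewrite [h l0 * _]mulrC divfK // subrr mulr0.
have kerUA (i : 'I_r) : ker U (fun l => fr w ^ d`_i * A i l).
  by have [k1 _] := hA w i hw; apply: ker_sheaf_res k1.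
have psiUA (i : 'I_r) : psi U (fun l => fr w ^ d`_i * A i l) = (fun j => fr w ^ d`_i * unit_vec i j).
  by have [k1 <-] := hA w i hw; apply: psi_res => //; apply: zopen_var.
have expand v : ker U v -> v = (fun l => \sum_i psi U v i * A i l).
  move=> hv; have hz := psi_ker hU hv.
  pose g (i : 'I_r) := psi U v i * fr w ^ (- d`_i).
  have hg (i : 'I_r) q : U q -> Oreg fr 0 q (g i).
    by move=> hq; rewrite -(subrr d`_i); apply: OregM; [apply: hz | apply: Oz].
  have [k1 p1] := @psi_comb U _ (index_enum _) g (fun (i : 'I_r) l => fr w ^ d`_i * A i l) hU hg kerUA.
  have e1 : (fun l => \sum_i g i * (fr w ^ d`_i * A i l)) = (fun l => \sum_i psi U v i * A i l).
    apply: functional_extensionality => l; apply: eq_bigr => i _.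
    by rewrite /g mulrA; congr (_ * _); rewrite -mulrA -expfzDr // addNr expr0z mulr1.
  rewrite -e1; apply: (psi_inj hU hv k1); rewrite p1; apply: functional_extensionality => j.
  rewrite (bigD1 j) //= psiUA /unit_vec eqxx mulr1 big1 ?addr0 => [|i]; last first.
    by rewrite eq_sym psiUA /unit_vec => /negPf ->; rewrite !mulr0.
  by rewrite /g -mulrA -expfzDr // addNr expr0z mulr1.
exists (fun (i : 'I_r) k => psi U (u k) i * fr w ^ (- c k)); split.
- by move=> i k hk; apply: OregM; [apply: psi_ker => //; apply: ker_u | apply: Oz].
- move=> k l hk hl; have /(congr1 (fun f => f l)) /= := expand _ (ker_u k hk).
  rewrite {1}/u => e1; under eq_bigr do rewrite mulrAC; rewrite -mulr_suml -e1.
  by rewrite mulrAC -expfzDr // subrr expr0z mul1r.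
- move=> i j.
  pose u' (k : 'I_N) := u k.
  pose g (k : 'I_N) := fr w ^ d`_i * A i k * fr w ^ (- c k).
  have hg k q : U q -> Oreg fr 0 q (g k).
    move=> hq; rewrite (_ : 0 = d`_i + (c k - d`_i) + (- c k)); last by lia.
    apply: OregM; last exact: Oz.
    by apply: OregM; [exact: Oz | apply: regA => //; apply: zopen_pt hq].
  have [k1 p1] := @psi_comb U _ (index_enum _) g u' hU hg (fun k => ker_u k (ltn_ord k)).
  have e1 : (fun l => \sum_k g k * u' k l) = (fun l => fr w ^ d`_i * A i l).
    apply: functional_extensionality => l; have [hl|hl] := ltnP l N; last first.
      rewrite tailA // mulr0 big1 // => k _; rewrite /u' /u.
      rewrite !gtn_eqF ?mulr0 ?subrr ?mulr0 //; first exact: leq_trans hl.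
      exact: leq_trans hl.
    transitivity (\sum_(k < N) fr w ^ d`_i * (A i k * (l == k)%:R - (l == l0)%:R / h l0 * (h k * A i k))).
      apply: eq_bigr => k _; rewrite /g /u' /u mulrA -[_ * fr w ^ c k]mulrA -expfzDr //.
      by rewrite addNr expr0z mulr1; ring.
    rewrite -mulr_sumr sumrB -mulr_sumr kerA mulr0 subr0; congr (_ * _).
    rewrite (bigD1 (Ordinal hl)) //= eqxx mulr1 big1 ?addr0 // => k.
    by rewrite -val_eqE /= eq_sym => /negPf ->; rewrite mulr0.
  have := p1; rewrite e1 psiUA => /(congr1 (fun f => f j)) /= e2.
  have hwd : fr w ^ d`_i != 0 by rewrite expfz_neq0.
  apply: (mulfI hwd); rewrite -/(unit_vec i j) e2 mulr_sumr; apply: eq_bigr => k _.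
  by rewrite /g; ring.
Qed.

End Extract.

(** * Quadrics whose normal bundle has many summands of large degree *)

(** Taylor expansion of a quadratic form. *)
Lemma meval_quadratic (R : comNzRingType) n (F : {mpoly R[n]}) (p q : 'I_n -> R) (c : R) :
  F \is 2.-homog ->
  F.@[fun i => p i + c * q i] =
    F.@[p] + c ^+ 2 * F.@[q] + c * \sum_i (F^`M(i)).@[q] * p i.
Proof.
move=> /dhomogP hF; rewrite [F in LHS]mpolyE [F in F.@[p]]mpolyE [F in F.@[q]]mpolyE.
have -> : \sum_i (F^`M(i)).@[q] * p i
    = \sum_(m <- msupp F) F@_m * \sum_i ('X_[m]^`M(i)).@[q] * p i.
  under [RHS]eq_bigr do rewrite mulr_sumr.
  rewrite [RHS]exchange_big /=; apply: eq_bigr => i _.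
  rewrite {1}(mpolyE F) (big_morph (mderiv i) (mderivD i) (mderiv0 _ _)).
  rewrite (big_morph (meval q) (mevalD q) (meval0 q)) mulr_suml.
  by apply: eq_bigr => m _; rewrite mderivZ mevalZ mulrA.
rewrite !raddf_sum /= !mulr_sumr -!big_split; apply: eq_big_seq => m /hF hm /=.
rewrite !mevalZ [c ^+ 2 * _]mulrCA [c * (_ * _)]mulrCA -!mulrDr; congr (_ * _).
have [i hi] : exists i, m i != 0%N.
  apply/existsP; apply: contraT; rewrite negb_exists => /forallP h0.
  by move: hm; rewrite /= mdegE big1 // => i _; apply/eqP/negPn.
have eU : (m = (m - U_(i)) + U_(i))%MM.
  by rewrite submK //; apply/mnm_lepP => j; rewrite mnm1E; case: eqP => [<-|//]; rewrite lt0n.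
have /mdeg1P[j /eqP ej] : mdeg (m - U_(i))%MM == 1%N.
  by move: hm; rewrite /= {1}eU mdegD mdeg1 addn1 => -[->].
rewrite eU ej mpolyXD !mevalM !mevalXU {eU ej hm hi m}.
have dv k l (v : 'I_n -> R) : ('X_k^`M(l)).@[v] = (k == l)%:R.
  rewrite mderivX mnm1E mevalZ; case: eqP => [->|_]; rewrite ?mul0r //.
  by rewrite -[X in (X - _)%MM]add0m addmK mpolyX0 meval1 mulr1.
have -> : \sum_l (('X_j * 'X_i)^`M(l)).@[q] * p l = q i * p j + q j * p i.
  transitivity (\sum_l ((j == l)%:R * (q i * p l) + (i == l)%:R * (q j * p l))).
    by apply: eq_bigr => l _; rewrite mderivM mevalD !mevalM !dv !mevalXU; ring.
  rewrite big_split /= (bigD1 j) //= (bigD1 (F := fun l => (i == l)%:R * _) i) //= !eqxx !mul1r.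
  rewrite !big1 ?addr0 // => l; rewrite eq_sym => /negPf ->; exact: mul0r.
ring.
Qed.

Lemma meval_dhomog_scale (R : comNzRingType) n (G : {mpoly R[n]}) m (p : 'I_n -> R) c :
  G \is m.-homog -> G.@[fun i => c * p i] = c ^+ m * G.@[p].
Proof.
move=> /dhomogP hG; rewrite !mevalE mulr_sumr; apply: eq_big_seq => j /hG /= hj.
rewrite mulrCA; congr (_ * _); under eq_bigr do rewrite exprMn.
by rewrite big_split /= prodrXr -mdegE hj.
Qed.

Lemma card_count (P : pred int) (s : seq int) : #|[set i : 'I_(size s) | P s`_i]| = count P s.
Proof.
by rewrite -sum1_count (big_nth 0) big_mkord -sum1_card; apply: eq_bigl => i; rewrite inE.
Qed.

Section ManyLargeSummands.
Variables (K : closedFieldType) (T : fieldType) (fr : {rmorphism bform K -> T}).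
Hypothesis fr_inj : injective fr.
Variables (e n : nat).
Hypotheses (he : (2 <= e)%N) (hen : (e <= n)%N).
Local Notation x := (xvar K n).
Local Notation ideal := (curve_ideal K e n).
Local Notation D := (dird (pullT fr e n)).
Variables (F : {mpoly K[n.+1]}) (d : seq int).
Hypotheses (F_homog : F \is 2.-homog) (F_ideal : in_curve_ideal e F).
Hypothesis F_smooth : smooth_along_curve e F.
Hypothesis F_iso : sheaf_iso fr (normal_sheaf fr e F) (split_sheaf fr d).
Hypothesis F_many : (e - 1 <= count (fun k : int => (e%:Z < k)%R) d)%N.

Let N := n.-1.
Let unit_seq (l k : nat) : T := (k == l)%:R.
Let h l : T := D (lift fr e (unit_seq l)) F.
Let deg : int := (e * 2)%N%:Z.

Let dird_ext v w G : (forall i, (i <= n)%N -> v i = w i) -> D v G = D w G.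
Proof. by move=> hvw; apply: eq_bigr => i _; rewrite hvw // -ltnS. Qed.

Let lift_ext u v i : (forall l, (l < N)%N -> u l = v l) -> (i <= n)%N ->
  lift fr e u i = lift fr e v i.
Proof.
move=> huv hi; rewrite /lift; case: ifP => hie; last by apply: huv; rewrite /N; lia.
congr (- _); apply: eq_bigr => k _; rewrite huv //.
by have := ltn_ord k; rewrite /N; lia.
Qed.

Let row_dird u : D (lift fr e u) F = \sum_(l < N) h l * u l.
Proof.
have comb (s : seq nat) (a : nat -> T) :
    D (lift fr e (fun k => \sum_(l <- s) a l * unit_seq l k)) F = \sum_(l <- s) h l * a l.
  elim: s => [|l s IHs].
    rewrite big_nil; apply: big1 => i _; rewrite /lift; case: ifP => _; last first.
      by rewrite big_nil mulr0.
    by rewrite big1 ?oppr0 ?mulr0 // => k _; rewrite big_nil mulr0.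
  have -> : (fun k => \sum_(j <- l :: s) a j * unit_seq j k)
      = (fun k => a l * unit_seq l k + \sum_(j <- s) a j * unit_seq j k).
    by apply: functional_extensionality => k; rewrite big_cons.
  by rewrite lift_lin dird_lin IHs big_cons mulrC.
rewrite -(big_mkord xpredT (fun l => h l * u l)) /index_iota subn0 -comb.
apply: dird_ext => i hi; apply: lift_ext => // l hl.
rewrite (bigD1_seq l) ?iota_uniq ?mem_iota //= /unit_seq eqxx mulr1 big1 ?addr0 // => k.
by rewrite eq_sym => /negPf ->; rewrite mulr0.
Qed.

Let row_reg l p : (l < N)%N -> is_pt p -> Oreg fr (deg - kdeg e l) p (h l).
Proof.
move=> hl hp.
have [w hw0 hw] : exists2 w : T, w != 0 & forall k, Oreg fr k p (w ^ k).
  have [hp0|hp0] := is_ptP hp; [exists (sv fr) | exists (tv fr)].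
  - exact: sv_neq0. - by move=> k; apply: Oreg_svz. - exact: tv_neq0.
  - by move=> k; apply: Oreg_tvz.
have -> : h l = D (lift fr e (fun k => w ^ kdeg e l * unit_seq l k)) F * w ^ (- kdeg e l).
  rewrite row_dird (bigD1 (Ordinal hl)) //= /unit_seq eqxx mulr1 big1 ?addr0.
    by rewrite -mulrA -expfzDr // subrr expr0z mulr1.
  by move=> k; rewrite -val_eqE /= => /negPf ->; rewrite !mulr0.
apply: OregM => //; rewrite -[F]/(sval (exist _ F F_ideal : ideal)).
apply: (Oreg_lift fr_inj he hen) => // k hk.
rewrite /unit_seq; case: eqP => [->|_]; first by rewrite mulr1.
by rewrite mulr0; apply: Oreg0.
Qed.

Let iso : sheaf_iso fr (ker_sheaf fr N (kdeg e) h) (split_sheaf fr d).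
Proof.
apply: sheaf_iso_trans F_iso; apply/gen_iso_iso/gen_iso_sym.
exact: (normal_sheaf_ker fr_inj he hen F_ideal row_dird).
Qed.

Let data : exists A, split_data fr N (kdeg e) h deg (fun i : 'I_(size d) => d`_i) A.
Proof.
have [psi [h1 h2]] := iso.
apply: (@iso_split_data _ _ fr fr_inj N (kdeg e) h deg d row_reg psi) => //.
- by move=> U /h1[].
- by move=> U /h1[].
- by move=> U /h1[].
- by move=> U /h1[].
Qed.

Let many : (e.-1 <= #|[set i : 'I_(size d) | (e%:Z < d`_i)%R]|)%N.
Proof. by rewrite (card_count (fun k => (e%:Z < k)%R)) -subn1. Qed.

Let le_eN : (e.-1 <= N)%N. Proof. by rewrite /N; lia. Qed.
Let lt_deg : (e%:Z < e.+2%:Z)%R. Proof. by rewrite ltz_nat. Qed.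

Let row_head l : (l < e.-1)%N -> h l = 0.
Proof.
have [A sd] := data.
exact: (@row_head_eq0 _ _ fr fr_inj N (size d) e.-1 e.+2%:Z e%:Z h deg _ A le_eN sd many).
Qed.

(** The derivation in the direction of x_i, i <= e, has normal coordinates in the
    summands of degree e + 2 only, and there the row of F vanishes. *)
Let deriv_span (i : 'I_n.+1) : (i <= e)%N -> pullT fr e n F^`M(i) = 0.
Proof.
move=> hi; pose v (k : nat) : T := (k == i)%:R.
have -> : pullT fr e n F^`M(i) = D v F.
  rewrite /dird (bigD1 i) //= /v eqxx mulr1 big1 ?addr0 // => k.
  by rewrite -val_eqE /= => /negPf ->; rewrite mulr0.
pose phi (G : ideal) := D v (sval G).
have hom : ideal_hom fr phi := dird_ideal_hom fr v.
have := lift_coords fr_inj he hen hom (exist _ F F_ideal); rewrite /phi /= => <-.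
rewrite row_dird big1 // => -[l hlN] _ /=; have [hl|hl] := ltnP l e.-1; first by rewrite row_head // mul0r.
rewrite /N in hlN; have -> : l = (l.+2 - 2)%N by rewrite subn2.
rewrite coords_x //; last by lia.
rewrite ev_dird; last by apply: in_ideal_x; lia.
rewrite dird_xvar; last by lia.
by rewrite /v gtn_eqF ?mulr0 //; lia.
Qed.

Let deriv_span_curve q (i : 'I_n.+1) : on_curve e q -> (i <= e)%N -> (F^`M(i)).@[q] = 0.
Proof.
move=> [st [c [hst hc hq]]] hi.
rewrite (meval_eq _ (v2 := fun k => c * rnc_coord e (st ord0) (st ord_max) k)) //.
rewrite (@meval_dhomog_scale _ _ _ 1) ?dhomog_mderiv // -meval_pullback.
have := deriv_span hi; rewrite pullTE -(rmorph0 fr) => /fr_inj ->.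
by rewrite meval0 mulr0.
Qed.

Let span_tail (p : 'I_n.+1 -> K) (i : 'I_n.+1) : on_curve e p -> (e < i)%N -> p i = 0.
Proof. by move=> [st [c [_ _ ->]]] hi; rewrite /rnc_coord leqNgt hi mulr0. Qed.

(** By the Taylor expansion, F vanishes at a linear combination of points of the
    curve, since at these points F and its derivatives along the span vanish. *)
Lemma contains_span : contains_curve_span e F.
Proof.
move=> p [m [c [q [hq hp]]]]; rewrite (meval_eq _ hp) => {p hp}.
elim: m c q hq => [|m IHm] c q hq.
  have -> : F.@[fun i => \sum_(k < 0) c k * q k i] = F.@[fun i => 0 * 0].
    by apply: meval_eq => i; rewrite big_ord0 mulr0.
  by rewrite (meval_dhomog_scale _ _ F_homog) expr0n mul0r.
pose c' k := c (widen_ord (leqnSn m) k); pose q' k := q (widen_ord (leqnSn m) k).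
have hq' k : on_curve e (q' k) by apply: hq.
rewrite (meval_eq _ (v2 := fun i => \sum_(k < m) c' k * q' k i + c ord_max * q ord_max i)); last first.
  by move=> i; rewrite big_ord_recr.
rewrite meval_quadratic // IHm // F_ideal; last exact: hq.
rewrite mulr0 !add0r big1 ?mulr0 // => i _; have [hi|hi] := leqP i e.
  by rewrite deriv_span_curve ?mul0r //; apply: hq.
by rewrite big1 ?mulr0 // => k _; rewrite (span_tail (hq' k)) ?mulr0.
Qed.

(** At a point of the curve only the derivatives in the directions outside the
    span can be nonzero, and by smoothness one of them is. *)
Let surj : row_surjective fr N (kdeg e) h deg.
Proof.
move=> p hp; pose q : 'I_n.+1 -> K := fun i => rnc_coord e (p ord0) (p ord_max) i.
have hq : on_curve e q := on_curve_rnc e n hp.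
have [j hj] : exists j, (F^`M(j)).@[q] != 0.
  apply/existsP; apply: contraT; rewrite negb_exists => /forallP h0.
  by case: (F_smooth hq); split=> [|i]; [apply: F_ideal | apply/eqP/negPn].
have hje : (e < j)%N.
  by rewrite ltnNge; apply: contra hj => hje; rewrite deriv_span_curve.
have hjn := ltn_ord j; exists (j - 2)%N; first by rewrite /N; lia.
exists (rnc_pullback e F^`M(j)), 1, (e * 1)%N, 0%N; split.
- by apply: dhomog_pullback; apply: dhomog_mderiv.
- exact: dhomog1.
- by rewrite /deg /kdeg ifF; lia.
- by rewrite meval1 oner_eq0 meval_pullback.
rewrite rmorph1 divr1 -pullTE /h /dird (bigD1 j) // big1 => [|i /andP[_ hij]].
  apply: etrans (addr0 _) _; rewrite /lift ifF; last by rewrite leqNgt hje.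
  by rewrite /unit_seq eqxx mulr1.
have [hie|hie] := leqP i e; first by rewrite deriv_span ?mul0r.
rewrite /lift leqNgt hie /= /unit_seq (_ : (i - 2 == j - 2)%N = false) ?mulr0 //.
by apply/eqP => e1; case/eqP: hij; apply: val_inj => /=; lia.
Qed.

(** The degrees greater than e are e - 1 times e + 2; the number and the sum of the
    remaining ones follow from the rank and the degree of the kernel. *)
Lemma many_large_degrees : (e < n - 1)%N /\
  exists2 b : nat -> nat, (\sum_(e.+2 <= j < n.+1) b j = e)%N & perm_eq d (E'_degrees e n b).
Proof.
have [A sd] := data.
have [eN sumN] := split_degree fr_inj sd surj.
have [card_big top] := split_top_degrees fr_inj le_eN lt_deg sd many surj.
pose P (k : int) := (e%:Z < k)%R.
have cnt : count P d = e.-1 by rewrite -(card_count P).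
have filt : [seq k <- d | P k] = nseq e.-1 e.+2%:Z.
  rewrite -cnt -size_filter; apply/all_pred1P/allP => k; rewrite mem_filter => /andP[hk].
  move=> /(nthP 0)[i hi ek]; apply/eqP; rewrite -ek -[i]/(val (Ordinal hi)).
  by apply: (top (Ordinal hi)); rewrite inE /= ek.
pose rest := [seq k <- d | predC P k].
have permd : perm_eq d (nseq e.-1 e.+2%:Z ++ rest).
  by rewrite -filt perm_sym perm_filterC.
have size_rest : size d = (e.-1 + size rest)%N.
  by rewrite (perm_size permd) size_cat size_nseq.
have rest_le k : k \in rest -> k <= e%:Z.
  by rewrite mem_filter /= /P -leNgt => /andP[].
have szr : size rest = (n.+1 - e.+2)%N /\ (e < n)%N.
  by move: eN size_rest; rewrite /N; move: (size d) (size rest) => u w; lia.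
pose gap (j : nat) : int := e%:Z - nth 0 rest (j - e.+2)%N.
pose b (j : nat) : nat := absz (gap j).
have bE : rest = [seq e%:Z - (b j)%:Z | j <- index_iota e.+2 n.+1].
  apply: (@eq_from_nth _ 0) => [|i hi].
    by rewrite size_map size_iota; case: szr.
  have hi' : (i < n.+1 - e.+2)%N by case: szr => <-.
  rewrite (nth_map 0%N) ?size_iota // nth_iota // /b /gap addKn.
  by rewrite gez0_abs ?subr_ge0 ?subKr //; apply/rest_le/mem_nth.
have sumb : (\sum_(e.+2 <= j < n.+1) b j = e)%N.
  have sd' : \sum_(i < size d) d`_i = (e.-1 * e.+2)%N%:Z + \sum_(k <- rest) k.
    have -> : \sum_(i < size d) d`_i = \sum_(k <- d) k by rewrite [RHS](big_nth 0) big_mkord.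
    rewrite (perm_big _ permd) big_cat big_nseq iter_addr_0 /=; congr (_ + _).
    by rewrite -mulr_natl natz PoszM.
  have sr : \sum_(k <- rest) k = (e * (n - 1 - e))%N%:Z - (\sum_(e.+2 <= j < n.+1) b j)%N%:Z.
    rewrite bE big_map sumrB (big_morph Posz PoszD (erefl _)) sumr_const_nat.
    by rewrite -mulr_natl natz mulrC -PoszM; congr (Posz (_ * _) - _); lia.
  have sc : \sum_(l < N) kdeg e l = (e.-1 * e.+2 + (n - e) * e)%N%:Z.
    rewrite -(big_mkord xpredT (kdeg e)) (big_cat_nat (n := e.-1)) //= PoszD.
    rewrite (@eq_big_nat _ _ _ 0 e.-1 _ (fun=> e.+2%:Z)) => [|l hl]; last by rewrite /kdeg ifT //; lia.
    rewrite (@eq_big_nat _ _ _ e.-1 N _ (fun=> e%:Z)) => [|l hl]; last by rewrite /kdeg ifF //; lia.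
    rewrite !sumr_const_nat subn0 (_ : N - e.-1 = n - e)%N; last by rewrite /N; lia.
    by rewrite -[_ *+ e.-1]mulr_natl -[_ *+ (n - e)]mulr_natl !natz -!PoszM.
  have hn : (n - e = (n - 1 - e).+1)%N by case: szr; lia.
  by move: sumN; rewrite sc sd' sr /deg hn mulSn [((n - 1 - e) * e)%N]mulnC; lia.
split; last by exists b; rewrite // /E'_degrees -bE.
rewrite ltnNge; apply/negP => hle; move: sumb; rewrite big_geq; lia.
Qed.

End ManyLargeSummands.

(** * Arranging the degrees *)

Section Numerology.
Variables (e n : nat).
Hypotheses (he : (2 <= e)%N) (hen : (e <= n)%N).

Lemma sum_tail_leq (b : nat -> nat) i j m : (i <= j)%N ->
  (\sum_(j.+1 <= k < m) b k <= \sum_(i.+1 <= k < m) b k)%N.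
Proof.
move=> hij; have [hj|hj] := leqP j.+1 m; last by rewrite big_geq // ltnW.
by rewrite [X in (_ <= X)%N](big_cat_nat (n := j.+1)) ?leq_addl.
Qed.

Section Gamma.
Variable b : nat -> nat.
Local Notation ga := (gamma e n b).

Lemma gamma_le j : (ga j <= e)%N.
Proof. exact: leq_subr. Qed.

Lemma gamma_mono : {homo ga : i j / (i <= j)%N}.
Proof.
by move=> i j hij; apply/leq_sub2l/sum_tail_leq.
Qed.

Lemma gamma_n : ga n = e.
Proof. by rewrite /gamma big_geq // subn0. Qed.

Lemma gamma_succ j : (j < n)%N -> (\sum_(j.+1 <= k < n.+1) b k <= e)%N ->
  (ga j.+1 = ga j + b j.+1)%N.
Proof. by move=> hj; rewrite /gamma big_ltn //; lia. Qed.

End Gamma.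

Lemma pairmap_map_iota (f : nat -> nat -> int) (F : nat -> nat) m k :
  pairmap f (F m) [seq F i | i <- iota m.+1 k] = [seq f (F i) (F i.+1) | i <- iota m k].
Proof. by elim: k m => [|k IHk] m //=; rewrite IHk. Qed.

Section Betas.
Variables a b : nat -> nat.
Hypothesis sum_ab : (\sum_(1 <= i < e.-1) a i + \sum_(e.+1 <= j < n.+1) b j = e - 2)%N.
Local Notation y := (num_zero e a).
Local Notation be := (beta e a).
Local Notation ga := (gamma e n b).

Let sp := [seq x <- sorted_a e a | x != 0%N].
Let M := (e - 2 - y)%N.

Lemma sorted_leq_zeros (s : seq nat) : sorted leq s ->
  s = nseq (count_mem 0%N s) 0%N ++ [seq x <- s | x != 0%N].
Proof.
elim: s => [//|x s IHs] /= hs; have := IHs (path_sorted hs).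
case: eqVneq => [->|hx] /= e1; first by rewrite -e1.
have hall : all (fun z => z != 0%N) s.
  apply/allP => z hz; have := order_path_min leq_trans hs => /allP/(_ z hz).
  by move: hx; rewrite -!lt0n; apply: leq_trans.
have /eqP -> : count_mem 0%N s == 0%N.
  by rewrite -leqn0 leqNgt -has_count -all_predC.
by rewrite (all_filterP hall).
Qed.

Let sortedE : sorted_a e a = nseq y 0%N ++ sp.
Proof. by apply: sorted_leq_zeros; apply: sort_sorted; apply: leq_total. Qed.

Let size_sorted : size (sorted_a e a) = (e - 2)%N.
Proof. by rewrite size_sort size_map size_iota; lia. Qed.

Let size_sp : size sp = M.
Proof. by rewrite /M -size_sorted sortedE size_cat size_nseq addKn. Qed.

Let y_le : (y <= e - 2)%N.
Proof. by rewrite -size_sorted sortedE size_cat size_nseq leq_addr. Qed.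

Let beta_succ i : (i < M)%N -> (be i.+1 = be i + nth 0 sp i)%N.
Proof.
move=> hi; rewrite /beta big_nat_recr //=; congr (_ + _)%N.
by rewrite sortedE nth_cat size_nseq addnS /= ltnNge leq_addr /= addKn.
Qed.

Let beta0 : be 0 = 0%N.
Proof. by rewrite /beta big_geq. Qed.

Let betaE i : (i <= M)%N -> be i = (\sum_(0 <= k < i) nth 0 sp k)%N.
Proof.
elim: i => [|i IHi] hi; first by rewrite beta0 big_geq.
by rewrite beta_succ // IHi ?big_nat_recr // ltnW.
Qed.

Let sum_sp : (\sum_(0 <= k < M) nth 0 sp k = \sum_(1 <= i < e.-1) a i)%N.
Proof.
rewrite -size_sp -(big_nth 0%N xpredT id).
transitivity (\sum_(k <- sorted_a e a) k)%N.
  by rewrite sortedE big_cat big_nseq /= -[LHS]add0n; congr (_ + _)%N; elim: (y).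
by rewrite (perm_big _ (permEl (perm_sort _ _))) big_map.
Qed.

Let sp_pos i : (i < M)%N -> (0 < nth 0 sp i)%N.
Proof.
move=> hi; have : nth 0%N sp i \in sp by rewrite mem_nth // size_sp.
by rewrite mem_filter lt0n => /andP[].
Qed.

Let beta_mono i j : (i <= j <= M)%N -> (be i <= be j)%N.
Proof.
move=> /andP[hij hj]; rewrite !betaE //; last exact: leq_trans hj.
by rewrite [X in (_ <= X)%N](big_cat_nat (n := i)) //= leq_addr.
Qed.

Let beta_last : be M = (\sum_(1 <= i < e.-1) a i)%N.
Proof. by rewrite betaE. Qed.

Definition betas := [seq be i | i <- iota 0 M.+1].

Lemma betas_sorted : sorted ltn betas.
Proof.
apply/(sortedP 0%N) => i; rewrite size_map size_iota => hi.
rewrite !(nth_map 0%N) ?size_iota; try lia.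
rewrite !nth_iota ?add0n; try lia.
have hiM : (i < M)%N by lia.
by have := sp_pos hiM; rewrite beta_succ //; lia.
Qed.

Let betas_le c : c \in betas -> (c <= \sum_(1 <= i < e.-1) a i)%N.
Proof.
by move=> /mapP[i hi ->]; rewrite -beta_last beta_mono //; move: hi; rewrite mem_iota; lia.
Qed.

Lemma betas_lt c : c \in betas -> (c < e.-1)%N.
Proof. by move=> /betas_le; lia. Qed.

Lemma betas_gamma c j : c \in betas -> (e < j <= n)%N -> (c.+2 <= ga j)%N.
Proof.
move=> /betas_le hc hj; rewrite /gamma.
have : (\sum_(j.+1 <= k < n.+1) b k <= \sum_(e.+1 <= k < n.+1) b k)%N.
  by apply: sum_tail_leq; lia.
lia.
Qed.

Lemma betas_head : 0%N \in betas.
Proof. by rewrite /betas /= beta0 inE eqxx. Qed.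

Lemma betas_last : e = n -> (e - 2)%N \in betas.
Proof.
move=> een; have -> : (e - 2)%N = be M.
  by rewrite beta_last -sum_ab [X in (_ + X)%N]big_geq ?addn0 // een.
by apply: map_f; rewrite mem_iota; lia.
Qed.

Let kd := kdeg e.
Let f k l : int := kd k - (chain_q e ga l)%:Z + (chain_q e ga k)%:Z.

(** Consecutive exponents of t differ by the positive a_i, then by 2 + b_{e+1} at
    the passage from the quadrics Q to the products of coordinates, then by the
    b_j; the syzygies accordingly have degrees e + 2 - a_i and e - b_j. The
    coordinates off the chain account for the a_i that are 0. *)
Lemma betas_degrees :
  perm_eq (chain_degrees (kdeg e) (chain_q e ga) (head 0%N (chain e n betas))
             (behead (chain e n betas)) (chain_free e betas)) (E_degrees e n a b).
Proof.
have e_free : [seq kdeg e k | k <- chain_free e betas] = [seq e.+2%:Z - x%:Z | x <- nseq y 0%N].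
  have sz : size (chain_free e betas) = y.
    have := perm_size (@chain_perm e n he hen betas betas_sorted betas_lt).
    rewrite !size_cat !size_iota size_map size_iota.
    by move: y_le; rewrite /M; move: (size (chain_free _ _)) => w; lia.
  rewrite map_nseq -sz subr0; apply: (@eq_from_nth _ 0); rewrite ?size_map ?size_nseq // => i hi.
  rewrite nth_nseq hi (nth_map 0%N) // /kdeg ifT //.
  by have := mem_nth 0%N hi; rewrite mem_filter mem_iota add0n => /andP[_].
have e_chain : pairmap f 0%N (behead (chain e n betas))
    = [seq e.+2%:Z - x%:Z | x <- sp] ++ [seq e%:Z - (b j)%:Z | j <- index_iota e.+1 n.+1].
  have -> : behead (chain e n betas) = [seq be i | i <- iota 1 M] ++ iota e.-1 (n - e) by [].
  rewrite pairmap_cat; congr (_ ++ _).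
    rewrite -{1}beta0 pairmap_map_iota; apply: (@eq_from_nth _ 0).
      by rewrite !size_map size_iota size_sp.
    move=> i; rewrite size_map size_iota => hi.
    rewrite (nth_map 0%N) ?size_iota // nth_iota // add0n (nth_map 0%N) ?size_sp //.
    have h1 : be i.+1 \in betas by apply: map_f; rewrite mem_iota; lia.
    have h2 : be i \in betas by apply: map_f; rewrite mem_iota; lia.
    rewrite /f /kd /kdeg /chain_q !betas_lt //.
    by have := beta_succ hi; lia.
  have -> : last 0%N [seq be i | i <- iota 1 M] = be M.
    by case: (M) => [|m]; rewrite ?beta0 // -[m.+1]addn1 iotaD map_cat last_cat /= add1n addn1.
  rewrite /index_iota subSS; case hk : (n - e)%N => [//|k] /=.
  have hM : be M \in betas by apply: map_f; rewrite mem_iota; lia.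
  congr (_ :: _).
    rewrite /f /kd /kdeg /chain_q betas_lt // ltnn prednK; last by lia.
    have /= hg := @gamma_succ b e; rewrite /gamma beta_last.
    by move: sum_ab; rewrite [X in (_ + X)%N]big_ltn //; lia.
  rewrite -[iota (e.-1).+1 k]map_id (@pairmap_map_iota f id).
  have -> : e.+2 = (3 + e.-1)%N by lia.
  rewrite iotaDl -map_comp; apply/eq_in_map => l; rewrite mem_iota => hl.
  rewrite /f /kd /kdeg /chain_q /= !ifF; try lia.
  have hs : (\sum_(l.+3 <= k < n.+1) b k <= e)%N.
    have : (\sum_(l.+3 <= k < n.+1) b k <= \sum_(e.+1 <= k < n.+1) b k)%N.
      by apply: sum_tail_leq; lia.
    by move: sum_ab; lia.
  by rewrite (gamma_succ _ hs) ?add3n; lia.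
have hd0 : head 0%N (chain e n betas) = 0%N by rewrite /chain /betas /= beta0.
rewrite /chain_degrees hd0 -/f e_chain e_free /E_degrees.
rewrite perm_catAC perm_sym.
have -> : [seq e.+2%:Z - (a i)%:Z | i <- index_iota 1 e.-1]
  = [seq e.+2%:Z - x%:Z | x <- [seq a i | i <- index_iota 1 e.-1]] by rewrite -map_comp.
rewrite perm_cat2r -map_cat; apply: perm_map; rewrite perm_sym.
apply: perm_trans (permEl (perm_sort leq _)); rewrite -/(sorted_a e a) sortedE.
by rewrite perm_catC.
Qed.

End Betas.

Section OnlyGamma.
Variable b : nat -> nat.
Hypothesis he1 : (e < n - 1)%N.
Hypothesis sum_b : (\sum_(e.+2 <= j < n.+1) b j = e)%N.
Local Notation ga := (gamma e n b).

Lemma gamma_first : ga e.+1 = 0%N.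
Proof. by rewrite /gamma sum_b subnn. Qed.

(** Without quadrics Q in the chain the exponents of t start at 0 with the product
    of index e + 1, and all e - 1 coordinates of degree e + 2 are free. *)
Lemma gamma_degrees :
  perm_eq (chain_degrees (kdeg e) (chain_q e ga) (head 0%N (chain e n [::]))
             (behead (chain e n [::])) (chain_free e [::])) (E'_degrees e n b).
Proof.
have [k hk] : exists k, (n - e = k.+1)%N by exists (n - e).-1; lia.
rewrite /chain cat0s hk /= /chain_degrees /E'_degrees perm_catC; apply/seq.permP => P.
congr (count P _); congr (_ ++ _).
  rewrite /chain_free filter_predT; apply: (@eq_from_nth _ 0).
    by rewrite size_map size_iota size_nseq.
  move=> i; rewrite size_map size_iota => hi.
  by rewrite nth_nseq hi (nth_map 0%N) ?size_iota // nth_iota // /kdeg add0n hi.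
rewrite -[iota (e.-1).+1 k]map_id (@pairmap_map_iota _ id) /index_iota.
have -> : (n.+1 - e.+2 = k)%N by lia.
have -> : e.+2 = (3 + e.-1)%N by lia.
rewrite iotaDl -map_comp; apply/eq_in_map => l; rewrite mem_iota => hl.
rewrite /kdeg /chain_q /= !ifF; try lia.
have hs : (\sum_(l.+3 <= k < n.+1) b k <= e)%N.
  by rewrite -[X in (_ <= X)%N]sum_b; apply: sum_tail_leq; lia.
by rewrite (gamma_succ _ hs) ?add3n; lia.
Qed.

End OnlyGamma.
End Numerology.

(** * Quadrics with prescribed normal bundle *)

Section Concrete.
Variables (K : closedFieldType) (e n : nat).
Hypotheses (he : (2 <= e)%N) (hen : (e <= n)%N).

Definition ratfrac : {rmorphism bform K -> ratfun K} := @FracField.tofrac (bform K).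

Lemma ratfrac_inj : injective ratfrac.
Proof. by move=> a b /eqP; rewrite /= tofrac_eq => /eqP. Qed.

Lemma realizes_chain_form B ga (d : seq int) : sorted ltn B ->
  (forall b, b \in B -> (b < e.-1)%N) -> {homo ga : i j / (i <= j)%N} ->
  (forall j, (ga j <= e)%N) ->
  (forall b j, b \in B -> (e < j <= n)%N -> (b.+2 <= ga j)%N) ->
  (0%N \in B \/ exists2 j, (e < j <= n)%N & ga j = 0%N) ->
  ((e - 2)%N \in B \/ exists2 j, (e < j <= n)%N & ga j = e) ->
  perm_eq (chain_degrees (kdeg e) (chain_q e ga) (head 0%N (chain e n B))
             (behead (chain e n B)) (chain_free e B)) d ->
  realizes e (chain_form K e n B ga) d.
Proof.
move=> h1 h2 h3 h4 h5 hh hl hd.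
have sm := @chain_form_smooth K e n he hen B ga h1 h2 h4 hh hl.
have id : in_curve_ideal e (chain_form K e n B ga) by apply: chain_form_ideal.
split.
- split; last exact: chain_form_dhomog.
  apply/eqP => F0; have := sm _ (on_curve_rnc e n (is_pt_infty K)).
  by case; split=> [|i]; rewrite F0 ?mderiv0 meval0.
- exact: id.
- exact: sm.
have sz : (0 < size (chain e n B))%N.
  rewrite /chain size_cat size_iota; case: hh => [hB|[j hj _]]; last by lia.
  by case: (B) hB.
have gi : gen_iso (normal_sheaf ratfrac e (chain_form K e n B ga)) (split_sheaf ratfrac d).
  by apply: chain_form_normal => //; apply: ratfrac_inj.
exact: (gen_iso_iso ratfrac gi).
Qed.

End Concrete.

Theorem theorem1p5 (K : closedFieldType) (e n : nat)
    (he : (2 <= e)%N) (hen : (e <= n)%N) :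
  (* (a) *)
  (forall a b : nat -> nat,
     (\sum_(1 <= i < e.-1) a i + \sum_(e.+1 <= j < n.+1) b j = e - 2)%N ->
     let y := num_zero e a in
     [/\ exists F : {mpoly K[n.+1]}, realizes e F (E_degrees e n a b),
         e = n ->
           realizes e
             (\sum_(0 <= i < (n - 2 - y).+1)
                 Qform K n (beta e a i + 1) (beta e a i + 2))
             (E_degrees e n a b)
       & (e < n)%N ->
           realizes e
             (\sum_(0 <= i < (e - 2 - y).+1)
                 Qform K n (beta e a i + 1) (beta e a i + 2)
              + \sum_(e.+1 <= j < n.+1)
                  xvar K n (gamma e n b j) * xvar K n j)
             (E_degrees e n a b)]) /\
  (* (b), direct part *)
  (forall (F : {mpoly K[n.+1]}) (d : seq int),
     is_quadric F -> contains_curve e F -> smooth_along_curve e F ->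
     omod_iso (normal_bundle e F) (split_bundle K d) ->
     (e - 1 <= count (fun k : int => (e%:Z < k)%R) d)%N ->
     [/\ (e < n - 1)%N,
         exists b : nat -> nat,
           (\sum_(e.+2 <= j < n.+1) b j = e)%N /\
           omod_iso (normal_bundle e F) (split_bundle K (E'_degrees e n b))
       & contains_curve_span e F]) /\
  (* (b), converse *)
  ((e < n - 1)%N ->
   forall b : nat -> nat,
     (\sum_(e.+2 <= j < n.+1) b j = e)%N ->
     (exists F : {mpoly K[n.+1]}, realizes e F (E'_degrees e n b)) /\
     realizes e
       (\sum_(e.+1 <= j < n.+1) xvar K n (gamma e n b j) * xvar K n j)
       (E'_degrees e n b)).
Proof.
have gen a b : (\sum_(1 <= i < e.-1) a i + \sum_(e.+1 <= j < n.+1) b j = e - 2)%N ->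
    realizes e (chain_form K e n (betas e a) (gamma e n b)) (E_degrees e n a b).
  move=> hab.
  apply: (realizes_chain_form K he hen).
  - exact: (betas_sorted he hen hab).
  - exact: (betas_lt he hen hab).
  - exact: gamma_mono.
  - exact: gamma_le.
  - exact: (betas_gamma he hen hab).
  - by left; apply: betas_head.
  - have [een|een] := eqVneq e n; first by left; apply: (betas_last he hen hab).
    by right; exists n; [lia | apply: gamma_n].
  - exact: (betas_degrees he hen hab).
have betasE a b F :
    F = \sum_(e.+1 <= j < n.+1) xvar K n (gamma e n b j) * xvar K n j ->
    \sum_(0 <= i < (e - 2 - num_zero e a).+1)
      Qform K n (beta e a i + 1) (beta e a i + 2) + F
    = chain_form K e n (betas e a) (gamma e n b).
  move=> ->; rewrite /chain_form /betas big_map /index_iota subn0; congr (_ + _).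
  by apply: eq_bigr => i _; rewrite addn1 addn2.
split; last split.
- move=> a b hab y; split; first by exists (chain_form K e n (betas e a) (gamma e n b)); apply: gen.
  + move=> een; have := gen a b hab; rewrite -(betasE _ _ 0) ?addr0 -?een //.
    by rewrite big_geq // een.
  + by move=> hn; rewrite (betasE _ _ _ (erefl _)); apply: gen.
- move=> F d [F0 F2] Fc Fs Fiso Fd.
  have [h1 [b hb hd]] := many_large_degrees (@ratfrac_inj K) he hen F2 Fc Fs Fiso Fd.
  split=> //.
    exists b; split=> //; apply: (sheaf_iso_trans Fiso (gen_iso_iso (ratfrac K) (split_sheaf_perm (ratfrac K) hd))).
  exact: (contains_span (@ratfrac_inj K) he hen F2 Fc Fiso Fd).
move=> hn b hb.
have R : realizes e (\sum_(e.+1 <= j < n.+1) xvar K n (gamma e n b j) * xvar K n j)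
    (E'_degrees e n b).
  have <- : chain_form K e n [::] (gamma e n b)
      = \sum_(e.+1 <= j < n.+1) xvar K n (gamma e n b j) * xvar K n j.
    by rewrite /chain_form big_nil add0r.
  apply: (realizes_chain_form K he hen) => //.
  - exact: gamma_mono.
  - exact: gamma_le.
  - by right; exists e.+1; [lia | apply: gamma_first].
  - by right; exists n; [lia | apply: gamma_n].
  - exact: gamma_degrees.
by split=> //; eexists; exact: R.
Qed.
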